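(* Let $\gamma\in(0,1)$ and $s\in(0,1)$, let $\mathsf{u}$ solve $\partial_t^\gamma \mathsf{u}+\mathcal{L}^s\mathsf{u}=f$ in $\Omega\times(0,T)$, $\mathsf{u}(0)=\mathsf{u}_0$ in $\Omega$, $\mathsf{u}=0$ on $\partial\Omega\times(0,T)$, and assume $\mathcal{A}(\mathsf{u}_0,f):=\|\mathsf{u}_0\|_{\mathbb{H}^s(\Omega)}+\|f\|_{H^2(0,T;\mathbb{H}^{-s}(\Omega))}<\infty$. Let $\mathcal{K}\in\mathbb{N}$, $\tau=T/\mathcal{K}$, $t_k=k\tau$, $a_j=(j+1)^{1-\gamma}-j^{1-\gamma}$, and for $0\le k\le\mathcal{K}-1$ define the fractional residual $$r_\gamma^{k+1}=\partial_t^\gamma\mathsf{u}(\cdot,t_{k+1})-\frac1{\Gamma(2-\gamma)}\sum_{j=0}^k a_j\,\frac{\mathsf{u}(\cdot,t_{k+1-j})-\mathsf{u}(\cdot,t_{k-j})}{\tau^\gamma}.$$ Then, for every $0<\theta<\tfrac12$, the residual $r_\gamma^\tau=\{r_\gamma^k\}$ satisfies $$\|r_\gamma^\tau\|_{L^2(0,T;\mathbb{H}^{-s}(\Omega))}\lesssim\tau^\theta\mathcal{A}(\mathsf{u}_0,f).$$ The hidden constant is independent of the data and $\tau$ but blows up as $\theta\uparrow\tfrac12$.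
   Context: $\Omega\subset\mathbb{R}^n$ ($n\ge1$) is open, bounded and connected with polyhedral boundary; $T>0$. $\mathcal{L}w=-\operatorname{div}(A\nabla w)+cw$ with $0\le c\in L^\infty(\Omega)$ and $A\in C^{0,1}(\Omega,GL(n,\mathbb{R}))$ symmetric and positive definite; it is assumed that $\|w\|_{H^2(\Omega)}\lesssim\|\mathcal{L}w\|_{L^2(\Omega)}$ for all $w\in H^2(\Omega)\cap H^1_0(\Omega)$. $\{(\lambda_k,\varphi_k)\}$ are the Dirichlet eigenpairs of $\mathcal{L}$ with $\{\varphi_k\}$ orthonormal basis of $L^2(\Omega)$; $\mathbb{H}^s(\Omega)=\{w=\sum_k w_k\varphi_k:\sum_k\lambda_k^sw_k^2=\|w\|_{\mathbb{H}^s(\Omega)}^2<\infty\}$, $\mathbb{H}^{-s}(\Omega)$ is its dual, $\mathcal{L}^sw=\sum_k\lambda_k^sw_k\varphi_k$. The Caputo derivative is $\partial_t^\gamma \mathsf{u}(x,t)=\frac1{\Gamma(1-\gamma)}\int_0^t (t-r)^{-\gamma}\partial_r\mathsf{u}(x,r)\,dr$. For a time-discrete sequence, the norm is $\|r^\tau\|_{L^2(0,T;\mathcal{X})}^2=\sum_{k=1}^{\mathcal{K}}\tau\|r^k\|_{\mathcal{X}}^2$ (i.e. the $L^2$ norm of the function equal to $r^k$ on $(t_{k-1},t_k]$). The relation $a\lesssim b$ means $a\le Cb$ with a nonessential constant $C$. *)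

(* Defs.v *)
From HB Require Import structures.
From mathcomp Require Import all_boot all_order all_algebra.
From mathcomp Require Import all_classical all_reals all_analysis.
Set Implicit Arguments.
Unset Strict Implicit.
Unset Printing Implicit Defensive.
Import Order.TTheory GRing.Theory Num.Theory.
Import numFieldNormedType.Exports.
Local Open Scope classical_set_scope.
Local Open Scope ring_scope.

(* The library has the product sigma-algebra on n.-tuples but no Lebesgue
   measure on R^n.  It is built on tuples by iterating the product measure and
   then transported to 'rV[R]_n, which carries the topology and the norm. *)

Section transport.
Context d1 d2 (T1 : measurableType d1) (T2 : measurableType d2) (R : realType).
Variables (m : {measure set T1 -> \bar R}).
Variables (f : T1 -> T2) (g : T2 -> T1).

Definition transport of sigma_finite setT m & measurable_fun setT f &
  measurable_fun setT g & cancel f g : set T2 -> \bar R := pushforward m f.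

Hypotheses (sfm : sigma_finite setT m) (mf : measurable_fun setT f)
  (mg : measurable_fun setT g).
Hypothesis fK : cancel f g.
Local Notation mu := (transport sfm mf mg fK).

Let mu0 : mu set0 = 0%E.
Proof. by rewrite /transport /pushforward preimage_set0 measure0. Qed.

Let mu_ge0 A : (0 <= mu A)%E.
Proof. exact: measure_ge0. Qed.

Let mu_sigma_additive : semi_sigma_additive mu.
Proof.
move=> F mF tF mUF; rewrite /transport /pushforward preimage_bigcup.
apply: measure_semi_sigma_additive.
- by move=> n; rewrite -[X in measurable X]setTI; exact: mf.
- apply/trivIsetP => /= i j _ _ ij; rewrite -preimage_setI.
  by move/trivIsetP : tF => /(_ _ _ _ _ ij) ->//; rewrite preimage_set0.
- by rewrite -preimage_bigcup -[X in measurable X]setTI; exact: mf.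
Qed.

HB.instance Definition _ :=
  isMeasure.Build _ _ _ mu mu0 mu_ge0 mu_sigma_additive.

Let mu_sigma_finite : sigma_finite setT mu.
Proof.
have [F TF Foo] := sfm.
exists (fun i => g @^-1` F i); first by rewrite -preimage_bigcup -TF preimage_setT.
move=> i; have [mF Fi] := Foo i; split.
  by rewrite -[X in measurable X]setTI; exact: mg.
rewrite /transport /pushforward -comp_preimage.
by rewrite (_ : g \o f = id) ?preimage_id//; apply/funext => x; exact: fK.
Qed.

HB.instance Definition _ :=
  Measure_isSigmaFinite.Build _ _ _ mu mu_sigma_finite.

End transport.

Lemma product_sigma_finite d1 d2 (T1 : measurableType d1)
    (T2 : measurableType d2) (R : realType)
    (m1 : {sigma_finite_measure set T1 -> \bar R})
    (m2 : {sigma_finite_measure set T2 -> \bar R}) :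
  sigma_finite setT (m1 \x m2)%E.
Proof.
have /sigma_finiteP[F [TF ndF Foo]] := sigma_finiteT m1.
have /sigma_finiteP[G [TG ndG Goo]] := sigma_finiteT m2.
exists (fun n => F n `*` G n).
  rewrite -setXTT TF TG predeqE => -[x y]; split.
    move=> [/= [n _ Fnx] [k _ Gky]]; exists (maxn n k) => //; split.
    - by move: x Fnx; exact/subsetPset/ndF/leq_maxl.
    - by move: y Gky; exact/subsetPset/ndG/leq_maxr.
  by move=> [n _ []/= ? ?]; split; exists n.
move=> k; have [? ?] := Foo k; have [? ?] := Goo k.
split; first exact: measurableX.
by rewrite product_measure1E// lte_mul_pinfty// ge0_fin_numE.
Qed.

Section lebesgue_tuple.
Context {R : realType}.
Local Notation mR := (measurableTypeR R).

Definition tcons n (p : mR * n.-tuple mR) : n.+1.-tuple mR :=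
  [tuple of p.1 :: p.2].

Lemma measurable_tcons n : measurable_fun [set: mR * n.-tuple mR] (@tcons n).
Proof. exact: (@measurable_cons _ _ _ _ fst n snd). Qed.

Lemma measurable_thead_behead n : measurable_fun [set: n.+1.-tuple mR]
  (fun t => (thead t, [tuple of behead t]) : mR * n.-tuple mR).
Proof.
apply/measurable_fun_pairP; split; first exact: measurable_tnth.
exact: measurable_behead.
Qed.

Lemma tconsK n : cancel (@tcons n) (fun t => (thead t, [tuple of behead t])).
Proof. by move=> [x t]; rewrite /= theadE; congr pair; apply/val_inj. Qed.

Definition lebesgue_step n
    (m : {sigma_finite_measure set (n.-tuple mR) -> \bar R}) :
    {sigma_finite_measure set (n.+1.-tuple mR) -> \bar R} :=
  let leb1 : {sigma_finite_measure set mR -> \bar R} := @lebesgue_measure R in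
  transport (product_sigma_finite leb1 m)
    (@measurable_tcons n) (@measurable_thead_behead n) (@tconsK n).

Definition lebesgue_base : {sigma_finite_measure set (0.-tuple mR) -> \bar R} :=
  \d_ [tuple].

Fixpoint lebesgue_tuple n : {sigma_finite_measure set (n.-tuple mR) -> \bar R} :=
  if n is m.+1 then lebesgue_step (lebesgue_tuple m) else lebesgue_base.

Definition row_of_tuple n (t : n.-tuple mR) : 'rV[R]_n := \row_i tnth t i.

Definition measurable_rV n (A : set 'rV[R]_n) :=
  measurable (@row_of_tuple n @^-1` A).

Lemma measurable_rV0 n : @measurable_rV n set0.
Proof. by rewrite /measurable_rV preimage_set0; exact: measurable0. Qed.

Lemma measurable_rVC n (A : set 'rV[R]_n) :
  measurable_rV A -> measurable_rV (~` A).
Proof. by rewrite /measurable_rV preimage_setC; exact: measurableC. Qed.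

Lemma measurable_rV_bigcup n (F : (set 'rV[R]_n)^nat) :
  (forall i, measurable_rV (F i)) -> measurable_rV (\bigcup_i F i).
Proof.
by move=> mF; rewrite /measurable_rV preimage_bigcup; exact: bigcupT_measurable.
Qed.

End lebesgue_tuple.

Definition rV_display : measure_display. Proof. by constructor. Qed.

HB.instance Definition _ (R : realType) (n : nat) :=
  @isMeasurable.Build rV_display 'rV[R]_n (@measurable_rV R n)
    (@measurable_rV0 R n) (@measurable_rVC R n) (@measurable_rV_bigcup R n).

Section lebesgue_rV.
Context {R : realType}.
Variable n : nat.
Local Notation mR := (measurableTypeR R).

Definition tuple_of_row (x : 'rV[R]_n) : n.-tuple mR := [tuple x ord0 i | i < n].

Lemma row_of_tupleK : cancel (@row_of_tuple R n) tuple_of_row.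
Proof. by move=> t; apply/eq_from_tnth => i; rewrite tnth_mktuple mxE. Qed.

Lemma measurable_row_of_tuple : measurable_fun setT (@row_of_tuple R n).
Proof. by move=> _ A mA; rewrite setTI. Qed.

Lemma measurable_tuple_of_row : measurable_fun setT tuple_of_row.
Proof.
move=> _ A mA; rewrite setTI /measurable/= /measurable_rV -comp_preimage.
rewrite (_ : tuple_of_row \o _ = id) ?preimage_id//.
by apply/funext => t; exact: row_of_tupleK.
Qed.

Definition lebesgue_rV : {sigma_finite_measure set 'rV[R]_n -> \bar R} :=
  transport (sigma_finiteT (lebesgue_tuple n))
    measurable_row_of_tuple measurable_tuple_of_row row_of_tupleK.

End lebesgue_rV.
Arguments lebesgue_rV {R} n.

Section test_functions.
Context {R : realType} {V : normedModType R}.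

(* All iterated directional derivatives exist and are continuous, which in
   finite dimension is C^oo smoothness. *)
Definition smooth (psi : V -> R) := forall vs : seq V,
  let g := foldr (fun v h => 'D_v h) psi vs in
  continuous g /\ forall x v, derivable g x v.

Definition test_function (U : set V) (psi : V -> R) :=
  smooth psi /\
  exists2 K, compact K /\ K `<=` U & forall x, ~ K x -> psi x = 0.

End test_functions.

Section domain.
Context {R : realType} {n : nat}.
Local Notation E := 'rV[R]_n.
Local Notation mu := (lebesgue_rV n).
Implicit Types (Omega : set E) (w v g c : E -> R) (G : 'I_n -> E -> R).

Definition polyhedron (P : set E) := exists (m : nat) (a : 'I_m -> E) (b : 'I_m -> R),
  P = [set x | forall j, \sum_i a j ord0 i * x ord0 i <= b j].

(* [closure Omega `\` Omega] is the boundary of the open set Omega; the faces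
   are bounded when Omega is. *)
Definition polyhedral_boundary Omega := exists (m : nat) (P : 'I_m -> set E),
  (forall j, polyhedron (P j)) /\
  closure Omega `\` Omega = \bigcup_(j in [set: 'I_m]) P j.

Definition L2 Omega w :=
  measurable_fun Omega w /\ mu.-integrable Omega (fun x => (w x ^+ 2)%:E).

Definition L2dot Omega w v : R := \int[mu]_(x in Omega) (w x * v x).

Definition L2normsq Omega w : \bar R := (\int[mu]_(x in Omega) (w x ^+ 2)%:E)%E.

Definition partial (i : 'I_n) w : E -> R := 'D_(delta_mx ord0 i) w.

Definition weak_partial Omega (i : 'I_n) w g := forall psi,
  test_function Omega psi -> L2dot Omega w (partial i psi) = - L2dot Omega g psi.

Definition H1 Omega w G := [/\ L2 Omega w, forall i, L2 Omega (G i) &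
  forall i, weak_partial Omega i w (G i)].

Definition H10 Omega w G := H1 Omega w G /\
  exists psi : nat -> E -> R, [/\ forall m, test_function Omega (psi m),
    L2normsq Omega (fun x => psi m x - w x) @[m --> \oo] --> 0%E &
    forall i, L2normsq Omega (fun x => partial i (psi m) x - G i x)
      @[m --> \oo] --> 0%E].

Definition H2 Omega w G (H : 'I_n -> 'I_n -> E -> R) :=
  H1 Omega w G /\ forall i, H1 Omega (G i) (H i).

Definition H2norm Omega w G (H : 'I_n -> 'I_n -> E -> R) : \bar R :=
  (((L2normsq Omega w + \sum_i L2normsq Omega (G i)) +
    \sum_i \sum_j L2normsq Omega (H i j)) `^ 2^-1)%E.

(* - div (A grad w) + c w = g in the sense of distributions, where G is the
   weak gradient of w. *)
Definition elliptic_op Omega (A : E -> 'M[R]_n) c w G g := forall psi,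
  test_function Omega psi ->
  \int[mu]_(x in Omega) (\sum_i \sum_j A x i j * G j x * partial i psi x
                         + c x * w x * psi x) = L2dot Omega g psi.

Definition admissible_coefficients Omega (A : E -> 'M[R]_n) c :=
  [/\ [lipschitz A x | x in Omega],
      forall x, Omega x -> A x \in unitmx /\ (A x)^T = A x,
      forall x, Omega x -> forall xi : E, xi != 0 ->
        0 < (xi *m A x *m xi^T) ord0 ord0,
      measurable_fun Omega c &
      exists M : R, {ae mu, forall x, Omega x -> 0 <= c x <= M}].

Definition H2_regular Omega (A : E -> 'M[R]_n) c := exists C : R,
  forall w G H g, H2 Omega w G H -> H10 Omega w G -> L2 Omega g ->
    elliptic_op Omega A c w G g ->
    (H2norm Omega w G H <= C%:E * (L2normsq Omega g) `^ 2^-1)%E.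

(* The eigenvalues need not be required to be positive: this follows from the
   positivity of A and c and the Poincare inequality on H^1_0(Omega). *)
Definition dirichlet_eigenbasis Omega (A : E -> 'M[R]_n) c
    (lam : nat -> R) (phi : nat -> E -> R) :=
  [/\ forall k, exists2 G, H10 Omega (phi k) G &
        elliptic_op Omega A c (phi k) G (fun x => lam k * phi k x),
      forall i j, L2dot Omega (phi i) (phi j) = (i == j)%:R &
      forall w, L2 Omega w ->
        L2normsq Omega (fun x => w x - \sum_(k < m) L2dot Omega w (phi k) * phi k x)
          @[m --> \oo] --> 0%E].

End domain.

Section spectral.
Context {R : realType} {n : nat}.
Local Notation E := 'rV[R]_n.
Local Notation functional := ((E -> R) -> R).
Local Notation leb := (@lebesgue_measure R).
Variables (Omega : set E) (lam : nat -> R) (phi : nat -> E -> R).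
Variable s : R.
Implicit Types (w v : E -> R) (F : functional) (f : R -> functional).

Definition Hs_norm w : \bar R :=
  ((\sum_(k <oo) ((lam k `^ s * L2dot Omega w (phi k) ^+ 2)%:E)) `^ 2^-1)%E.

Definition Hs w := L2 Omega w /\ (Hs_norm w < +oo)%E.

(* H^{-s}(Omega), the dual of H^s(Omega), consists of functionals defined on all
   functions but only constrained on H^s(Omega). *)
Definition dual_norm F : \bar R :=
  ereal_sup [set `|F w|%:E | w in [set w | Hs w /\ (Hs_norm w <= 1)%E]].

Definition Hms F :=
  (forall a w v, Hs w -> Hs v -> F (fun x => a * w x + v x) = a * F w + F v) /\
  (dual_norm F < +oo)%E.

(* L^2(Omega) is embedded in H^{-s}(Omega) through the pairing of L^2(Omega). *)
Definition of_L2 w : functional := L2dot Omega w.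

Definition Ls w : functional := fun v =>
  limn (series (fun k => lam k `^ s * L2dot Omega w (phi k) * L2dot Omega v (phi k))).

Section time.
Variable T : R.

(* Functions of time are represented by pointwise limits of simple functions, as
   every almost everywhere class of Bochner measurable functions can be. *)
Definition simple_in_time f := exists (p : nat) (B : 'I_p -> set R) (x : 'I_p -> functional),
  (forall i, measurable (B i) /\ Hms (x i)) /\
  forall t w, f t w = \sum_i \1_(B i) t * x i w.

Definition strongly_measurable f := exists S : nat -> R -> functional,
  (forall m, simple_in_time (S m)) /\
  forall t, 0 < t < T -> dual_norm (fun w => S m t w - f t w) @[m --> \oo] --> 0%E.

Definition Lp_Hms (p : nat) f :=
  [/\ forall t, 0 < t < T -> Hms (f t), strongly_measurable f &
      (\int[leb]_(t in `]0%R, T[) (dual_norm (f t) ^+ p) < +oo)%E].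

Definition weak_time_derivative f (f' : R -> functional) := forall psi : R -> R,
  test_function (`]0%R, T[%classic : set R) psi -> forall w, Hs w ->
  \int[leb]_(t in `]0%R, T[) (derive1 psi t * f t w) =
  - \int[leb]_(t in `]0%R, T[) (psi t * f' t w).

(* The norm of H^2(0,T;H^{-s}(Omega)); it is +oo when f is not in this space,
   and otherwise the infimum is over a singleton because weak derivatives are
   unique up to null sets. *)
Definition H2T_norm f : \bar R := ereal_inf [set N | exists f1 f2,
  [/\ Lp_Hms 2 f, Lp_Hms 2 f1 & Lp_Hms 2 f2] /\
  [/\ weak_time_derivative f f1, weak_time_derivative f1 f2 &
   N = ((\int[leb]_(t in `]0%R, T[) (dual_norm (f t) ^+ 2) +
         \int[leb]_(t in `]0%R, T[) (dual_norm (f1 t) ^+ 2) +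
         \int[leb]_(t in `]0%R, T[) (dual_norm (f2 t) ^+ 2)) `^ 2^-1)%E]].

End time.

Definition Gamma (a : R) : R :=
  \int[leb]_(x in `]0%R, +oo[) (x `^ (a - 1) * expR (- x)).

Variable gamma : R.

(* The Caputo derivative at time t of a function whose time derivative is du;
   the Bochner integral in H^{-s}(Omega) is evaluated on test elements. *)
Definition caputo (du : R -> functional) (t : R) : functional := fun w =>
  (Gamma (1 - gamma))^-1 *
  \int[leb]_(r in `]0%R, t[) ((t - r) `^ (- gamma) * du r w).

(* u is in W^{1,1}(0,T;H^{-s}(Omega)) with time derivative du, and is identified
   with its absolutely continuous representative, so that it has a value u(t) at
   every time and u(0) = u0.  The homogeneous Dirichlet condition is the membership
   of u(t) in H^s(Omega). *)
Definition solves (T : R) (u0 : E -> R) (f : R -> functional)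
    (u : R -> E -> R) (du : R -> functional) :=
  [/\ L2 Omega u0 /\ forall t, 0 <= t <= T -> L2 Omega (u t),
      Lp_Hms T 1 du,
      forall t, 0 <= t <= T -> forall w, Hs w ->
        of_L2 (u t) w = of_L2 u0 w + \int[leb]_(r in `]0%R, t[) du r w &
      {ae leb, forall t, 0 < t < T -> Hs (u t) /\
        forall w, Hs w -> caputo du t w + Ls (u t) w = f t w}].

Definition data_norm (T : R) (u0 : E -> R) (f : R -> functional) : \bar R :=
  (Hs_norm u0 + H2T_norm T f)%E.

(* Its index k stands for the time t_{k+1}; likewise for [residual] below. *)
Definition L1_scheme (tau : R) (u : R -> E -> R) (k : nat) : E -> R := fun x =>
  (Gamma (2 - gamma))^-1 * \sum_(j < k.+1)
    (j.+1%:R `^ (1 - gamma) - j%:R `^ (1 - gamma)) *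
    ((u ((k.+1 - j)%N%:R * tau) x - u ((k - j)%N%:R * tau) x) / tau `^ gamma).

Definition residual (tau : R) (u : R -> E -> R) (du : R -> functional) (k : nat)
    : functional :=
  fun w => caputo du (k.+1%:R * tau) w - of_L2 (L1_scheme tau u k) w.

Definition discrete_norm (tau : R) (K : nat) (r : nat -> functional) : \bar R :=
  ((\sum_(k < K) (tau%:E * dual_norm (r k) ^+ 2)) `^ 2^-1)%E.

End spectral.

(* Main.v *)
Require Import Defs.
From HB Require Import structures.
From mathcomp Require Import all_boot all_order all_algebra.
From mathcomp Require Import all_classical all_reals all_analysis.
From mathcomp Require Import measurable_realfun.
From mathcomp Require Import ring lra.
Set Implicit Arguments.
Unset Strict Implicit.
Unset Printing Implicit Defensive.
Import Order.TTheory GRing.Theory Num.Theory.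
Import numFieldNormedType.Exports.
Local Open Scope classical_set_scope.
Local Open Scope ring_scope.

(** Tested against [phi k], the equation becomes a scalar Volterra equation for v, the time
    derivative of the k-th coefficient of the solution, with parameter mu = lambda_k^s. The problem
    is to find bounds that are uniform in mu and strong enough at t = 0, where v behaves like
    t^(g-1) with g = gamma.

    The scalar equation is solved explicitly. Let [res g m] be the resolvent of the kernel m
    t^(g-1), that is t^(g-1) times a Mittag-Leffler function of -m t^g. Convolving the equation with
    it gives v, up to a constant factor, as b [res g m] plus the primitive of an integrable function
    ([mode_kernel], [mode_rep]); the weak time derivatives of f enter as ordinary primitives through
    [du_bois_reymond]. The decisive facts are that [res g m] is nonnegative, at most t^(g-1) and
    nonincreasing ([ml_ge0], [res_identity], [res_antitone]). Hence |v| <= B t^(g-1), and the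
    oscillations of v on the steps after the first add up to at most B tau^(g-1) ([mode_decay],
    [osc_sum]). Here B is a fixed multiple of mu |y0| plus the L^1 norms in time of the k-th
    coefficients of f, f' and f'', y0 being the coefficient of the initial datum ([mode_bound]).

    The L1 scheme is the Caputo integral with v replaced on each step by its mean. The deviation
    from the mean integrates to zero, so at level k an earlier step i contributes at most the
    oscillation of the kernel on that step times the L^1 deviation of v; for fixed i these kernel
    oscillations telescope when summed over k. Thus the sum over all levels of the absolute
    residuals of one mode is at most a constant times B, uniformly in tau ([residual_sum],
    [mode_estimate]). As the l^2 norm is at most the l^1 norm, the factor tau of the discrete norm
    then yields the rate tau^(1/2).

    The modes are recombined with the weights lambda_k^(-s). Bessel's inequality for functionals in
    H^(-s) bounds the weighted sum of the B_k^2 by the data ([bessel], [time_bessel_L1],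
    [mode_amplitude_sum]), and [dual_norm_le] recovers the dual norm from the modes
    ([residual_estimate]). Since tau <= T, the power tau^(1/2) is at most (1 + T) tau^theta for
    theta < 1/2. *)

(** * Affine changes of variable in the Lebesgue integral *)

Section affine.
Context {R : realType}.
Local Notation mR := (measurableTypeR R).
Local Notation leb := (@lebesgue_measure R).
Local Open Scope ereal_scope.

Lemma measurable_affine (a b : R) :
  measurable_fun [set: mR] (fun x => (a + b * x)%R : mR).
Proof.
by apply: measurable_funD; [exact: measurable_cst|apply: measurable_funM].
Qed.

(** Uniqueness of Lebesgue measure: the pushforward by the affine map, rescaled by |b|, gives
    half-open intervals their length. A negative slope only moves the closed endpoint to the other
    side. *)
Lemma lebesgue_measure_affine (a b : R) (A : set R) : b != 0%R -> measurable A ->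
  leb ((fun x => a + b * x)%R @^-1` A) = `|b|^-1%:E * leb A.
Proof.
move=> b0 mA.
have [p pE] : {p : {measure set mR -> \bar R} | forall A, p A = leb ((fun x => a + b * x)%R @^-1` A)}.
  by unshelve eexists (pushforward leb (fun x => (a + b * x)%R : mR)); 
    first exact: measurable_affine.
pose nb : {nonneg R} := NngNum (normr_ge0 b).
have -> : leb A = mscale nb p A.
  apply: (@lebesgue_measure_unique _ (mscale nb p)) => //= _ [[x y]] _ <-.
  rewrite /mscale/= pE/= lebesgue_measure_itv/= lte_fin.
  have [b_gt0|b_lt0] := ltP 0%R b.
    have -> : (fun x1 => a + b * x1)%R @^-1` `]x, y] = `]((x - a) / b)%R, ((y - a) / b)%R]%classic.
      apply/seteqP; split => z /=; rewrite !in_itv/=;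
      by rewrite ltr_pdivrMr// ler_pdivlMr// ltrBlDl lerBrDl [(z * b)%R]mulrC.
    rewrite lebesgue_measure_itv/= lte_fin ltr_pM2r ?invr_gt0// ltrD2r.
    case: ifPn => xy; last by rewrite mule0.
    by rewrite -!EFinB -EFinM; congr EFin; rewrite gtr0_norm//; field.
  have {}b_lt0 : (b < 0)%R by rewrite lt_neqAle b0.
  have -> : (fun x1 => a + b * x1)%R @^-1` `]x, y] = `[((y - a) / b)%R, ((x - a) / b)%R[%classic.
    apply/seteqP; split => z /=; rewrite !in_itv/=.
      rewrite andbC ler_ndivrMr// ltr_ndivlMr// ltrBlDl lerBrDl [(z * b)%R]mulrC//.
    by rewrite andbC ler_ndivrMr// ltr_ndivlMr// ltrBlDl lerBrDl [(z * b)%R]mulrC.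
  rewrite lebesgue_measure_itv/= lte_fin ltr_nM2r ?invr_lt0// ltrD2r.
  case: ifPn => xy; last by rewrite mule0.
  by rewrite -!EFinB -EFinM; congr EFin; rewrite ltr0_norm//; field.
rewrite /mscale/= pE muleA -EFinM mulVf ?mul1e//.
by rewrite normr_eq0.
Qed.

Lemma ge0_integral_affine (a b : R) (f : R -> \bar R) : b != 0%R ->
  measurable_fun setT f -> (forall x, 0 <= f x) ->
  \int[leb]_x f (a + b * x)%R = `|b|^-1%:E * \int[leb]_x f x.
Proof.
move=> b0 mf f0.
have /(_ setT) := @ge0_integral_pushforward _ _ mR mR R _ (measurable_affine a b) leb.
move=> /(_ f measurableT mf).
have ? : {in [set: mR], forall y : mR, 0 <= f y} by move=> y _; exact: f0.
move=> /(_ _)/esym; rewrite preimage_setT => -> //.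
have nb0 : (0 <= `|b|^-1)%R by rewrite invr_ge0.
rewrite -(@ge0_integral_mscale _ mR R leb setT measurableT (NngNum nb0) f)//.
apply: eq_measure_integral => //=.
  exact: measurable_affine.
move=> ? A mA _; rewrite /pushforward /mscale/=.
by rewrite lebesgue_measure_affine.
Qed.

End affine.

Section almost_everywhere.
Context {R : realType}.
Local Notation leb := (@lebesgue_measure R).
Implicit Types P Q S : R -> Prop.

Lemma ae_imp P Q : (forall x, P x -> Q x) ->
  {ae leb, forall x, P x} -> {ae leb, forall x, Q x}.
Proof. move=> PQ; apply: filterS; first exact: (ae_filter_ringOfSetsType leb). exact: PQ. Qed.

Lemma ae_imp2 P Q S : (forall x, P x -> Q x -> S x) ->
  {ae leb, forall x, P x} -> {ae leb, forall x, Q x} -> {ae leb, forall x, S x}.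
Proof. move=> PQ; apply: filterS2; first exact: (ae_filter_ringOfSetsType leb). exact: PQ. Qed.

Lemma aeT P : (forall x, P x) -> {ae leb, forall x, P x}.
Proof. move=> allP; apply: filterE; first exact: (ae_filter_ringOfSetsType leb). exact: allP. Qed.

End almost_everywhere.

(** * Convolution of nonnegative extended-valued functions on the line *)

Section convolution.
Context {R : realType}.
Local Notation mR := (measurableTypeR R).
Local Notation leb := (@lebesgue_measure R).
Local Open Scope ereal_scope.
Implicit Types f g h : R -> \bar R.

(** Values in the nonnegative extended reals make the algebra of convolution unconditional, by
    Tonelli. For causal functions this is the Volterra convolution over ]0, t[, see
    [conv_causalE]. *)
Definition conv f g (t : R) := \int[leb]_s (f (t - s)%R * g s).

Definition nnmeas f := measurable_fun setT f /\ forall x, 0 <= f x.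

Lemma measurable_subr (a : R) : measurable_fun [set: mR] (fun x => (a - x)%R : mR).
Proof.
have := measurable_affine a (-1)%R.
by under eq_fun do rewrite mulN1r.
Qed.

Lemma ge0_integral_subr (a : R) f : nnmeas f ->
  \int[leb]_x f (a - x)%R = \int[leb]_x f x.
Proof.
move=> [mf f0].
have := @ge0_integral_affine _ a (-1)%R f _ mf f0.
under eq_integral do rewrite mulN1r.
by move=> ->; rewrite ?oppr_eq0// normrN1 invr1 mul1e.
Qed.

Lemma ge0_integral_addr (a : R) f : nnmeas f ->
  \int[leb]_x f (x - a)%R = \int[leb]_x f x.
Proof.
move=> [mf f0].
have := @ge0_integral_affine _ (- a)%R 1%R f _ mf f0.
under eq_integral do rewrite mul1r addrC.
by move=> ->; rewrite// normr1 invr1 mul1e.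
Qed.

Lemma measurable_conv_integrand f g (t : R) : nnmeas f -> nnmeas g ->
  measurable_fun [set: mR] (fun s => f (t - s)%R * g s).
Proof.
move=> [mf _] [mg _]; apply: emeasurable_funM => //.
by apply: measurableT_comp => //; exact: measurable_subr.
Qed.

Lemma conv_ge0 f g t : nnmeas f -> nnmeas g -> 0 <= conv f g t.
Proof. by move=> [_ f0] [_ g0]; apply: integral_ge0 => s _; exact: mule_ge0. Qed.

Lemma nnmeas_conv f g : nnmeas f -> nnmeas g -> nnmeas (conv f g).
Proof.
move=> nf ng; split; last by move=> x; exact: conv_ge0.
have [mf f0] := nf; have [mg g0] := ng.
have := @measurable_fun_fubini_tonelli_F _ _ mR mR R leb
  (fun z => f (z.1 - z.2)%R * g z.2); apply => /=.
  apply: emeasurable_funM; last exact: measurableT_comp.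
  by apply: measurableT_comp => //; exact: measurable_funB.
by move=> x; exact: mule_ge0.
Qed.

Lemma convC f g : nnmeas f -> nnmeas g -> conv f g = conv g f.
Proof.
move=> nf ng; apply/funext => t; rewrite /conv.
rewrite -(@ge0_integral_subr t (fun s => f (t - s)%R * g s)).
  by apply: eq_integral => s _; rewrite subKr muleC.
split; first exact: measurable_conv_integrand.
by move=> s; apply: mule_ge0; [apply nf|apply ng].
Qed.

(** Tonelli, followed by a translation of the inner variable. *)
Lemma convA f g h : nnmeas f -> nnmeas g -> nnmeas h ->
  conv f (conv g h) = conv (conv f g) h.
Proof.
move=> nf ng nh; apply/funext => t; rewrite /conv.
have [mf f0] := nf; have [mg g0] := ng; have [mh h0] := nh.
transitivity (\int[leb]_s \int[leb]_r (f (t - s)%R * (g (s - r)%R * h r))).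
  apply: eq_integral => s _; rewrite ge0_integralZl//.
    exact: measurable_conv_integrand.
  by move=> r _; exact: mule_ge0.
transitivity (\int[leb]_r \int[leb]_s (f (t - s)%R * (g (s - r)%R * h r))).
  have := @fubini_tonelli _ _ mR mR R leb leb
    (fun z => f (t - z.1)%R * (g (z.1 - z.2)%R * h z.2)); apply => /=.
    apply: emeasurable_funM.
      apply: measurableT_comp => //.
      exact: (measurableT_comp (measurable_subr t)).
    apply: emeasurable_funM; last exact: measurableT_comp.
    by apply: measurableT_comp => //; exact: measurable_funB.
  by move=> x; rewrite !mule_ge0.
apply: eq_integral => r _.
rewrite -ge0_integralZr//; last 2 first.
  exact: (measurable_conv_integrand _ nf ng).
  by move=> s _; exact: mule_ge0.
rewrite -(@ge0_integral_addr r (fun s => f (t - r - s)%R * g s * h r)); last first.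
  split; last by move=> s; rewrite !mule_ge0.
  by apply: emeasurable_funM => //; exact: (measurable_conv_integrand _ nf ng).
apply: eq_integral => s _; rewrite muleA; congr (f _ * _ * _).
by rewrite opprB addrA subrK.
Qed.

Lemma convDr f g h : nnmeas f -> nnmeas g -> nnmeas h ->
  conv f (g \+ h) = conv f g \+ conv f h.
Proof.
move=> nf ng nh; apply/funext => t; rewrite /conv/=.
have [mf f0] := nf; have [mg g0] := ng; have [mh h0] := nh.
rewrite -ge0_integralD//; last 4 first.
  by move=> s _; exact: mule_ge0.
  exact: measurable_conv_integrand.
  by move=> s _; exact: mule_ge0.
  exact: measurable_conv_integrand.
by apply: eq_integral => s _; rewrite ge0_muleDr.
Qed.

Lemma nnmeasD f g : nnmeas f -> nnmeas g -> nnmeas (f \+ g).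
Proof.
move=> [mf f0] [mg g0]; split; first exact: emeasurable_funD.
by move=> x; exact: adde_ge0.
Qed.

Lemma nnmeasZ (c : R) f : (0 <= c)%R -> nnmeas f -> nnmeas (fun x => c%:E * f x).
Proof.
move=> c0 [mf f0]; split; first exact: emeasurable_funM.
by move=> x; rewrite mule_ge0.
Qed.

Lemma convZr (c : R) f g : (0 <= c)%R -> nnmeas f -> nnmeas g ->
  conv f (fun x => c%:E * g x) = (fun x => c%:E * conv f g x).
Proof.
move=> c0 nf ng; apply/funext => t; rewrite /conv/=.
have [mf f0] := nf; have [mg g0] := ng.
rewrite -ge0_integralZl//; last 2 first.
  exact: measurable_conv_integrand.
  by move=> s _; exact: mule_ge0.
by apply: eq_integral => s _; rewrite muleCA.
Qed.

Lemma convZl (c : R) f g : (0 <= c)%R -> nnmeas f -> nnmeas g ->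
  conv (fun x => c%:E * f x) g = (fun x => c%:E * conv f g x).
Proof. by move=> c0 nf ng; rewrite convC// ?convZr// ?(convC ng nf)//; exact: nnmeasZ. Qed.

Lemma convDl f g h : nnmeas f -> nnmeas g -> nnmeas h ->
  conv (g \+ h) f = conv g f \+ conv h f.
Proof.
by move=> nf ng nh; rewrite convC ?convDr// ?(convC nf)//; exact: nnmeasD.
Qed.

Definition causal f := forall t, (t <= 0)%R -> f t = 0.

Lemma conv_causalE f g t : causal f -> causal g ->
  conv f g t = \int[leb]_(s in `]0%R, t[) (f (t - s)%R * g s).
Proof.
move=> cf cg; rewrite /conv [RHS]integral_mkcond.
apply: eq_integral => s _; rewrite patchE; case: ifPn => // /negP.
rewrite inE/= in_itv/= => /negP; rewrite negb_and -!leNgt => /orP[s0|ts].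
  by rewrite cg// mule0.
by rewrite cf ?mul0e// subr_le0.
Qed.

Lemma causal_conv f g : causal f -> causal g -> causal (conv f g).
Proof.
by move=> cf cg t t0; rewrite conv_causalE// set_itv_ge ?integral_set0// bnd_simp -leNgt.
Qed.

Lemma ae_eq_conv f g h T : causal f -> nnmeas f -> nnmeas g -> nnmeas h ->
  causal g -> causal h ->
  {ae leb, forall t, (0 < t < T)%R -> g t = h t} ->
  forall t, (t <= T)%R -> conv f g t = conv f h t.
Proof.
move=> cf nf ng nh cg ch gh t tT; rewrite !conv_causalE//.
apply: ae_eq_integral => //.
- by apply: measurable_funTS; exact: measurable_conv_integrand.
- by apply: measurable_funTS; exact: measurable_conv_integrand.
move: gh; apply: ae_imp => s gh; rewrite /= in_itv/= => /andP[s0 st].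
by rewrite gh// s0 (lt_le_trans st).
Qed.

End convolution.

(** * Power kernels and the Beta integral *)

Section power_kernels.
Context {R : realType}.
Local Notation mR := (measurableTypeR R).
Local Notation leb := (@lebesgue_measure R).
Implicit Types a b t x y : R.

Lemma integral_powR_segment a x y : 0 < a -> 0 < x -> x < y ->
  (\int[leb]_(s in `[x, y]) (s `^ (a - 1))%:E = ((y `^ a - x `^ a) / a)%:E)%E.
Proof.
move=> a0 x0 xy.
have a_neq0 : a != 0 by rewrite gt_eqF.
have drv (z : R) : 0 < z -> is_derive z 1 (fun z : R => a^-1 * z `^ a) (z `^ (a - 1)).
  move=> z0; have -> : z `^ (a - 1) = a^-1 *: (a * z `^ (a - 1)).
    by rewrite /GRing.scale/= mulrA mulVf// mul1r.
  exact: (@is_deriveZ R _ _ (fun y : R => y `^ a) a^-1 z 1 _ (is_derive1_powR a z0)).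
rewrite (@continuous_FTC2 _ _ (fun z => a^-1 * z `^ a))//.
- by rewrite -EFinB; congr EFin; rewrite -mulrBr mulrC.
- apply: derivable_within_continuous => z; rewrite in_itv/= => /andP[xz _].
  by apply: derivable_powR; rewrite in_itv/= andbT (lt_le_trans x0).
- have cts (z : R) : 0 < z -> {for z, continuous (fun z : R => a^-1 * z `^ a)}.
    move=> z0; apply: differentiable_continuous; apply/derivable1_diffP.
    by have [] := drv _ z0.
  split.
  + move=> z; rewrite in_itv/= => /andP[xz _].
    by have [] := drv _ (lt_trans x0 xz).
  + by apply: cvg_at_right_filter; apply: cts.
  + by apply: cvg_at_left_filter; apply: cts; rewrite (lt_trans x0).
- move=> z; rewrite in_itv/= => /andP[xz _].
  by rewrite derive1E; have [_] := drv _ (lt_trans x0 xz).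
Qed.

(** The integrand may be singular at 0, so ]0, t] is exhausted by the segments [t/(n+2), t], on
    which the fundamental theorem of calculus applies; n+2 keeps them nondegenerate. *)
Lemma integral_powR a t : 0 < a -> 0 <= t ->
  (\int[leb]_(s in `]0%R, t[) (s `^ (a - 1))%:E = (t `^ a / a)%:E)%E.
Proof.
move=> a0; rewrite le_eqVlt => /predU1P[<-|t0].
  by rewrite set_itv_ge ?bnd_simp ?ltxx// integral_set0 powR0 ?mul0r// gt_eqF.
rewrite integral_itv_bndo_bndc; last first.
  by apply/measurable_EFinP; apply: measurable_funTS; exact: measurable_powR.
pose F n := `[n.+2%:R^-1 * t, t]%classic.
have FU : \bigcup_n F n = `]0, t]%classic.
  apply/seteqP; split => z /=.
    move=> [n _]; rewrite /F/= !in_itv/= => /andP[nz ->].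
    by rewrite (lt_le_trans _ nz)// mulr_gt0// invr_gt0.
  rewrite in_itv/= => /andP[z0 zt].
  have [n /ltW tz] : exists n, t / z < n.+2%:R.
    have [n _ /(_ n (leqnn _)) /= tzn] := nbhs_infty_gtr (t / z).
    by exists n; rewrite (lt_le_trans tzn)// ler_nat; do 2 apply: leqW.
  exists n => //; rewrite /F/= in_itv/= zt andbT.
  by rewrite mulrC ler_pdivrMr// mulrC -ler_pdivrMr.
have ndF : nondecreasing_seq F.
  move=> m n mn; apply/subsetPset => z; rewrite /F/= !in_itv/= => /andP[mz ->].
  rewrite andbT (le_trans _ mz)// ler_wpM2r//; first exact: ltW.
  by rewrite lef_pV2 ?posrE// ler_nat !ltnS.
have := @ge0_nondecreasing_set_cvg_integral _ mR R F (fun s => (s `^ (a - 1))%:E) leb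
  ndF _ _ _.
rewrite FU => /(_ _ _ _)/cvg_lim <- //; last 3 first.
- by move=> i; apply: measurable_itv.
- by move=> i; apply/measurable_EFinP; apply: measurable_funTS; exact: measurable_powR.
- by move=> i x _; rewrite lee_fin powR_ge0.
apply/cvg_lim => //.
have -> : (fun i => \int[leb]_(x in F i) (x `^ (a - 1))%:E)%E =
   (fun i => ((t `^ a - (i.+2%:R^-1 * t) `^ a) / a)%:E).
  apply/funext => i; rewrite integral_powR_segment//.
    by rewrite mulr_gt0// invr_gt0.
  by rewrite gtr_pMl// invf_lt1// ltr1n.
apply: cvg_EFin; first by near=> n.
rewrite -[in X in _ --> X](subr0 (t `^ a)).
apply: cvgMl; apply: cvgB; first exact: cvg_cst.
apply: (@cvg_comp _ _ _ (fun n : nat => n.+2%:R^-1 * t) (fun z => z `^ a) _ (0^'+)); last exact: powR_cvg0.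
have lim0 : n.+2%:R^-1 * t @[n --> \oo] --> (0 : R).
  rewrite -[X in _ --> X](mul0r t); apply: cvgMl.
  apply/gtr0_cvgV0; first by near=> n; rewrite ltr0n.
  apply/cvgryPge => B; near=> n.
  have : B <= n%:R by near: n; exact: nbhs_infty_ger.
  by move/le_trans; apply; rewrite ler_nat; do 2 apply: leqW.
move=> P; rewrite /at_right /within/= => -[e/= e0 Pe].
apply: (@filterS _ _ _ (fun n : nat => ball 0 e (n.+2%:R^-1 * t)) _ _
  (lim0 _ (nbhsx_ballx 0 e e0))) => n ne.
by apply: Pe => //=; rewrite mulr_gt0// invr_gt0.
Unshelve. all: by end_near. Qed.


Local Open Scope ereal_scope.

(** The Riemann-Liouville kernel without its factor 1/Gamma(a), extended by zero. [pw 1] is the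
    Heaviside function, so [conv (pw 1)] is integration from 0. *)
Definition pw a t : \bar R := if (0 < t)%R then (t `^ (a - 1))%:E else 0.

Lemma pwE a t : (0 < t)%R -> pw a t = (t `^ (a - 1))%:E.
Proof. by rewrite /pw => ->. Qed.

Lemma causal_pw a : causal (pw a).
Proof. by move=> t; rewrite /pw leNgt => /negbTE ->. Qed.

Lemma pw1E t : pw 1 t = (\1_(`]0%R, +oo[%classic) t)%:E.
Proof.
rewrite /pw indicE subrr powRr0; case: ifPn => t0.
  by rewrite mem_set//= in_itv/= t0.
by rewrite memNset//= in_itv/= andbT; exact/negP.
Qed.

Lemma nnmeas_pw a : nnmeas (pw a).
Proof.
split; last by move=> x; rewrite /pw; case: ifP => // _; rewrite lee_fin powR_ge0.
have -> : pw a = (fun t => (\1_(`]0%R, +oo[%classic) t)%:E * (t `^ (a - 1))%:E).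
  apply/funext => t; rewrite -pw1E /pw subrr powRr0.
  by case: ifP; rewrite ?mul1e ?mul0e.
apply: emeasurable_funM; apply/measurable_EFinP.
  by apply: measurable_indic; exact: measurable_itv.
exact: measurable_powR.
Qed.

Lemma conv_pw1E f t : causal f -> conv (pw 1) f t = \int[leb]_(s in `]0%R, t[) f s.
Proof.
move=> cf; rewrite conv_causalE//; last exact: causal_pw.
apply: eq_integral => s; rewrite inE/= in_itv/= => /andP[_ st].
by rewrite pwE ?subr_gt0// subrr powRr0 mul1e.
Qed.

Lemma conv_pw1 a t : (0 < a)%R -> (0 <= t)%R ->
  conv (pw 1) (pw a) t = (t `^ a / a)%:E.
Proof.
move=> a0 t0; rewrite conv_pw1E; last exact: causal_pw.
rewrite -integral_powR//; apply: eq_integral => s.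
by rewrite inE/= in_itv/= => /andP[s0 _]; rewrite pwE.
Qed.

(** The substitution s -> t s, both kernels being homogeneous. *)
Lemma conv_pw_scale a b t : (0 < t)%R ->
  conv (pw a) (pw b) t = (t `^ (a + b - 1))%:E * conv (pw a) (pw b) 1.
Proof.
move=> t0; rewrite /conv.
have nn : nnmeas (fun s => pw a (t - s)%R * pw b s).
  split; last by move=> x; apply: mule_ge0; apply nnmeas_pw.
  by apply: measurable_conv_integrand; exact: nnmeas_pw.
have -> : \int[leb]_x (pw a (t - x)%R * pw b x) =
    t%:E * \int[leb]_x (pw a (t - t * x)%R * pw b (t * x)%R).
  have := @ge0_integral_affine _ 0%R t _ (lt0r_neq0 t0) nn.1 nn.2.
  have -> : `|t|%R = t by rewrite gtr0_norm.
  under eq_integral do rewrite add0r.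
  by move=> ->; rewrite muleA -EFinM mulfV ?mul1e ?gt_eqF.
have nn' : nnmeas (fun s => pw a (t - t * s)%R * pw b (t * s)%R).
  split; last by move=> x; apply: mule_ge0; apply nnmeas_pw.
  have := measurableT_comp nn.1 (measurable_affine 0 t).
  by under [X in measurable_fun _ X]eq_fun do rewrite /= add0r.
transitivity (\int[leb]_x (t%:E * (pw a (t - t * x)%R * pw b (t * x)%R))).
  by rewrite ge0_integralZl//; [exact: nn'.1|move=> x _; exact: nn'.2|rewrite lee_fin ltW].
transitivity (\int[leb]_x ((t `^ (a + b - 1))%:E * (pw a (1 - x)%R * pw b x))); last first.
  rewrite ge0_integralZl//.
  - by apply: measurable_conv_integrand; exact: nnmeas_pw.
  - by move=> x _; apply: mule_ge0; apply nnmeas_pw.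
  - by rewrite lee_fin powR_ge0.
apply: eq_integral => s _.
have [s0|s0] := leP s 0%R.
  by rewrite !(causal_pw _ (t := s))// (causal_pw _ (t := (t * s)%R)) ?mule0// pmulr_rle0.
have [s1|s1] := leP 1%R s.
  rewrite (causal_pw _ (t := (1 - s)%R)) ?subr_le0//.
  by rewrite (causal_pw _ (t := (t - t * s)%R)) ?mul0e ?mule0// subr_le0 ler_pMr.
rewrite !pwE ?subr_gt0// ?mulr_gt0// ?gtr_pMr// -?EFinM; congr EFin.
have -> : (t - t * s = t * (1 - s))%R by rewrite mulrBr mulr1.
have -> : (a + b - 1 = 1 + (a - 1) + (b - 1))%R by ring.
have t_neq0 : t != 0%R by rewrite gt_eqF.
rewrite (@powRD _ t (1 + (a - 1))%R) ?t_neq0 ?implybT// (@powRD _ t 1%R) ?t_neq0 ?implybT//.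
rewrite powRr1 ?ltW// !powRM ?subr_ge0 ?ltW//; ring.
Qed.

Lemma powR_le_half p x : (2^-1 <= x)%R -> (x <= 1)%R -> (x `^ p <= 1 + 2 `^ (- p))%R.
Proof.
move=> x2 x1; have x0 : (0 < x)%R by rewrite (lt_le_trans _ x2)// invr_gt0.
have [p0|p0] := leP 0%R p.
  rewrite (@le_trans _ _ 1%R)//; last by rewrite lerDl powR_ge0.
  by rewrite -(powRr0 x); apply: ger_powR; rewrite // x0.
rewrite (@le_trans _ _ (2 `^ (- p))%R)//; last by rewrite lerDr.
have -> : (x `^ p = (x `^ (- p))^-1)%R by rewrite powRN invrK.
have -> : (2 `^ (- p) = ((2^-1) `^ (- p))^-1 :> R)%R.
  by rewrite -[2^-1%R]powR_inv1// -powRrM mulN1r opprK powRN.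
rewrite lef_pV2 ?posrE ?powR_gt0 ?invr_gt0//.
by apply: ge0_ler_powR => //; rewrite ?nnegrE ?oppr_ge0 ?invr_ge0// ltW.
Qed.

(** Each half of ]0, 1[ carries the singularity of only one factor; on that half the other factor is
    bounded by [powR_le_half]. *)
Lemma conv_pw_le a b : (0 < a)%R -> (0 < b)%R ->
  conv (pw a) (pw b) 1 <= ((1 + 2 `^ (- (a - 1))) / b + (1 + 2 `^ (- (b - 1))) / a)%:E.
Proof.
move=> a0 b0.
set ca := (1 + 2 `^ (- (a - 1)))%R; set cb := (1 + 2 `^ (- (b - 1)))%R.
have ca0 : (0 <= ca)%R by rewrite addr_ge0// powR_ge0.
have cb0 : (0 <= cb)%R by rewrite addr_ge0// powR_ge0.
have nca : nnmeas (fun x => ca%:E * pw 1 x) by apply: nnmeasZ => //; exact: nnmeas_pw.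
have ncb : nnmeas (fun x => cb%:E * pw 1 x) by apply: nnmeasZ => //; exact: nnmeas_pw.
have -> : (ca / b + cb / a)%:E =
    conv (fun x => ca%:E * pw 1 x) (pw b) 1 + conv (fun x => cb%:E * pw 1 x) (pw a) 1.
  rewrite !convZl//; try exact: nnmeas_pw.
  by rewrite !conv_pw1// !powR1 !mul1r.
rewrite [conv _ (pw a)]convC; try by [exact: nnmeas_pw|apply: nnmeasZ => //; exact: nnmeas_pw].
rewrite /conv -ge0_integralD//; last 4 first.
- by move=> x _; rewrite !mule_ge0//; apply nnmeas_pw.
- exact: (measurable_conv_integrand _ nca (nnmeas_pw _)).
- by move=> x _; rewrite !mule_ge0//; apply nnmeas_pw.
- exact: (measurable_conv_integrand _ (nnmeas_pw _) ncb).
apply: ge0_le_integral => //.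
- by move=> x _; rewrite !mule_ge0//; apply nnmeas_pw.
- by apply: measurable_conv_integrand; exact: nnmeas_pw.
- apply: emeasurable_funD.
    exact: (measurable_conv_integrand _ nca (nnmeas_pw _)).
  exact: (measurable_conv_integrand _ (nnmeas_pw _) ncb).
move=> s _.
have [s0|s0] := leP s 0%R.
  by rewrite !(causal_pw _ (t := s))// !mule0 adde0.
have [s1|s1] := leP 1%R s.
  by rewrite !(causal_pw _ (t := (1 - s)%R)) ?subr_le0// !mule0 !mul0e adde0.
rewrite !pwE ?subr_gt0// !subrr !powRr0 -!EFinM -EFinD lee_fin !mulr1.
have [s2|s2] := leP s (2^-1)%R.
  rewrite (@le_trans _ _ (ca * s `^ (b - 1))%R)//; last by rewrite lerDl mulr_ge0// powR_ge0.
  apply: ler_wpM2r; first exact: powR_ge0.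
  by apply: powR_le_half; lra.
rewrite (@le_trans _ _ ((1 - s) `^ (a - 1) * cb)%R)//; last by rewrite lerDr mulr_ge0// powR_ge0.
apply: ler_wpM2l; first exact: powR_ge0.
by apply: powR_le_half; lra.
Qed.

(** Euler's Beta integral; for positive arguments it is finite by [conv_pw_le], so [fine] loses
    nothing ([BetaE]). *)
Definition Beta a b : R := fine (conv (pw a) (pw b) 1).

Lemma conv_pw1_ge0 a b t : 0 <= conv (pw a) (pw b) t.
Proof. by apply: conv_ge0; exact: nnmeas_pw. Qed.

Lemma BetaE a b : (0 < a)%R -> (0 < b)%R -> conv (pw a) (pw b) 1 = (Beta a b)%:E.
Proof.
move=> a0 b0; rewrite /Beta fineK// ge0_fin_numE ?conv_pw1_ge0//.
by rewrite (le_lt_trans (conv_pw_le _ _))// ltry.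
Qed.

Lemma conv_pw a b t : (0 < a)%R -> (0 < b)%R -> (0 < t)%R ->
  conv (pw a) (pw b) t = (Beta a b * t `^ (a + b - 1))%:E.
Proof. by move=> a0 b0 t0; rewrite conv_pw_scale// BetaE// -EFinM mulrC. Qed.

Lemma BetaC a b : Beta a b = Beta b a.
Proof. by rewrite /Beta convC//; exact: nnmeas_pw. Qed.

Lemma Beta_ge0 a b : (0 <= Beta a b)%R.
Proof. by rewrite fine_ge0// conv_pw1_ge0. Qed.

Lemma Beta_gt0 a b : (0 < a < 1)%R -> (0 < b < 1)%R -> (0 < Beta a b)%R.
Proof.
move=> /andP[a0 a1] /andP[b0 b1].
have : (1 / b)%:E <= conv (pw a) (pw b) 1.
  have <- : conv (pw 1) (pw b) 1 = (1 / b)%:E by rewrite conv_pw1// powR1.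
  apply: ge0_le_integral => //.
  - by move=> x _; rewrite !mule_ge0//; apply nnmeas_pw.
  - by apply: measurable_conv_integrand; exact: nnmeas_pw.
  - by apply: measurable_conv_integrand; exact: nnmeas_pw.
  move=> s _; have [s0|s0] := leP s 0%R.
    by rewrite !(causal_pw _ (t := s))// !mule0.
  apply: lee_wpmul2r; first by apply nnmeas_pw.
  rewrite /pw; case: ifP => // s1; rewrite lee_fin subrr powRr0.
  rewrite -[leLHS](powRr0 (1 - s)); apply: ger_powR; first by lra.
  by rewrite subr_le0 ltW.
rewrite BetaE// lee_fin; apply: lt_le_trans.
by rewrite divr_gt0.
Qed.

(** The integral is cut at distance d from the singular endpoint: farther away the singular factor
    is at most d^(a-1), closer to it the other factor is at most 1. A small d followed by a large b
    makes the bound small, which gives the series below an infinite radius of convergence. *)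
Lemma Beta_le a b (d : R) : (0 < a <= 1)%R -> (1 <= b)%R -> (0 < d <= 1)%R ->
  (Beta a b <= d `^ (a - 1) / b + d `^ a / a)%R.
Proof.
move=> /andP[a0 a1] b1 /andP[d0 d1].
have b0 : (0 < b)%R by exact: lt_le_trans b1.
rewrite -lee_fin -BetaE//.
have nd : nnmeas (fun x => (d `^ (a - 1))%:E * pw 1 x).
  by apply: nnmeasZ => //; [exact: powR_ge0|exact: nnmeas_pw].
have -> : (d `^ (a - 1) / b + d `^ a / a)%:E =
    conv (fun x => (d `^ (a - 1))%:E * pw 1 x) (pw b) 1 + conv (pw 1) (pw a) d.
  rewrite !convZl//; try exact: nnmeas_pw; last exact: powR_ge0.
  by rewrite !conv_pw1// ?(ltW d0)// !powR1 !mul1r.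
have nnf : nnmeas (fun s => pw 1 (d - s)%R * pw a s).
  split; last by move=> x; apply: mule_ge0; apply nnmeas_pw.
  by apply: measurable_conv_integrand; exact: nnmeas_pw.
have mf2 : measurable_fun setT (fun x => pw 1 (d - (1 - x))%R * pw a (1 - x)%R).
  exact: (measurableT_comp nnf.1 (measurable_subr 1)).
rewrite /conv -[X in _ + X](ge0_integral_subr 1 nnf)// -ge0_integralD//; last 3 first.
- by move=> x _; rewrite !mule_ge0//; [rewrite lee_fin powR_ge0|apply nnmeas_pw..].
- exact: (measurable_conv_integrand _ nd (nnmeas_pw _)).
- by move=> x _; exact: nnf.2.
apply: ge0_le_integral => //.
- by move=> x _; rewrite !mule_ge0//; apply nnmeas_pw.
- by apply: measurable_conv_integrand; exact: nnmeas_pw.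
- apply: emeasurable_funD => //.
  exact: (measurable_conv_integrand _ nd (nnmeas_pw _)).
move=> s _.
have [s0|s0] := leP s 0%R.
  by rewrite !(causal_pw _ (t := s))// !mule0 add0e; exact: nnf.2.
have [s1|s1] := leP 1%R s.
  by rewrite !(causal_pw _ (t := (1 - s)%R)) ?subr_le0// !(mule0,mul0e) adde0.
rewrite (pwE _ (t := s))// !(pwE _ (t := (1 - s)%R)) ?subr_gt0// subrr powRr0 mule1.
have [s2|s2] := leP d (1 - s)%R.
  rewrite (@le_trans _ _ ((d `^ (a - 1))%:E * (s `^ (b - 1))%:E))//.
    rewrite -!EFinM lee_fin ler_wpM2r ?powR_ge0//.
    rewrite -[X in (X <= _)%R]invrK -[X in (_ <= X)%R]invrK lef_pV2 ?posrE ?invr_gt0 ?powR_gt0//; last by rewrite subr_gt0.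
    rewrite -!powRN; apply: ge0_ler_powR; rewrite ?nnegrE; lra.
  by rewrite leeDl// mule_ge0//; [apply nnmeas_pw|rewrite lee_fin powR_ge0].
rewrite [leRHS]addeC pwE ?subr_gt0// subrr powRr0 mul1e.
rewrite (@le_trans _ _ ((1 - s) `^ (a - 1))%:E)//; last first.
  by rewrite leeDl// mule_ge0// lee_fin powR_ge0.
rewrite -EFinM lee_fin ler_piMr ?powR_ge0//.
by rewrite -[leRHS](powRr0 s); apply: ger_powR; [rewrite s0 ltW|rewrite subr_ge0].
Qed.

End power_kernels.

(** * Everywhere convergent power series with nonnegative coefficients *)

Section positive_series.
Context {R : realType}.
Implicit Types (a c : nat -> R) (x : R).

Lemma ratio_half_cvg a N : (forall n, 0 <= a n) ->
  (forall n, (N <= n)%N -> a n.+1 <= a n / 2) -> cvgn (series a).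
Proof.
(* [M] dominates a_n 2^n for n <= N, and beyond N the ratio hypothesis keeps a_n 2^n
   nonincreasing. *)
move=> a0 aN; pose M := \sum_(i < N.+1) a i * 2 ^+ i.
have M0 i : 0 <= a i * 2 ^+ i by rewrite mulr_ge0.
apply: (@series_le_cvg _ _ (geometric M 2^-1)) => // [n|n|].
- by rewrite mulr_ge0// sumr_ge0.
- rewrite /geometric/= exprVn ler_pdivlMr ?exprn_gt0//.
  have [nN|Nn] := ltnP n N.+1.
    by rewrite /M (bigD1 (Ordinal nN))//= lerDl sumr_ge0.
  rewrite -(subnKC Nn); elim: (n - N.+1)%N => [|k ih].
    rewrite addn0 /M (bigD1 ord_max)//= (@le_trans _ _ (a N * 2 ^+ N))//.
      by rewrite exprS mulrA ler_wpM2r// -ler_pdivlMr// aN.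
    by rewrite lerDl sumr_ge0.
  apply: le_trans ih; rewrite addnS exprS mulrA ler_wpM2r// -ler_pdivlMr//.
  by rewrite aN// leqW// leq_addr.
- by apply: is_cvg_geometric_series; rewrite ger0_norm// invf_lt1// ltr1n.
Qed.

(** Since n+1 <= 2^(n+1), the differentiated series at x is dominated by the original one at
    2(x+1). *)
Lemma entire_diffs c : (forall n, 0 <= c n) ->
  (forall x, 0 <= x -> cvgn (pseries c x)) ->
  forall x, 0 <= x -> cvgn (pseries (pseries_diffs c) x).
Proof.
move=> c0 cvgc x x0.
have dx0 : 0 <= 2 * (x + 1) by rewrite mulr_ge0// addr_ge0.
have /cvg_ex[l] := cvgc _ dx0; rewrite /pseries -cvg_shiftS => cl.
apply: (@series_le_cvg _ _ (fun n => c n.+1 * (2 * (x + 1)) ^+ n.+1)) => [n|n|n|].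
- by rewrite /pseries_diffs !mulr_ge0// exprn_ge0.
- by rewrite mulr_ge0// exprn_ge0.
- rewrite /pseries_diffs/= [X in X * _]mulrC -mulrA ler_wpM2l// exprMn.
  rewrite ler_pM// ?exprn_ge0//.
    by rewrite -natrX ler_nat ltnW// ltn_expl.
  rewrite exprS (@le_trans _ _ ((x + 1) ^+ n))//.
    by apply: lerXn2r; rewrite ?nnegrE ?addr_ge0// lerDl.
  by rewrite ler_peMl ?exprn_ge0 ?addr_ge0// lerDr.
- apply/cvg_ex; exists (l - c 0%N).
  have -> : series (fun n => c n.+1 * (2 * (x + 1)) ^+ n.+1) =
     (fun n => series (fun i => c i * (2 * (x + 1)) ^+ i) n.+1 - c 0%N).
    by apply/funext => n; rewrite /series/= big_nat_recl//= expr0 mulr1 addrAC subrr add0r.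
  by apply: cvgB => //; exact: cvg_cst.
Qed.

Lemma entire_continuous c : (forall n, 0 <= c n) ->
  (forall x, 0 <= x -> cvgn (pseries c x)) ->
  forall x, {for x, continuous (fun x => limn (pseries c x))}.
Proof.
move=> c0 cvgc x; have cvgd := entire_diffs c0 cvgc.
have d0 n : 0 <= pseries_diffs c n by rewrite mulr_ge0.
have nx : 0 <= `|x| + 1 by rewrite addr_ge0.
apply: differentiable_continuous; apply/derivable1_diffP.
have [] // := @pseries_snd_diffs _ c (`|x| + 1) x (cvgc _ nx) (cvgd _ nx).
- exact: entire_diffs.
- by rewrite (ger0_norm nx) ltrDl.
Qed.

End positive_series.

(** * The Mittag-Leffler function and its kernels *)

Section mittag_leffler.
Context {R : realType}.
Local Notation mR := (measurableTypeR R).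
Local Notation leb := (@lebesgue_measure R).
Variable g : R.
Hypothesis g01 : 0 < g <= 1.
Implicit Types (x t m : R).

Let g0 : 0 < g. Proof. by case/andP: g01. Qed.

(** In terms of the Gamma function this is Gamma(g)^(n+1) / Gamma((n+1)g), so [ml] below is x ->
    Gamma(g) E_{g,g}(-Gamma(g) x). The product of Beta values is the form in which convolution with
    [pw g] acts as an index shift. *)
Fixpoint ml_coef n : R := if n is k.+1 then ml_coef k * Beta g (k.+1%:R * g) else 1.

Lemma ml_coef_ge0 n : 0 <= ml_coef n.
Proof. by elim: n => //= n ih; rewrite mulr_ge0// Beta_ge0. Qed.

Lemma ml_coef_cvg x : 0 <= x -> cvgn (pseries ml_coef x).
Proof.
move=> x0.
(* The ratio of consecutive terms is x B(g, (n+1)g). This d makes the part of the Beta integral near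
   its singularity contribute at most 1/4. *)
have [d /andP[d0 d1] dg] : exists2 d : R, 0 < d <= 1 & x * (d `^ g / g) <= 4^-1.
  pose e : R := g / (4 * (x + 1)).
  have e0 : 0 < e by rewrite divr_gt0// mulr_gt0// ltr_pwDr.
  exists (Num.min 1 (e `^ g^-1)).
    by rewrite lt_min ltr01 powR_gt0//= ge_min lexx.
  rewrite (@le_trans _ _ (x * (e / g)))//.
    rewrite ler_wpM2l// ler_pM2r ?invr_gt0//.
    rewrite [leRHS](_ : e = (e `^ g^-1) `^ g); last first.
      by rewrite -powRrM mulVf ?gt_eqF// powRr1// ltW.
    apply: ge0_ler_powR; rewrite ?nnegrE ?(ltW g0)// ?powR_ge0//.
      by rewrite le_min ler01 powR_ge0.
    by rewrite ge_min lexx orbT.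
  rewrite /e mulrAC divff ?gt_eqF// mul1r ler_pdivrMr; first by lra.
  by rewrite mulr_gt0// ltr_pwDr.
(* For n beyond this threshold the other part contributes at most 1/4 too, and (n+1)g >= 1 as
   [Beta_le] asks. *)
pose B := 4 * x * d `^ (g - 1) / g + g^-1.
have [N _ BN] := nbhs_infty_ger B.
apply: (@ratio_half_cvg _ _ N) => [n|n Nn].
  by rewrite mulr_ge0// ?ml_coef_ge0// exprn_ge0.
have {}BN : B <= n%:R by exact: BN.
rewrite /= exprS -mulrA -[leRHS]mulrA ler_wpM2l ?ml_coef_ge0//.
rewrite mulrA [leRHS]mulrC ler_wpM2r ?exprn_ge0// mulrC.
have n1 : g^-1 <= n.+1%:R.
  rewrite (@le_trans _ _ B)// ?lerDr ?divr_ge0 ?mulr_ge0 ?powR_ge0 ?(ltW g0)//.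
  by rewrite (le_trans BN)// ler_nat.
have ng1 : 1 <= n.+1%:R * g by rewrite -ler_pdivrMr// mul1r.
have := @Beta_le _ g (n.+1%:R * g) d g01 ng1 _; rewrite d0 d1 => /(_ erefl).
move=> /(ler_wpM2l x0)/le_trans; apply.
rewrite mulrDr (_ : 2^-1 = 4^-1 + 4^-1 :> R); last by field.
rewrite lerD//.
rewrite mulrA ler_pdivrMr ?(lt_le_trans _ ng1)// mulrA.
rewrite -ler_pdivrMr// mulrC -ler_pdivrMl ?invr_gt0// invrK.
apply: le_trans (_ : B <= _); last by rewrite (le_trans BN)// ler_nat.
rewrite /B (_ : 4 * (g^-1 * _) = 4 * x * d `^ (g - 1) / g); last by ring.
by rewrite lerDl invr_ge0 ltW.
Qed.

(** Even ([false]) and odd ([true]) coefficients are kept in separate series: both have nonnegative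
    terms, so Tonelli applies to each, and the alternating sign appears only in the difference
    [ml]. *)
Definition ml_part (b : bool) n : R := if odd n == b then ml_coef n else 0.

Lemma ml_part_ge0 b n : 0 <= ml_part b n.
Proof. by rewrite /ml_part; case: ifP => // _; exact: ml_coef_ge0. Qed.

Lemma ml_partS b n : ml_part (~~ b) n.+1 = ml_part b n * Beta g (n.+1%:R * g).
Proof. by rewrite /ml_part/= eqb_negLR negbK; case: ifP; rewrite ?mul0r. Qed.

Lemma ml_part_cvg b x : 0 <= x -> cvgn (pseries (ml_part b) x).
Proof.
move=> x0; apply: series_le_cvg (ml_coef_cvg x0) => n.
- by rewrite mulr_ge0 ?ml_part_ge0// exprn_ge0.
- by rewrite mulr_ge0 ?ml_coef_ge0// exprn_ge0.
- rewrite ler_wpM2r ?exprn_ge0// /ml_part; case: ifP => // _; exact: ml_coef_ge0.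
Qed.

Definition ml x : R :=
  limn (pseries (ml_part false) x) - limn (pseries (ml_part true) x).

Lemma continuous_ml : continuous ml.
Proof.
have cts b : continuous (fun x => limn (pseries (ml_part b) x)).
  by move=> x; apply: entire_continuous => [|y]; [exact: ml_part_ge0|exact: ml_part_cvg].
by move=> x; apply: cvgB; exact: cts.
Qed.

Lemma limn_pseries0 (c : nat -> R) : limn (pseries c 0) = c 0%N.
Proof.
apply/cvg_lim => //; rewrite -cvg_shiftS /=.
suff -> : (fun n => pseries c 0 n.+1) = cst (c 0%N) by exact: cvg_cst.
apply/funext => n; rewrite /pseries /series/= big_nat_recl//= expr0 mulr1 big1 ?addr0// => i _.
by rewrite expr0n mulr0.
Qed.

Lemma ml0 : ml 0 = 1.
Proof. by rewrite /ml !limn_pseries0 /ml_part/= subr0. Qed.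

Local Open Scope ereal_scope.

(** The two nonnegative halves of t^(g-1) ml(m t^g), expanded in power kernels so that convolution
    acts term by term. *)
Definition ml_kernel b m t : \bar R :=
  \sum_(n <oo) (ml_part b n * m ^+ n)%:E * pw (n.+1%:R * g) t.

Section kernel.
Variables (m : R) (m0 : (0 <= m)%R).

Let coef_ge0 b n : (0 <= ml_part b n * m ^+ n)%R.
Proof. by rewrite mulr_ge0 ?ml_part_ge0// exprn_ge0. Qed.

Lemma nnmeas_ml_kernel b : nnmeas (ml_kernel b m).
Proof.
split.
  apply: ge0_emeasurable_sum => [n x _ _|n _].
    by rewrite mule_ge0// ?lee_fin//; apply nnmeas_pw.
  by have [] := nnmeasZ (coef_ge0 b n) (nnmeas_pw (n.+1%:R * g)).
by move=> x; apply: nneseries_ge0 => n _ _; rewrite mule_ge0// ?lee_fin//; apply nnmeas_pw.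
Qed.

Lemma causal_ml_kernel b : causal (ml_kernel b m).
Proof. by move=> t t0; apply: eseries0 => n _ _; rewrite causal_pw// mule0. Qed.

Lemma ml_kernelE b t : (0 < t)%R ->
  ml_kernel b m t = (t `^ (g - 1) * limn (pseries (ml_part b) (m * t `^ g)))%:E.
Proof.
move=> t0.
have mt0 : (0 <= m * t `^ g)%R by rewrite mulr_ge0// powR_ge0.
rewrite /ml_kernel EFinM -EFin_lim; last exact: ml_part_cvg.
rewrite /pseries.
have -> : EFin \o series (fun i => ml_part b i * (m * t `^ g) ^+ i)%R =
   (fun n => \sum_(0 <= i < n) (ml_part b i * (m * t `^ g) ^+ i)%:E).
  by apply/funext => n/=; rewrite sumEFin.
rewrite -nneseriesZl; last first.
  by move=> n _; rewrite lee_fin mulr_ge0 ?ml_part_ge0 ?exprn_ge0.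
apply: eq_eseriesr => n _; rewrite pwE// -!EFinM; congr EFin.
rewrite exprMn -(powR_mulrn n (powR_ge0 t g)) -powRrM.
have -> : (n.+1%:R * g - 1 = (g - 1) + g * n%:R)%R by rewrite -natr1; ring.
by rewrite powRD ?(gt_eqF t0) ?implybT//; ring.
Qed.

(** Convolution with [pw g] multiplies the n-th term by B(g, (n+1)g), the ratio of consecutive
    coefficients. It therefore shifts the index by one and exchanges the parities; the summand with
    [pw g] restores the missing index 0. *)
Lemma conv_ml_kernel b : (fun t => m%:E * conv (pw g) (ml_kernel b m) t) \+
  (fun t => (ml_part (~~ b) 0)%:E * pw g t) = ml_kernel (~~ b) m.
Proof.
apply/funext => t /=.
have npw (a : R) : nnmeas (pw a) := nnmeas_pw a.
have nterm c n : nnmeas (fun s => (ml_part c n * m ^+ n)%:E * pw (n.+1%:R * g) s).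
  by apply: nnmeasZ.
have [t0|t0] := leP t 0%R.
  rewrite causal_ml_kernel// causal_pw// (causal_conv (causal_pw _) (causal_ml_kernel b))//.
  by rewrite !mule0 adde0.
have -> : conv (pw g) (ml_kernel b m) t = \sum_(n <oo)
   conv (pw g) (fun s => (ml_part b n * m ^+ n)%:E * pw (n.+1%:R * g) s) t.
  rewrite /conv /ml_kernel -integral_nneseries//; last 2 first.
  - by move=> n; exact: (measurable_conv_integrand _ (npw g) (nterm b n)).
  - by move=> n s _; apply: mule_ge0; [apply npw|apply nterm].
  apply: eq_integral => s _.
  have [r ->] : exists r : R, pw g (t - s)%R = r%:E by rewrite /pw; case: ifP; eexists.
  by rewrite nneseriesZl// => n _; exact: (nterm b n).2.
rewrite [RHS]nneseries_recl//; last by move=> n _; exact: (nterm (~~ b) n).2.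
rewrite expr0 mulr1 mul1r [RHS]addeC; congr (_ + _).
rewrite -nneseriesZl; last by move=> n _; apply: conv_ge0.
rewrite -nneseries_addn; last by move=> n; exact: (nterm (~~ b) n).2.
apply: eq_eseriesr => n _; rewrite addn1.
rewrite convZr//= conv_pw// ?mulr_gt0// pwE// -!EFinM; congr EFin.
rewrite ml_partS exprS.
have -> : (g + n.+1%:R * g - 1 = n.+2%:R * g - 1)%R by rewrite -[n.+2%:R]natr1; ring.
by ring.
Qed.

Lemma ml_kernel_ge0 b t : 0 <= ml_kernel b m t.
Proof. exact: (nnmeas_ml_kernel b).2. Qed.

Lemma ml_kernel_false t :
  pw g t + m%:E * conv (pw g) (ml_kernel true m) t = ml_kernel false m t.
Proof. by rewrite -[RHS](congr1 (fun f => f t) (conv_ml_kernel true))/= /ml_part/= mul1e addeC. Qed.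

Lemma ml_kernel_true t :
  m%:E * conv (pw g) (ml_kernel false m) t = ml_kernel true m t.
Proof. by rewrite -[RHS](congr1 (fun f => f t) (conv_ml_kernel false))/= /ml_part/= mul0e adde0. Qed.

End kernel.

End mittag_leffler.

(** * Positivity and monotonicity of the resolvent kernel *)

Section mittag_leffler_pos.
Context {R : realType}.
Local Notation mR := (measurableTypeR R).
Local Notation leb := (@lebesgue_measure R).
Variable g : R.
Hypothesis g01 : 0 < g <= 1.
Implicit Types (x t m : R).

Let g0 : 0 < g. Proof. by case/andP: g01. Qed.

Local Open Scope ereal_scope.

Lemma ml_kernel_diff m t : (0 <= m)%R -> (0 < t)%R -> exists2 q : R,
  ml_kernel g true m t = q%:E &
  ml_kernel g false m t = (q + t `^ (g - 1) * ml g (m * t `^ g))%:E.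
Proof.
move=> m0 t0; rewrite !ml_kernelE//; eexists; first by [].
by congr EFin; rewrite /ml; ring.
Qed.

Lemma ml_kernel_cancel m (T : R) (rho : R -> \bar R) : (0 <= m)%R ->
  nnmeas rho -> causal rho ->
  (forall s, (0 < s < T)%R -> ml_kernel g false m s = ml_kernel g true m s + rho s) ->
  forall t, (t <= T)%R ->
  ml_kernel g false m t + m%:E * conv (pw g) rho t = ml_kernel g true m t + pw g t.
Proof.
move=> m0 nrho crho PQ t tT.
have nP := nnmeas_ml_kernel g m0 false; have nQ := nnmeas_ml_kernel g m0 true.
rewrite -(ml_kernel_true g01 m0) -(ml_kernel_false g01 m0).
rewrite (@ae_eq_conv _ (pw g) (ml_kernel g false m) (ml_kernel g true m \+ rho) T) //.
- rewrite convDr//; last exact: nnmeas_pw.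
  rewrite /= (@ge0_muleDr _ m%:E (conv _ _ _)); try by (apply: conv_ge0 => //; exact: nnmeas_pw).
  by rewrite [RHS]addeC addeA.
- exact: causal_pw.
- exact: nnmeas_pw.
- exact: nnmeasD.
- exact: causal_ml_kernel.
- by move=> s s0; rewrite /= causal_ml_kernel// crho// adde0.
- by apply: aeT => s; exact: PQ.
Qed.

Lemma ml_first_zero x : (0 <= x)%R -> (ml g x < 0)%R ->
  exists2 x0, (0 < x0)%R & (ml g x0 <= 0)%R /\ forall y, (0 <= y < x0)%R -> (0 < ml g y)%R.
Proof.
move=> x_ge0 mlx.
pose S := [set y | (0 <= y)%R /\ (ml g y <= 0)%R].
have S0 : S !=set0 by exists x; split => //; exact: ltW.
have lS : lbound S 0%R by move=> y [].
have hS : has_inf S by split => //; exists 0%R.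
have below y : (0 <= y < inf S)%R -> (0 < ml g y)%R.
  move=> /andP[y0 yS]; rewrite ltNge; apply/negP => mly.
  by have /(ge_inf (ex_intro _ _ lS)) : S y by []; rewrite leNgt yS.
have iS0 : (0 <= inf S)%R by apply: lb_le_inf.
have iS : (ml g (inf S) <= 0)%R.
  rewrite leNgt; apply/negP => mlS.
  have /cvgrPdist_lt/(_ _ mlS) := @continuous_ml _ _ g01 (inf S).
  case=> e /= e0 He.
  have [y [y0 mly] ySe] := inf_adherent e0 hS.
  have := He y; rewrite /ball/= => /(_ _).
  have yS : (inf S <= y)%R by apply: (ge_inf (ex_intro _ _ lS)); split.
  rewrite ler0_norm ?subr_le0// opprB ltrBlDl => /(_ ySe).
  by rewrite ltr_norml => /andP[_]; lra.
exists (inf S) => //.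
rewrite lt_neqAle iS0 andbT; apply/eqP => S_eq0; move: iS.
by rewrite -S_eq0 ml0 leNgt ltr01.
Qed.


Lemma continuous_powR_gt0 (p s : R) : (0 < s)%R ->
  {for s, continuous (fun s : R => (s `^ p)%R)}.
Proof.
move=> s0; apply: differentiable_continuous; apply/derivable1_diffP.
by apply: derivable_powR; rewrite in_itv/= s0.
Qed.

Lemma measurable_res_fun m :
  measurable_fun [set: mR] (fun s : mR => (s `^ (g - 1) * ml g (m * s `^ g))%R : mR).
Proof.
apply: measurable_funM; first exact: measurable_powR.
apply: (@measurableT_comp _ _ _ _ _ _ (ml g)).
  by apply: continuous_measurable_fun; exact: continuous_ml.
by apply: measurable_funM => //; exact: measurable_powR.
Qed.

Lemma le0_ler_powR (p x y : R) : (p <= 0 -> 0 < y -> y <= x -> x `^ p <= y `^ p)%R.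
Proof.
move=> p0 y0 yx; have x0 : (0 < x)%R by exact: lt_le_trans yx.
rewrite -[leLHS]invrK -[leRHS]invrK lef_pV2 ?posrE ?invr_gt0 ?powR_gt0//.
by rewrite -!powRN; apply: ge0_ler_powR; rewrite ?nnegrE ?oppr_ge0// ltW.
Qed.

(** At a first zero t0 of e(s) = ml(s^g), the equation rho + [pw g] * rho = [pw g] forces ([pw g] *
    rho)(t0) >= t0^(g-1). At a nearby point c < t0 where e is positive and locally maximal, ([pw g]
    * rho)(c) equals c^(g-1) (1 - e(c)). Passing from c to t0 gains only a small multiple of e(c),
    which is not enough to make up the deficit. *)
Lemma ml_ge0 x : (0 <= x)%R -> (0 <= ml g x)%R.
Proof.
move=> x_ge0; rewrite leNgt; apply/negP => mlx.
have [x0 x0_gt0 [mlx0 mlpos]] := ml_first_zero x_ge0 mlx.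
pose t0 := (x0 `^ g^-1)%R.
have t0_gt0 : (0 < t0)%R by rewrite powR_gt0.
have t0g : (t0 `^ g = x0)%R by rewrite -powRrM mulVf ?gt_eqF// powRr1// ltW.
pose e s := ml g (s `^ g).
have e_gt0 s : (0 < s < t0)%R -> (0 < e s)%R.
  move=> /andP[s0 st0]; apply: mlpos; rewrite powR_ge0 -t0g.
  by rewrite gt0_ltr_powR ?nnegrE ?ltW.
(* Chosen so that the kernel has mass at most 1/8 on the window ]t0 - 2 eta, t0[ and so that this
   window stays away from 0. *)
pose eta := Num.min (t0 / 4)%R ((g / 8) `^ g^-1 / 2)%R.
have eta_gt0 : (0 < eta)%R by rewrite lt_min; apply/andP; split; do ?[apply: divr_gt0 => //|apply: powR_gt0].
have eta_t0 : (eta <= t0 / 4)%R by rewrite ge_min lexx.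
have eta_g : ((2 * eta) `^ g <= g / 8)%R.
  rewrite [leRHS](_ : (g / 8)%R = ((g / 8) `^ g^-1) `^ g)%R; last first.
    by rewrite -powRrM mulVf ?gt_eqF// powRr1// divr_ge0// ltW.
  apply: ge0_ler_powR; rewrite ?nnegrE ?powR_ge0 ?(ltW g0)//.
    by rewrite mulr_ge0// ltW.
  by rewrite -ler_pdivlMl// mulrC ge_min lexx orbT.
pose a := (t0 - eta)%R.
have a_gt0 : (t0 / 2 <= a)%R by rewrite /a; lra.
have at0 : (a < t0)%R by rewrite /a; lra.
have [c /[!in_itv]/= /andP[ac ct0] cmax] : exists2 c, c \in `[a, t0]%R &
    forall t, t \in `[a, t0]%R -> (e t <= e c)%R.
  apply: EVT_max; first exact: ltW.
  apply: continuous_in_subspaceT => s; rewrite inE/= in_itv/= => /andP[s1 _].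
  have s0 : (0 < s)%R by rewrite (lt_le_trans _ s1)// (lt_le_trans _ a_gt0)// divr_gt0.
  apply: (@continuous_comp _ _ _ (fun s : R => (s `^ g)%R) (ml g)).
    exact: continuous_powR_gt0.
  exact: continuous_ml.
have ec : (0 < e c)%R.
  apply: lt_le_trans (cmax a _); last by rewrite in_itv/= lexx ltW.
  by apply: e_gt0; rewrite at0 (lt_le_trans _ a_gt0)// divr_gt0.
have {}ct0 : (c < t0)%R.
  rewrite lt_neqAle ct0 andbT; apply/eqP => ct0'.
  by move: ec; rewrite ct0' /e t0g ltNge mlx0.
have c_gt0 : (0 < c)%R by rewrite (lt_le_trans _ ac)// (lt_le_trans _ a_gt0)// divr_gt0.
(* The resolvent kernel for m = 1, cut off at t0; it is nonnegative because t0 is the first zero. *)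
pose rho s := (\1_(`]0%R, t0[%classic) s * (s `^ (g - 1) * ml g (1 * s `^ g)))%:E.
have rhoE s : (0 < s < t0)%R -> rho s = (s `^ (g - 1) * e s)%:E.
  by move=> st; rewrite /rho indicE mem_set/= ?in_itv//= !mul1r.
have rho0 s : ~~ (0 < s < t0)%R -> rho s = 0.
  by move=> st; rewrite /rho indicE memNset/= ?in_itv/= ?mul0r//; exact/negP.
have nrho : nnmeas rho.
  split.
    apply/measurable_EFinP; apply: measurable_funM; last exact: measurable_res_fun.
    by apply: measurable_indic; exact: measurable_itv.
  move=> s; have [st|st] := boolP (0 < s < t0)%R; last by rewrite rho0.
  by rewrite (rhoE _ st) lee_fin; apply: mulr_ge0; [exact: powR_ge0|exact/ltW/e_gt0].
have crho : causal rho by move=> s s0; rewrite rho0// le_gtF.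
have PQ s : (0 < s < t0)%R -> ml_kernel g false 1 s = ml_kernel g true 1 s + rho s.
  move=> st; have /andP[s0 _] := st.
  have [q -> ->] := ml_kernel_diff ler01 s0.
  by rewrite rhoE// mul1r.
have eqn := ml_kernel_cancel ler01 nrho crho PQ.
have conv_c : conv (pw g) rho c = (c `^ (g - 1) * (1 - e c))%:E.
  have := eqn c (ltW ct0); have [q -> ->] := ml_kernel_diff ler01 c_gt0.
  rewrite !mul1e -/(e c) mul1r pwE//.
  have := conv_ge0 c (nnmeas_pw g) nrho.
  case: (conv _ _ _) => // r _; rewrite -!EFinD => -[h]; congr EFin.
  by rewrite -[r](addKr (q + c `^ (g - 1) * e c)%R) h; ring.
(* Here the value ml(x0) <= 0 is used: the equation at t0 leaves at least [pw g t0] to the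
   convolution. *)
have conv_t0 : pw g t0 <= conv (pw g) rho t0.
  have := eqn t0 (lexx _); have [q -> ->] := ml_kernel_diff ler01 t0_gt0.
  rewrite !mul1e mul1r pwE//.
  have := conv_ge0 t0 (nnmeas_pw g) nrho.
  case: (conv _ _ _) => [r _| |]//; rewrite -!EFinD ?leey// => -[h].
  rewrite lee_fin -(lerD2l q) -h lerD2r gerDl.
  by rewrite pmulr_rle0 ?powR_gt0// t0g.
have a0_gt0 : (0 < t0 - 2 * eta)%R by lra.
(* [k1] compares the kernels seen from t0 and from c when s < c, because (t0/c)(c - s) <= t0 - s.
   [k2] bounds rho on [c, t0[, by the choice of c as a maximum. *)
pose k1 := ((t0 / c) `^ (g - 1))%R.
pose k2 := (a `^ (g - 1) * e c)%R.
have k2_ge0 : (0 <= k2)%R by rewrite mulr_ge0 ?powR_ge0// ltW.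
have nshift : nnmeas (fun s => pw g (2 * eta - s)%R * pw 1 s).
  split; last by move=> s; apply: mule_ge0; apply nnmeas_pw.
  by apply: measurable_conv_integrand; exact: nnmeas_pw.
have : conv (pw g) rho t0 <=
    k1%:E * conv (pw g) rho c + k2%:E * conv (pw g) (pw 1) (2 * eta).
  have nrhoc : nnmeas (fun s => pw g (c - s)%R * rho s).
    split; last by move=> s; apply: mule_ge0; [apply nnmeas_pw|apply nrho].
    by apply: measurable_conv_integrand => //; exact: nnmeas_pw.
  have mF2 : measurable_fun [set: mR] (fun s => pw g (2 * eta - (s - (t0 - 2 * eta)))%R * pw 1 (s - (t0 - 2 * eta))%R).
    apply: (measurableT_comp nshift.1).
    by apply: measurable_funB => //; exact: measurable_cst.
  rewrite /conv -[X in _ + _ * X](@ge0_integral_addr _ (t0 - 2 * eta)%R _ nshift).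
  rewrite -ge0_integralZl//; last 3 first.
  - exact: nrhoc.1.
  - by move=> s _; exact: nrhoc.2.
  - by rewrite lee_fin powR_ge0.
  rewrite -(@ge0_integralZl _ _ _ leb _ measurableT _ mF2 k2%:E); last 2 first.
  - by move=> s _; exact: nshift.2.
  - by rewrite lee_fin.
  rewrite -ge0_integralD//; last 4 first.
  - by move=> s _; apply: mule_ge0; [rewrite lee_fin powR_ge0|exact: nrhoc.2].
  - exact: (nnmeasZ (powR_ge0 _ _) nrhoc).1.
  - by move=> s _; apply: mule_ge0; [rewrite lee_fin|exact: nshift.2].
  - exact: emeasurable_funM.
  apply: ge0_le_integral => //.
  - by move=> s _; apply: mule_ge0; [apply nnmeas_pw|apply nrho].
  - by apply: measurable_conv_integrand => //; exact: nnmeas_pw.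
  - apply: emeasurable_funD; first exact: (nnmeasZ (powR_ge0 _ _) nrhoc).1.
    exact: emeasurable_funM.
  move=> s _.
  have [st|st] := boolP (0 < s < t0)%R; last first.
    rewrite rho0// !mule0 add0e; apply: mule_ge0; last exact: nshift.2.
    by rewrite lee_fin.
  have /andP[s_gt0 s_lt] := st.
  have g1 : (g - 1 <= 0)%R by case/andP: g01 => _; rewrite subr_le0.
  rewrite rhoE//; have [sc|cs] := ltP s c.
    rewrite (@le_trans _ _ (k1%:E * (pw g (c - s)%R * (s `^ (g - 1) * e s)%:E)))//.
      rewrite muleA; apply: lee_wpmul2r.
        by rewrite lee_fin; apply: mulr_ge0; [exact: powR_ge0|exact/ltW/e_gt0].
      rewrite !pwE ?subr_gt0// -EFinM lee_fin /k1.
      rewrite -powRM; [|by rewrite divr_ge0// ltW|by rewrite subr_ge0 ltW].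
      apply: le0_ler_powR => //; first by rewrite mulr_gt0 ?divr_gt0// subr_gt0.
      rewrite mulrAC ler_pdivrMr// !(mulrBr,mulrBl) lerB// [leRHS]mulrC.
      by rewrite ler_wpM2l// ltW.
    by rewrite leeDl//; apply: mule_ge0; [rewrite lee_fin|exact: nshift.2].
  rewrite (@le_trans _ _ (k2%:E * (pw g (2 * eta - (s - (t0 - 2 * eta)))%R *
     pw 1 (s - (t0 - 2 * eta))%R)))//; last first.
    rewrite leeDr//; apply: mule_ge0; first by rewrite lee_fin powR_ge0.
    by apply: mule_ge0; [apply nnmeas_pw|rewrite -rhoE//; apply nrho].
  have -> : (2 * eta - (s - (t0 - 2 * eta)) = t0 - s)%R by ring.
  have h1 : (0 < s - (t0 - 2 * eta))%R.
    by rewrite subr_gt0 (lt_le_trans _ cs)// (lt_le_trans _ ac)// /a; lra.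
  rewrite [pw 1 _]pwE// subrr powRr0 mule1 muleC; apply: lee_wpmul2r.
    by apply nnmeas_pw.
  rewrite lee_fin; apply: ler_pM; [exact: powR_ge0|exact/ltW/e_gt0| |].
    apply: le0_ler_powR => //; last exact: le_trans cs.
    by rewrite (lt_le_trans _ a_gt0)// divr_gt0.
  by apply: cmax; rewrite in_itv/= (le_trans ac)//= ltW.
rewrite conv_c [conv _ (pw 1)]convC; try exact: nnmeas_pw.
rewrite conv_pw1//; last by rewrite mulr_ge0// ltW.
move=> /(le_trans conv_t0); rewrite pwE// -!EFinM -EFinD lee_fin.
(* The right-hand side is at most t0^(g-1) (1 - e(c)) + t0^(g-1) e(c)/4, strictly less than
   t0^(g-1). *)
rewrite leNgt => /negP; apply.
have k1c : (k1 * c `^ (g - 1) = t0 `^ (g - 1))%R.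
  rewrite /k1 -powRM ?divr_ge0 ?ltW// ?divfK// ?gt_eqF//.
have p0 : (0 < t0 `^ (g - 1))%R by rewrite powR_gt0.
have k2_le : (k2 <= 2 * t0 `^ (g - 1) * e c)%R.
  rewrite /k2 ler_wpM2r ?(ltW ec)//.
  rewrite (@le_trans _ _ ((t0 / 2) `^ (g - 1)))%R//.
    by apply: le0_ler_powR => //; [case/andP: g01 => _; rewrite subr_le0|rewrite divr_gt0].
  rewrite mulrC powRM ?(ltW t0_gt0) ?invr_ge0// ler_wpM2r ?powR_ge0//.
  have E2 : ((2^-1) `^ (-1) = 2 :> R)%R by rewrite powR_inv1 ?invrK// invr_ge0.
  rewrite -[leRHS]E2.
  apply: ger_powR; first by rewrite invr_gt0 ltr0n/= invf_le1 ?ltr0n// ler1n.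
  by rewrite lerBrDl subrr ltW.
have eg : ((2 * eta) `^ g / g <= 8^-1)%R by rewrite ler_pdivrMr// [leRHS]mulrC.
rewrite mulrA k1c.
have h2 : (k2 * ((2 * eta) `^ g / g) <= 2 * t0 `^ (g - 1) * e c * 8^-1)%R.
  by apply: ler_pM => //; rewrite divr_ge0 ?powR_ge0// ltW.
have h3 : (0 < t0 `^ (g - 1) * e c)%R by rewrite mulr_gt0.
rewrite (le_lt_trans (lerD (lexx _) h2))//.
rewrite mulrBr mulr1; lra.
Qed.

Lemma eadd_cancel (q : R) (x y : \bar R) : q%:E + x = q%:E + y -> x = y.
Proof. by move=> /(congr1 (fun z => z - q%:E)); rewrite !(addeC q%:E) !addeK. Qed.

(** The resolvent of the Volterra kernel m t^(g-1), as [res_eq] shows; in classical notation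
    Gamma(g) t^(g-1) E_{g,g}(-m Gamma(g) t^g). *)
Definition res m t : \bar R :=
  if (0 < t)%R then (t `^ (g - 1) * ml g (m * t `^ g))%:E else 0.

Lemma resE m t : (0 < t)%R -> res m t = (t `^ (g - 1) * ml g (m * t `^ g))%:E.
Proof. by rewrite /res => ->. Qed.

Lemma causal_res m : causal (res m).
Proof. by move=> t; rewrite /res leNgt => /negbTE ->. Qed.

Lemma nnmeas_res m : (0 <= m)%R -> nnmeas (res m).
Proof.
move=> m0; split; last first.
  move=> t; rewrite /res; case: ifP => // _; rewrite lee_fin.
  by apply: mulr_ge0; [exact: powR_ge0|apply: ml_ge0; rewrite mulr_ge0// powR_ge0].
have -> : res m = (fun t => (\1_(`]0%R, +oo[%classic) t)%:E *
    (t `^ (g - 1) * ml g (m * t `^ g))%:E).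
  apply/funext => t; rewrite -pw1E /pw /res subrr powRr0.
  by case: ifP; rewrite ?mul1e ?mul0e.
apply: emeasurable_funM; apply/measurable_EFinP; last exact: measurable_res_fun.
by apply: measurable_indic; exact: measurable_itv.
Qed.

Lemma res_eq m t : (0 <= m)%R -> res m t + m%:E * conv (pw g) (res m) t = pw g t.
Proof.
move=> m0; have nr := nnmeas_res m0; have cr := @causal_res m.
have [t0|t0] := leP t 0%R.
  rewrite cr// (causal_conv (causal_pw _) cr)// causal_pw//.
  by rewrite mule0 adde0.
have PQ s : (0 < s < t)%R -> ml_kernel g false m s = ml_kernel g true m s + res m s.
  move=> /andP[s0 _]; have [q -> ->] := ml_kernel_diff m0 s0.
  by rewrite resE.
have := ml_kernel_cancel m0 nr cr PQ (lexx t).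
have [q -> ->] := ml_kernel_diff m0 t0.
by rewrite EFinD -addeA => /eadd_cancel <-; rewrite resE.
Qed.

Lemma res_le_pw m t : (0 <= m)%R -> res m t <= pw g t.
Proof.
move=> m0; rewrite -(res_eq t m0) leeDl// mule_ge0//.
by apply: conv_ge0; [exact: nnmeas_pw|exact: nnmeas_res].
Qed.

Lemma le_conv (f1 f2 h1 h2 : R -> \bar R) t : nnmeas f1 -> nnmeas f2 ->
  nnmeas h1 -> nnmeas h2 -> (forall s, f1 s <= f2 s) -> (forall s, h1 s <= h2 s) ->
  conv f1 h1 t <= conv f2 h2 t.
Proof.
move=> nf1 nf2 nh1 nh2 f12 h12; apply: ge0_le_integral => //.
- by move=> s _; apply: mule_ge0; [apply nf1|apply nh1].
- exact: measurable_conv_integrand.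
- exact: measurable_conv_integrand.
- by move=> s _; apply: lee_pmul; [apply nf1|apply nh1| |].
Qed.

(** The resolvent identity: y is the convolution of [res m] with [res n] at t, nonnegative by
    [ml_ge0]. It yields monotonicity in m without differentiating the series. *)
Lemma res_identity m n t : (0 <= m)%R -> (0 < n)%R -> (0 < t)%R ->
  exists2 y, (0 <= y)%R & (fine (res m t) = fine (res n t) + (n - m) * y)%R.
Proof.
move=> m0 n_gt0 t0; have n0 := ltW n_gt0.
have nrm := nnmeas_res m0; have nrn := nnmeas_res n0.
have npw : nnmeas (pw g) := nnmeas_pw g.
have fin_conv f h : nnmeas f -> nnmeas h -> (forall s, f s <= pw g s) ->
    (forall s, h s <= pw g s) -> exists2 r, (0 <= r)%R & conv f h t = r%:E.
  move=> nf nh fl hl; exists (fine (conv f h t)); first exact/fine_ge0/conv_ge0.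
  rewrite fineK// ge0_fin_numE ?conv_ge0//.
  by rewrite (le_lt_trans (le_conv t nf npw nh npw fl hl))// conv_pw// ltry.
have rmle s : res m s <= pw g s by exact: res_le_pw.
have rnle s : res n s <= pw g s by exact: res_le_pw.
have [y y0 Y] := fin_conv _ _ nrm nrn rmle rnle.
have [a a0 A] := fin_conv _ _ nrm npw rmle (fun s => lexx _).
have [b b0 B] := fin_conv _ _ npw nrn (fun s => lexx _) rnle.
exists y => //.
have nln : nnmeas (conv (pw g) (res n)) by exact: nnmeas_conv.
have nml : nnmeas (conv (res m) (pw g)) by exact: nnmeas_conv.
(* The triple convolution of [res m], [pw g] and [res n]. Inserting the resolvent equation on either
   side gives y + n X = a and y + m X = b, from which X is eliminated. *)
pose X := conv (res m) (conv (pw g) (res n)) t.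
have eq1 : y%:E + n%:E * X = a%:E.
  have <- : conv (res m) (res n \+ (fun s => n%:E * conv (pw g) (res n) s)) t = a%:E.
    by rewrite -A; congr (conv _ _ t); apply/funext => s; rewrite /= res_eq.
  rewrite convDr//; last exact: nnmeasZ.
  by rewrite /= convZr// Y.
have eq2 : y%:E + m%:E * X = b%:E.
  have <- : conv (res m \+ (fun s => m%:E * conv (res m) (pw g) s)) (res n) t = b%:E.
    rewrite -B; congr (conv _ _ t); apply/funext => s.
    by rewrite /= (convC nrm npw) res_eq.
  rewrite convDl//; last exact: nnmeasZ.
  by rewrite /= convZl// Y -convA.
(* Since n > 0, an infinite X would make a infinite. *)
have Xfin : X = (fine X)%:E.
  rewrite fineK// ge0_fin_numE; last exact: conv_ge0.
  rewrite ltNge leye_eq; apply/negP => /eqP Xoo.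
  by move: eq1; rewrite Xoo gt0_muley ?lte_fin// addey.
have := res_eq t m0; rewrite -(convC nrm npw) A.
have := res_eq t n0; rewrite B.
move: eq1 eq2; rewrite Xfin !resE// pwE// -!EFinM -!EFinD.
move: (fine X) => x [eq1] [eq2] [eq3] [eq4] /=.
have E1 : a = (y + n * x)%R by [].
have E2 : b = (y + m * x)%R by [].
move: eq3 eq4; rewrite E1 E2 => eq3 eq4.
have -> : (t `^ (g - 1) * ml g (m * t `^ g) = t `^ (g - 1) - m * (y + n * x))%R.
  by rewrite -[X in _ = (X - _)%R]eq4 addrK.
have -> : (t `^ (g - 1) * ml g (n * t `^ g) = t `^ (g - 1) - n * (y + m * x))%R.
  by rewrite -[X in _ = (X - _)%R]eq3 addrK.
by ring.
Qed.

(** The resolvent identity at time 1, where the power factor equals 1. *)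
Lemma ml_antitone x y : (0 <= x)%R -> (x <= y)%R -> (ml g y <= ml g x)%R.
Proof.
move=> x0 xy; have [->//|nxy] := eqVneq x y.
have y0 : (0 < y)%R by rewrite (le_lt_trans x0)// lt_neqAle nxy.
have [z z0] := res_identity x0 y0 ltr01.
rewrite !resE//= !powR1 !mulr1 !mul1r => ->.
by rewrite lerDl mulr_ge0// subr_ge0.
Qed.

Lemma ml_le1 x : (0 <= x)%R -> (ml g x <= 1)%R.
Proof. by move=> x0; rewrite -(ml0 g); exact: ml_antitone. Qed.

Lemma res_antitone m s t : (0 <= m)%R -> (0 < s)%R -> (s <= t)%R -> res m t <= res m s.
Proof.
move=> m0 s0 st; have t0 := lt_le_trans s0 st.
rewrite !resE// lee_fin; apply: ler_pM.
- exact: powR_ge0.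
- by apply: ml_ge0; rewrite mulr_ge0// powR_ge0.
- by apply: le0_ler_powR => //; case/andP: g01 => _; rewrite subr_le0.
- apply: ml_antitone; first by rewrite mulr_ge0// powR_ge0.
  by rewrite ler_wpM2l//; apply: ge0_ler_powR => //; rewrite ?nnegrE; exact: ltW.
Qed.

End mittag_leffler_pos.

(** * Uniqueness of densities with a given primitive *)

Section primitive_uniqueness.
Context {R : realType}.
Local Notation mR := (measurableTypeR R).
Local Notation leb := (@lebesgue_measure R).

Lemma integrable_locally_integrable (phi : R -> R) :
  leb.-integrable setT (EFin \o phi) -> locally_integrable setT phi.
Proof.
move=> iphi; apply: open_integrable_locally => //; exact: openT.
Qed.

Lemma ae_eq0_of_primitive (phi : R -> R) (T : R) :
  leb.-integrable setT (EFin \o phi) ->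
  (forall x, 0 < x < T -> \int[leb]_(t in `]-oo, x]) phi t = 0) ->
  {ae leb, forall t, 0 < t < T -> phi t = 0}.
Proof.
move=> iphi phi0.
have := @FTC1Ny R phi _ (integrable_locally_integrable iphi).
move=> /(_ _)/=.
have h y : leb.-integrable `]-oo, y] (EFin \o phi).
  by apply: integrableS iphi.
move=> /(_ h); apply: ae_imp => t [_ Ft] /andP[t0 tT].
rewrite -Ft derive1E; transitivity ('D_1 (cst 0 : R -> R) t); last exact: derive_cst.
apply: near_eq_derive; near=> s.
apply: phi0; apply/andP; split; near: s.
  exact: lt_nbhsr.
exact: lt_nbhsl.
Unshelve. all: by end_near. Qed.

End primitive_uniqueness.

(** * Signed functions on ]0, T[ as differences of causal nonnegative ones *)

Section extension.
Context {R : realType}.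
Local Notation mR := (measurableTypeR R).
Local Notation leb := (@lebesgue_measure R).
Local Open Scope ereal_scope.
Variable T : R.
Local Notation D := (`]0%R, T[%classic : set R).
Implicit Types phi : R -> R.

Definition ppos phi : R -> \bar R := ((EFin \o phi) \_ D)^\+.
Definition pneg phi : R -> \bar R := ((EFin \o phi) \_ D)^\-.

Lemma pposE phi t : (0 < t < T)%R -> ppos phi t = (Num.max (phi t) 0)%:E.
Proof. by move=> tD; rewrite /ppos funeposE patchE mem_set/= ?in_itv// EFin_max. Qed.

Lemma pnegE phi t : (0 < t < T)%R -> pneg phi t = (Num.max (- phi t) 0)%:E.
Proof. by move=> tD; rewrite /pneg funenegE patchE mem_set/= ?in_itv// EFin_max. Qed.

Lemma ppos_out phi t : ~~ (0 < t < T)%R -> ppos phi t = 0.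
Proof.
move=> tD; rewrite /ppos funeposE patchE memNset ?maxxx//= in_itv/=.
exact/negP.
Qed.

Lemma pneg_out phi t : ~~ (0 < t < T)%R -> pneg phi t = 0.
Proof.
move=> tD; rewrite /pneg funenegE patchE memNset ?oppe0 ?maxxx//= in_itv/=.
exact/negP.
Qed.

Lemma pnegN phi : pneg phi = ppos (fun t => - phi t)%R.
Proof.
apply/funext => t; have [tD|tD] := boolP (0 < t < T)%R; last by rewrite pneg_out// ppos_out.
by rewrite pnegE// pposE.
Qed.

Lemma causal_ppos phi : causal (ppos phi).
Proof. by move=> t t0; rewrite ppos_out// le_gtF. Qed.

Lemma nnmeas_ppos phi : measurable_fun D phi -> nnmeas (ppos phi).
Proof.
move=> mphi; split; last by move=> x; rewrite funepos_ge0.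
apply: measurable_funepos; apply/measurable_restrict => //=.
by rewrite setTI; apply/measurable_EFinP.
Qed.

Lemma integral_ppos_lty phi : leb.-integrable D (EFin \o phi) ->
  \int[leb]_t ppos phi t < +oo.
Proof.
move=> iphi; apply: integral_funepos_lt_pinfty => //.
exact: (integrable_mkcond _ _).1.
Qed.

Lemma conv_pw1_lty (f : R -> \bar R) t : nnmeas f -> \int[leb]_t f t < +oo ->
  conv (pw 1) f t < +oo.
Proof.
move=> nf; apply: le_lt_trans; apply: ge0_le_integral => //.
- by move=> s _; apply: mule_ge0; [apply nnmeas_pw|apply nf].
- by apply: measurable_conv_integrand => //; exact: nnmeas_pw.
- exact: nf.1.
- move=> s _; rewrite /pw; case: ifP => _; last by rewrite mul0e; exact: nf.2.
  by rewrite subrr powRr0 mul1e.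
Qed.

Lemma Rintegral_conv_pw (a : R) phi t : (t <= T)%R ->
  conv (pw a) (ppos phi) t < +oo -> conv (pw a) (pneg phi) t < +oo ->
  measurable_fun D phi ->
  (\int[leb]_(r in `]0%R, t[) ((t - r) `^ (a - 1) * phi r) =
   fine (conv (pw a) (ppos phi) t) - fine (conv (pw a) (pneg phi) t))%R.
Proof.
move=> tT pfin nfin mphi.
have mphiN : measurable_fun D (fun t => - phi t)%R by exact: measurable_funN.
rewrite /Rintegral integralE.
have in_ r : r \in `]0%R, t[%classic -> [/\ (0 < r)%R, (r < t)%R & (0 < r < T)%R].
  by rewrite inE/= in_itv/= => /andP[r0 rt]; rewrite r0 rt (lt_le_trans rt).
have -> : \int[leb]_(r in `]0%R, t[) (fun r => ((t - r) `^ (a - 1) * phi r)%:E)^\+ r =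
    conv (pw a) (ppos phi) t.
  rewrite conv_causalE; [|exact: causal_pw|exact: causal_ppos].
  apply: eq_integral => r /in_[r0 rt rT].
  rewrite pposE// pwE ?subr_gt0// -EFinM funeposE maxr_pMr ?powR_ge0// mulr0.
  by rewrite EFin_max.
have -> : \int[leb]_(r in `]0%R, t[) (fun r => ((t - r) `^ (a - 1) * phi r)%:E)^\- r =
    conv (pw a) (pneg phi) t.
  rewrite pnegN conv_causalE; [|exact: causal_pw|exact: causal_ppos].
  apply: eq_integral => r /in_[r0 rt rT].
  rewrite pposE// pwE ?subr_gt0// -EFinM funenegE maxr_pMr ?powR_ge0// mulr0 mulrN.
  by rewrite EFin_max.
rewrite fineB// ge0_fin_numE//; apply: conv_ge0; try exact: nnmeas_pw.
  exact: nnmeas_ppos.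
by rewrite pnegN; exact: nnmeas_ppos.
Qed.

Lemma Rintegral_ppos phi t : (t <= T)%R -> leb.-integrable D (EFin \o phi) ->
  (\int[leb]_(r in `]0%R, t[) phi r =
   fine (conv (pw 1) (ppos phi) t) - fine (conv (pw 1) (pneg phi) t))%R.
Proof.
move=> tT iphi.
have mphi : measurable_fun D phi by apply/measurable_EFinP; case/integrableP: iphi.
rewrite -(@Rintegral_conv_pw 1%R phi t)//.
- by apply: eq_Rintegral => r _; rewrite subrr powRr0 mul1r.
- by apply: conv_pw1_lty; [exact: nnmeas_ppos|exact: integral_ppos_lty].
- rewrite pnegN; apply: conv_pw1_lty; first by apply: nnmeas_ppos; exact: measurable_funN.
  apply: integral_ppos_lty; rewrite (_ : _ \o _ = -%E \o (EFin \o phi))//.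
  exact: integrableN.
Qed.

End extension.

(** * From extended-valued to real-valued integrals *)

Section fine_integral.
Context {R : realType}.
Local Notation mR := (measurableTypeR R).
Local Notation leb := (@lebesgue_measure R).
Local Open Scope ereal_scope.
Implicit Types (f h : R -> \bar R) (D : set R).

Lemma integrable_nnmeas f D : measurable D -> nnmeas f ->
  \int[leb]_(x in D) f x < +oo -> leb.-integrable D f.
Proof.
move=> mD [mf f0] fD; apply/integrableP; split; first exact: measurable_funTS.
by under eq_integral do rewrite gee0_abs//.
Qed.

Lemma ae_fin_num f D : measurable D -> nnmeas f -> \int[leb]_(x in D) f x < +oo ->
  {ae leb, forall x, D x -> f x \is a fin_num}.
Proof. by move=> mD nf fD; apply: integrable_ae => //; exact: integrable_nnmeas. Qed.

Lemma integrable_fine f D : measurable D -> nnmeas f ->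
  \int[leb]_(x in D) f x < +oo -> leb.-integrable D (fun x => (fine (f x))%:E).
Proof.
move=> mD nf fD; have [mf f0] := nf.
apply: (le_integrable _ _ _ (integrable_nnmeas mD nf fD)) => //.
  apply/measurable_EFinP; apply: (measurableT_comp (@fine_measurable R setT measurableT)).
  exact: measurable_funTS.
move=> x _; rewrite gee0_abs ?lee_fin ?fine_ge0// gee0_abs//.
by case: (f x) (f0 x) => //= r _; rewrite leey.
Qed.

Lemma Rintegral_fine f D : measurable D -> nnmeas f -> \int[leb]_(x in D) f x < +oo ->
  (\int[leb]_(x in D) fine (f x) = fine (\int[leb]_(x in D) f x))%R.
Proof.
move=> mD nf fD; rewrite /Rintegral; congr fine.
apply: ae_eq_integral => //.
- by case/integrableP: (integrable_fine mD nf fD).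
- by apply: measurable_funTS; apply nf.
- by move: (ae_fin_num mD nf fD); apply: ae_imp => x fx Dx; rewrite fineK// fx.
Qed.

(** Finiteness of the primitives at T makes f and h finite almost everywhere on ]0, T[. Their
    difference, cut off to that interval, is then a real integrable function to which
    [ae_eq0_of_primitive] applies. *)
Lemma ae_eq_of_conv1 f h T : nnmeas f -> nnmeas h -> causal f -> causal h ->
  conv (pw 1) f T < +oo -> conv (pw 1) h T < +oo ->
  (forall t, (t <= T)%R -> conv (pw 1) f t = conv (pw 1) h t) ->
  {ae leb, forall t, (0 < t < T)%R ->
    [/\ f t \is a fin_num, h t \is a fin_num & f t = h t]}.
Proof.
move=> nf nh cf ch; rewrite !conv_pw1E// => fT hT fh.
have mD : measurable (`]0%R, T[%classic : set mR) by exact: measurable_itv.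
pose phi := (fun t => fine (f t) - fine (h t))%R \_ `]0%R, T[%classic.
have iphiD : leb.-integrable `]0%R, T[ (fun t => (fine (f t) - fine (h t))%:E).
  have := integrableB mD (integrable_fine mD nf fT) (integrable_fine mD nh hT).
  by apply: eq_integrable => // t _; rewrite EFinB.
have iphi : leb.-integrable setT (EFin \o phi).
  by rewrite /phi -restrict_EFin; exact: (integrable_mkcond _ mD).1.
have sub_lty k x : nnmeas k -> (x <= T)%R -> \int[leb]_(s in `]0%R, T[) k s < +oo ->
    \int[leb]_(s in `]0%R, x[) k s < +oo.
  move=> [mk k0] xT; apply: le_lt_trans; apply: ge0_subset_integral => //.
  - exact: measurable_funTS.
  - by move=> z; rewrite /= !in_itv/= => /andP[-> zx]; exact: lt_le_trans xT.
have phi0 x : (0 < x < T)%R -> (\int[leb]_(t in `]-oo, x]) phi t = 0)%R.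
  move=> /andP[x0 xT]; rewrite /phi -Rintegral_mkcondr.
  have -> : `]-oo, x]%classic `&` `]0%R, T[%classic = `]0%R, x]%classic.
    apply/seteqP; split => z; rewrite /= !in_itv/=.
      by move=> [-> /andP[->]].
    by move=> /andP[-> zx]; split => //=; exact: le_lt_trans xT.
  have sx : `]0%R, x[%classic `<=` `]0%R, T[%classic.
    by move=> z; rewrite /= !in_itv/= => /andP[-> zx]/=; exact: lt_trans xT.
  rewrite -(@Rintegral_itv_bndo_bndc _ (BRight 0%R)); last first.
    by apply: (integrableS _ _ _ iphiD).
  rewrite RintegralB//.
  - rewrite !Rintegral_fine//; try by apply: sub_lty => //; exact: ltW.
    by rewrite -!conv_pw1E// fh ?subrr// ltW.
  - by apply: integrable_fine => //; apply: sub_lty => //; exact: ltW.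
  - by apply: integrable_fine => //; apply: sub_lty => //; exact: ltW.
have := ae_fin_num mD nf fT; have := ae_fin_num mD nh hT.
move=> hae fae; have phiae := ae_eq0_of_primitive iphi phi0.
have both := ae_imp2 (fun t hx fx => conj hx fx) hae fae.
apply: (ae_imp2 _ both phiae) => t [hx fx] phit tT.
have {}hx : h t \is a fin_num by apply: hx; rewrite /= in_itv.
have {}fx : f t \is a fin_num by apply: fx; rewrite /= in_itv.
split => //; move: (phit tT); rewrite /phi patchE mem_set/= ?in_itv//.
by move/eqP; rewrite subr_eq0 => /eqP e; rewrite -(fineK hx) -e fineK.
Qed.

End fine_integral.

(** * Inversion of the scalar fractional equation by the resolvent *)

Section mode.
Context {R : realType}.
Local Notation mR := (measurableTypeR R).
Local Notation leb := (@lebesgue_measure R).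
Local Open Scope ereal_scope.
Variables (g m T : R).
Hypotheses (g_gt0 : (0 < g)%R) (g_lt1 : (g < 1)%R) (m0 : (0 <= m)%R) (T0 : (0 < T)%R).

Let g01 : (0 < g <= 1)%R. Proof. by rewrite g_gt0 ltW. Qed.
Let npw (a : R) : nnmeas (pw a) := nnmeas_pw a.
Let nres : nnmeas (res g m) := nnmeas_res g01 m0.
Let g'0 : (0 < 1 - g)%R. Proof. by rewrite subr_gt0. Qed.
Local Notation cB := (Beta (1 - g) g).
Local Notation D := (`]0%R, T[%classic : set R).

Lemma conv_pwC t : conv (pw (1 - g)) (pw g) t = cB%:E * pw 1 t.
Proof.
have [t0|t0] := leP t 0%R.
  by rewrite (causal_conv (causal_pw _) (causal_pw _))// causal_pw// mule0.
rewrite conv_pw// pwE// -EFinM; congr EFin; congr (_ * _ `^ _)%R; ring.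
Qed.

(** The resolvent equation convolved with [pw (1 - g)]: by Abel's identity [conv_pwC], [pw g] turns
    into a multiple of the Heaviside function. Thus [res g m] is the fundamental solution of the
    mode equation. *)
Lemma conv_res t :
  conv (pw (1 - g)) (res g m) t + (m * cB)%:E * conv (pw 1) (res g m) t = cB%:E * pw 1 t.
Proof.
rewrite -conv_pwC.
have -> : pw g = res g m \+ (fun s => m%:E * conv (pw g) (res g m) s).
  by apply/funext => s; rewrite /= res_eq.
have nc : nnmeas (conv (pw g) (res g m)) by exact: nnmeas_conv.
rewrite convDr//; last exact: nnmeasZ.
rewrite /= convZr//; congr (_ + _).
rewrite convA//.
have -> : conv (pw (1 - g)) (pw g) = (fun s => cB%:E * pw 1 s) by apply/funext; exact: conv_pwC.
by rewrite convZl ?Beta_ge0// muleA -EFinM.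
Qed.

(** Convolution with [res g m] inverts the operator of the mode equation up to one integration. *)
Lemma res_conv_kernel p : nnmeas p ->
  conv (res g m) (conv (pw (1 - g)) p \+ (fun s => (m * cB)%:E * conv (pw 1) p s)) =
  (fun t => cB%:E * conv (pw 1) p t).
Proof.
move=> np.
have mc0 : (0 <= m * cB)%R by rewrite mulr_ge0// Beta_ge0.
have nc a : nnmeas (conv (pw a) (res g m)) by exact: nnmeas_conv.
have nc' a : nnmeas (conv (pw a) p) by exact: nnmeas_conv.
have e a : conv (res g m) (conv (pw a) p) = conv (conv (pw a) (res g m)) p.
  by rewrite (convA nres (npw a) np) (convC nres (npw a)).
rewrite (convDr nres (nc' _) (nnmeasZ mc0 (nc' 1%R))).
have -> := convZr mc0 nres (nc' 1%R); rewrite (e 1%R) (e (1 - g)%R).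

transitivity (conv (conv (pw (1 - g)) (res g m) \+
    (fun x => (m * cB)%:E * conv (pw 1) (res g m) x)) p).
  by rewrite (convDl np (nc _) (nnmeasZ mc0 (nc 1%R))) (convZl mc0 (nc 1%R) np).
have -> : conv (pw (1 - g)) (res g m) \+ (fun x => (m * cB)%:E * conv (pw 1) (res g m) x) =
    (fun s => cB%:E * pw 1 s).
  by apply/funext => s; exact: conv_res.
by rewrite (convZl (Beta_ge0 _ _) (npw 1%R) np).
Qed.

Lemma res_conv_primitive f : nnmeas f ->
  conv (res g m) (conv (pw 1) f) = conv (pw 1) (conv (res g m) f).
Proof. by move=> nf; rewrite (convA nres (npw _) nf) (convC nres (npw _)) -convA. Qed.

Lemma conv_le_mul F h : nnmeas F -> nnmeas h -> causal F -> causal h ->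
  (forall s, (s < T)%R -> F s <= F T) -> conv F h T <= F T * conv (pw 1) h T.
Proof.
move=> nF nh cF ch mono; have FT0 : 0 <= F T by apply nF.
have -> : F T * conv (pw 1) h T = \int[leb]_s (F T * (pw 1 (T - s)%R * h s)).
  rewrite ge0_integralZl//; first exact: (measurable_conv_integrand _ (npw _) nh).
  by move=> s _; apply: mule_ge0; [apply npw|apply nh].
apply: ge0_le_integral => //.
- by move=> s _; apply: mule_ge0; [apply nF|apply nh].
- exact: (measurable_conv_integrand _ nF nh).
- apply: emeasurable_funM => //; exact: (measurable_conv_integrand _ (npw _) nh).
move=> s _; have [s0|s0] := leP s 0%R; first by rewrite ch// !mule0.
have [sT|sT] := leP T s.
  by rewrite cF ?subr_le0// mul0e !mule_ge0//; [apply npw|apply nh].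
rewrite pwE ?subr_gt0// subrr powRr0 mul1e; apply: lee_wpmul2r; first by apply nh.
by apply: mono; rewrite gtrBl.
Qed.

(** Young's inequality in L^1(0, T). *)
Lemma conv_pw1_conv_le f h : nnmeas f -> nnmeas h -> causal f -> causal h ->
  conv (pw 1) (conv f h) T <= conv (pw 1) f T * conv (pw 1) h T.
Proof.
move=> nf nh cf ch; rewrite (convA (npw _) nf nh).
have nF := nnmeas_conv (npw 1%R) nf; have cF := causal_conv (@causal_pw _ 1%R) cf.
refine (conv_le_mul nF nh cF ch _) => s sT; rewrite !conv_pw1E//; apply: ge0_subset_integral => //.
- by apply: measurable_funTS; apply nf.
- by move=> x _; apply nf.
- by move=> x; rewrite /= !in_itv/= => /andP[-> xs]/=; exact: lt_trans sT.
Qed.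

Lemma conv_pw1_res_le : conv (pw 1) (res g m) T <= (T `^ g / g)%:E.
Proof.
rewrite -conv_pw1 ?(ltW T0)//; apply: le_conv => // s.
exact: res_le_pw.
Qed.

Lemma conv_pw1_res_lty : conv (pw 1) (res g m) T < +oo.
Proof. by rewrite (le_lt_trans conv_pw1_res_le)// ltry. Qed.

(** The unknown is p - q and the data are bp - bn and fp - fn, with negative terms moved across the
    equality. Convolving both sides with [res g m] turns them into primitives, and [ae_eq_of_conv1]
    strips the primitive. *)
Lemma mode_kernel p q fp fn (bp bn : R) : (0 <= bp)%R -> (0 <= bn)%R ->
  nnmeas p -> nnmeas q -> nnmeas fp -> nnmeas fn ->
  causal p -> causal q -> causal fp -> causal fn ->
  conv (pw 1) p T < +oo -> conv (pw 1) q T < +oo ->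
  conv (pw 1) fp T < +oo -> conv (pw 1) fn T < +oo ->
  {ae leb, forall t, (0 < t < T)%R ->
    conv (pw (1 - g)) p t + (m * cB)%:E * conv (pw 1) p t +
      (bn%:E * pw 1 t + conv (pw 1) fn t) =
    conv (pw (1 - g)) q t + (m * cB)%:E * conv (pw 1) q t +
      (bp%:E * pw 1 t + conv (pw 1) fp t)} ->
  {ae leb, forall t, (0 < t < T)%R ->
    [/\ cB%:E * p t + (bn%:E * res g m t + conv (res g m) fn t) \is a fin_num,
        cB%:E * q t + (bp%:E * res g m t + conv (res g m) fp t) \is a fin_num &
        cB%:E * p t + (bn%:E * res g m t + conv (res g m) fn t) =
        cB%:E * q t + (bp%:E * res g m t + conv (res g m) fp t)]}.
Proof.
move=> bp0 bn0 np nq nfp nfn cp cq cfp cfn pT qT fpT fnT pq.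
have mc0 : (0 <= m * cB)%R by rewrite mulr_ge0// Beta_ge0.
have cB0 : (0 <= cB)%R by exact: Beta_ge0.
have cres := @causal_res _ g m.
(* [L] is one side of the given equation and [V] one side of the conclusion; [LE] below shows that
   the convolution of [res g m] with [L] is the primitive of [V]. *)
pose L x (b : R) f : R -> \bar R := (conv (pw (1 - g)) x \+ (fun t => (m * cB)%:E * conv (pw 1) x t)) \+
   ((fun t => b%:E * pw 1 t) \+ conv (pw 1) f).
pose V x (b : R) f : R -> \bar R := (fun t => cB%:E * x t) \+ ((fun t => b%:E * res g m t) \+ conv (res g m) f).
have nc1 (a : R) x : nnmeas x -> nnmeas (conv (pw a) x) by move=> nx; exact: nnmeas_conv.
have nL x (b : R) f : (0 <= b)%R -> nnmeas x -> nnmeas f -> nnmeas (L x b f).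
  move=> b0 nx nf; apply: nnmeasD.
    by apply: nnmeasD; [exact: nc1|apply: nnmeasZ => //; exact: nc1].
  by apply: nnmeasD; [exact: nnmeasZ|exact: nc1].
have nV x (b : R) f : (0 <= b)%R -> nnmeas x -> nnmeas f -> nnmeas (V x b f).
  move=> b0 nx nf; apply: nnmeasD; first exact: nnmeasZ.
  by apply: nnmeasD; [exact: nnmeasZ|exact: nnmeas_conv].
have cL x (b : R) f : causal x -> causal f -> causal (L x b f).
  move=> cx cf t t0; rewrite /L/= (causal_conv (causal_pw _) cx)//.
  rewrite (causal_conv (causal_pw _) cx)// (causal_conv (causal_pw _) cf)//.
  by rewrite causal_pw// !mule0 !adde0.
have cV x (b : R) f : causal x -> causal f -> causal (V x b f).
  move=> cx cf t t0; rewrite /V/= cx// cres// (causal_conv cres cf)//.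
  by rewrite !mule0 !adde0.
have VE x (b : R) f t : (0 <= b)%R -> nnmeas x -> nnmeas f ->
    conv (pw 1) (V x b f) t = cB%:E * conv (pw 1) x t +
     (b%:E * conv (pw 1) (res g m) t + conv (pw 1) (conv (res g m) f) t).
  move=> b0 nx nf; have nr := nnmeas_conv nres nf; rewrite /V.
  rewrite (convDr (npw 1%R) (nnmeasZ cB0 nx) (nnmeasD (nnmeasZ b0 nres) nr)).
  rewrite (convDr (npw 1%R) (nnmeasZ b0 nres) nr).
  by rewrite (convZr cB0 (npw 1%R) nx) (convZr b0 (npw 1%R) nres).
have LE x (b : R) f t : (0 <= b)%R -> nnmeas x -> nnmeas f ->
    conv (res g m) (L x b f) t = conv (pw 1) (V x b f) t.
  move=> b0 nx nf; rewrite VE// /L.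
  have nk : nnmeas (conv (pw (1 - g)) x \+ (fun t => (m * cB)%:E * conv (pw 1) x t)).
    by apply: nnmeasD; [exact: nc1|apply: nnmeasZ => //; exact: nc1].
  rewrite (convDr nres nk (nnmeasD (nnmeasZ b0 (npw 1%R)) (nc1 1%R _ nf))).
  rewrite (convDr nres (nnmeasZ b0 (npw 1%R)) (nc1 1%R _ nf)).
  rewrite (res_conv_kernel nx) (convZr b0 nres (npw 1%R)).
  by rewrite (res_conv_primitive nf) (convC nres (npw 1%R)).
have Vlty x (b : R) f : (0 <= b)%R -> nnmeas x -> nnmeas f -> causal f ->
    conv (pw 1) x T < +oo -> conv (pw 1) f T < +oo -> conv (pw 1) (V x b f) T < +oo.
  move=> b0 nx nf cf xT fT; rewrite VE//; apply: lte_add_pinfty.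
    by apply: lte_mul_pinfty.
  apply: lte_add_pinfty.
    by apply: lte_mul_pinfty => //; exact: conv_pw1_res_lty.
  apply: le_lt_trans (conv_pw1_conv_le nres nf cres cf) _.
  have r0 : 0 <= conv (pw 1) (res g m) T by exact: (nc1 1%R _ nres).2.
  rewrite lte_mul_pinfty// ge0_fin_numE//; exact: conv_pw1_res_lty.
apply: (ae_eq_of_conv1 (nV _ _ _ bn0 np nfn) (nV _ _ _ bp0 nq nfp) (cV _ _ _ cp cfn) (cV _ _ _ cq cfp)).
- exact: Vlty.
- exact: Vlty.
move=> t tT; rewrite -(LE _ _ _ t bn0 np nfn) -(LE _ _ _ t bp0 nq nfp).
apply: (@ae_eq_conv _ _ _ _ T) => //; [exact: nL|exact: nL|exact: cL|exact: cL].
Qed.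

End mode.

(** * Representation of the solution of one mode *)

Section mode_real.
Context {R : realType}.
Local Notation mR := (measurableTypeR R).
Local Notation leb := (@lebesgue_measure R).
Variables (g m T : R).
Hypotheses (g_gt0 : (0 < g)%R) (g_lt1 : (g < 1)%R) (m0 : (0 <= m)%R) (T0 : (0 < T)%R).
Let g01 : (0 < g <= 1)%R. Proof. by rewrite g_gt0 ltW. Qed.
Let nres : nnmeas (res g m) := nnmeas_res g01 m0.
Let cres : causal (res g m) := @causal_res _ g m.
Let g'0 : (0 < 1 - g)%R. Proof. by rewrite subr_gt0. Qed.
Local Notation cB := (Beta (1 - g) g).
Local Notation D := (`]0%R, T[%classic : set R).
Implicit Types f v : R -> R.

Lemma nnmeas_ppn f : leb.-integrable D (EFin \o f) ->
  [/\ nnmeas (ppos T f), nnmeas (pneg T f), causal (ppos T f) & causal (pneg T f)].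
Proof.
move=> fi; have mf : measurable_fun D f by apply/measurable_EFinP; case/integrableP: fi.
rewrite pnegN; split; try exact: causal_ppos.
  exact: nnmeas_ppos.
by apply: nnmeas_ppos; exact: measurable_funN.
Qed.

Lemma conv_pw1_ppn_lty f t : leb.-integrable D (EFin \o f) ->
  (conv (pw 1) (ppos T f) t < +oo)%E /\ (conv (pw 1) (pneg T f) t < +oo)%E.
Proof.
move=> fi; have [np nn _ _] := nnmeas_ppn fi; split; apply: conv_pw1_lty => //.
  exact: integral_ppos_lty.
rewrite pnegN; apply: integral_ppos_lty; rewrite (_ : _ \o _ = (-%E \o (EFin \o f))%E)//.
exact: integrableN.
Qed.

Lemma conv_pw1_int (h : R -> \bar R) : causal h ->
  conv (pw 1) h T = (\int[leb]_(t in D) h t)%E.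
Proof. by move=> ch; rewrite conv_pw1E. Qed.

Lemma ae_fin_conv (a : R) (h : R -> \bar R) : 0 < a -> nnmeas h -> causal h ->
  (conv (pw 1) h T < +oo)%E ->
  {ae leb, forall t, D t -> conv (pw a) h t \is a fin_num}.
Proof.
move=> a0 nh ch hT; have npw := nnmeas_pw a.
apply: ae_fin_num => //; first exact: nnmeas_conv.
rewrite -conv_pw1_int; last exact: causal_conv (@causal_pw _ a) ch.
have aT : conv (pw 1) (pw a) T = (T `^ a / a)%:E by rewrite conv_pw1// ltW.
apply: le_lt_trans (conv_pw1_conv_le T npw nh (@causal_pw _ a) ch) _; rewrite aT.
have : (0 <= conv (pw 1) h T)%E by apply: conv_ge0 => //; exact: nnmeas_pw.
move: hT; case: (conv _ _ _) => // r _ _; exact: ltry.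
Qed.

Lemma max0_diff (x : R) : Num.max x 0 = x + Num.max (- x) 0.
Proof. by have [c0|c0] := leP 0 x; have [d0|d0] := leP 0 (- x); lra. Qed.

Lemma posneg (b : R) : exists bp bn, [/\ 0 <= bp, 0 <= bn, b = bp - bn & `|b| = bp + bn].
Proof.
exists (Num.max b 0), (Num.max (- b) 0); rewrite !le_max !lexx !orbT; split => //.
  by have [c0|c0] := leP 0 b; have [d0|d0] := leP 0 (- b); lra.
by have [c0|c0] := leP 0 b; rewrite ?(ger0_norm c0) ?(ltr0_norm c0); have [d0|d0] := leP 0 (- b); lra.
Qed.

Lemma integral_ppn f : leb.-integrable D (EFin \o f) ->
  \int[leb]_(t in D) `|f t| = fine (conv (pw 1) (ppos T f) T) + fine (conv (pw 1) (pneg T f) T).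
Proof.
move=> fi; have [np nn cp cn] := nnmeas_ppn fi.
have [] := conv_pw1_ppn_lty T fi; rewrite !conv_pw1_int// => pT nT.
rewrite -!Rintegral_fine// -RintegralD//; last 2 first.
- exact: integrable_fine.
- exact: integrable_fine.
apply: eq_Rintegral => t; rewrite inE/= in_itv/= => tD.
rewrite pposE// pnegE//=.
have [c0|c0] := leP 0 (f t); rewrite ?(ger0_norm c0) ?(ltr0_norm c0);
by have [d0|d0] := leP 0 (- f t); lra.
Qed.

Lemma res_conv_lty (h : R -> \bar R) : nnmeas h -> causal h ->
  (conv (pw 1) h T < +oo)%E ->
  [/\ (conv (pw 1) (conv (res g m) h) T < +oo)%E &
   fine (conv (pw 1) (conv (res g m) h) T) <= T `^ g / g * fine (conv (pw 1) h T)].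
Proof.
move=> nh ch hT.
have h0 : (0 <= conv (pw 1) h T)%E by apply: conv_ge0 => //; exact: nnmeas_pw.
have rT := conv_pw1_res_le g_gt0 g_lt1 m0 T0.
have := conv_pw1_conv_le T nres nh cres ch.
have : (0 <= conv (pw 1) (res g m) T)%E by apply: conv_ge0 => //; exact: nnmeas_pw.
have : (0 <= conv (pw 1) (conv (res g m) h) T)%E.
  by apply: conv_ge0; [exact: nnmeas_pw|exact: nnmeas_conv].
move: rT hT h0; case: (conv (pw 1) (res g m) T) => // a; rewrite lee_fin => aT.
case: (conv (pw 1) h T) => // c _; rewrite lee_fin => c0.
case: (conv _ _ _) => [d d0|_|]//; rewrite -EFinM !lee_fin => a0 dac.
by split; [exact: ltry|rewrite (le_trans dac)// ler_wpM2r].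
Qed.

Lemma conv_pw1_le (h : R -> \bar R) (s t : R) : nnmeas h -> causal h -> s <= t ->
  (conv (pw 1) h s <= conv (pw 1) h t)%E.
Proof.
move=> nh ch st; rewrite !conv_pw1E//; apply: ge0_subset_integral => //.
- by apply: measurable_funTS; apply nh.
- by move=> x _; apply nh.
- by move=> x; rewrite /= !in_itv/= => /andP[-> xs]/=; exact: lt_le_trans st.
Qed.

(** [mode_kernel] gives cB v = b [res] + [res] * f1, with * for convolution. As f1 = a1 + 1 * f2,
    the last term is the primitive of zeta = a1 [res] + [res] * f2, which is bounded in L^1 by
    Young's inequality and the mass T^g/g of [pw g] on ]0, T[. *)
Theorem mode_rep v f1 f2 (b a1 : R) : leb.-integrable D (EFin \o v) ->
  leb.-integrable D (EFin \o f1) -> leb.-integrable D (EFin \o f2) ->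
  {ae leb, forall t, 0 < t < T ->
     \int[leb]_(r in `]0%R, t[) ((t - r) `^ (- g) * v r) +
     m * cB * \int[leb]_(r in `]0%R, t[) v r = b + \int[leb]_(r in `]0%R, t[) f1 r} ->
  {ae leb, forall t, 0 < t < T -> f1 t = a1 + \int[leb]_(r in `]0%R, t[) f2 r} ->
  exists zeta : R -> R, [/\ leb.-integrable D (EFin \o zeta),
    \int[leb]_(t in D) `|zeta t| <= T `^ g / g * (`|a1| + \int[leb]_(t in D) `|f2 t|) &
    {ae leb, forall t, 0 < t < T ->
      cB * v t = b * fine (res g m t) + \int[leb]_(r in `]0%R, t[) zeta r}].
Proof.
move=> iv if1 if2 H1 H2.
have [np nq cp cq] := nnmeas_ppn iv.
have [nf1p nf1n cf1p cf1n] := nnmeas_ppn if1.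
have [nf2p nf2n cf2p cf2n] := nnmeas_ppn if2.
have mv : measurable_fun D v by apply/measurable_EFinP; case/integrableP: iv.
have [bp [bn [bp0 bn0 bE nbE]]] := posneg b.
have [ap [an [ap0 an0 aE naE]]] := posneg a1.
have [vT vT'] := conv_pw1_ppn_lty T iv.
have [f1T f1T'] := conv_pw1_ppn_lty T if1.
have [f2T f2T'] := conv_pw1_ppn_lty T if2.
have npw (a : R) : nnmeas (pw a) := nnmeas_pw a.
have kfin1 := ae_fin_conv g'0 np cp vT.
have kfin2 := ae_fin_conv g'0 nq cq vT'.
have fin1 f t : leb.-integrable D (EFin \o f) ->
    exists x y, conv (pw 1) (ppos T f) t = x%:E /\ conv (pw 1) (pneg T f) t = y%:E.
  move=> fi; have [l1 l2] := conv_pw1_ppn_lty t fi; have [n1 n2 _ _] := nnmeas_ppn fi.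
  exists (fine (conv (pw 1) (ppos T f) t)), (fine (conv (pw 1) (pneg T f) t)).
  by rewrite !fineK// ge0_fin_numE// conv_ge0.
have step1 := mode_kernel g_gt0 g_lt1 m0 T0 bp0 bn0 np nq nf1p nf1n cp cq cf1p cf1n vT vT' f1T f1T'.
have {}step1 : {ae leb, forall t, 0 < t < T ->
    [/\ (cB%:E * ppos T v t + (bn%:E * res g m t + conv (res g m) (pneg T f1) t) \is a fin_num)%E,
        (cB%:E * pneg T v t + (bp%:E * res g m t + conv (res g m) (ppos T f1) t) \is a fin_num)%E &
        (cB%:E * ppos T v t + (bn%:E * res g m t + conv (res g m) (pneg T f1) t) =
        cB%:E * pneg T v t + (bp%:E * res g m t + conv (res g m) (ppos T f1) t))%E]}.
  apply: step1; apply: (ae_imp2 _ (ae_imp2 (fun t h1 h2 => conj h1 h2) kfin1 kfin2) H1).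
  move=> t [/= p1 p2] h1 tT; have tD : t \in `]0, T[ by rewrite in_itv.
  have {}p1 := p1 tD; have {}p2 := p2 tD; have {}h1 := h1 tT.
  have /andP[t_gt0 /ltW tT'] := tT.
  move: h1; rewrite (Rintegral_ppos tT' iv) (Rintegral_ppos tT' if1).
  have -> : \int[leb]_(r in `]0, t[) ((t - r) `^ (- g) * v r) =
     fine (conv (pw (1 - g)) (ppos T v) t) - fine (conv (pw (1 - g)) (pneg T v) t).
    have l1 : (conv (pw (1 - g)) (ppos T v) t < +oo)%E.
      by rewrite -ge0_fin_numE//; apply: conv_ge0.
    have l2 : (conv (pw (1 - g)) (pneg T v) t < +oo)%E.
      by rewrite -ge0_fin_numE//; apply: conv_ge0.
    apply: etrans (Rintegral_conv_pw tT' l1 l2 mv).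
    by apply: eq_Rintegral => r _; congr (_ `^ _ * _); ring.
  have [x [y [-> ->]]] := fin1 v t iv; have [x1 [y1 [-> ->]]] := fin1 f1 t if1.
  rewrite -(fineK p1) -(fineK p2) bE pwE// subrr powRr0.
  move=> /= h; rewrite -!EFinM -!EFinD; congr EFin; lra.
(* [step2] states that [res] * f1 is the primitive of a1 [res] + [res] * f2, again with the negative
   terms on the opposite side. *)
have nr (h : R -> \bar R) : nnmeas h -> nnmeas (conv (res g m) h) by move=> ?; exact: nnmeas_conv.
have step2 t : t <= T ->
   (conv (res g m) (ppos T f1) t + (an%:E * conv (pw 1) (res g m) t + conv (pw 1) (conv (res g m) (pneg T f2)) t) =
    conv (res g m) (pneg T f1) t + (ap%:E * conv (pw 1) (res g m) t + conv (pw 1) (conv (res g m) (ppos T f2)) t))%E.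
  pose W (a : R) h1 h2 := (h1 \+ ((fun s => a%:E * pw 1 s) \+ conv (pw 1) h2))%E.
  have nW (a : R) h1 h2 : 0 <= a -> nnmeas h1 -> nnmeas h2 -> nnmeas (W a h1 h2).
    move=> a0 n1 n2; apply: nnmeasD => //; apply: nnmeasD; [exact: nnmeasZ|exact: nnmeas_conv].
  have cW (a : R) h1 h2 : causal h1 -> causal h2 -> causal (W a h1 h2).
    move=> c1 c2 s s0; rewrite /W/= c1// causal_pw// (causal_conv (@causal_pw _ 1) c2)//.
    by rewrite mule0 !adde0.
  have WE (a : R) h1 h2 s : 0 <= a -> nnmeas h1 -> nnmeas h2 -> conv (res g m) (W a h1 h2) s =
      (conv (res g m) h1 s + (a%:E * conv (pw 1) (res g m) s + conv (pw 1) (conv (res g m) h2) s))%E.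
    move=> a0 n1 n2; have n3 := nnmeas_conv (npw 1) n2; have n4 := nnmeasZ a0 (npw 1).
    rewrite /W (convDr nres n1 (nnmeasD n4 n3)) (convDr nres n4 n3).
    by rewrite (convZr a0 nres (npw 1)) (res_conv_primitive g_gt0 g_lt1 m0 n2) (convC nres (npw 1)).
  move=> tT; rewrite -(WE _ _ _ t an0 nf1p nf2n) -(WE _ _ _ t ap0 nf1n nf2p).
  refine (ae_eq_conv cres nres (nW _ _ _ an0 nf1p nf2n) (nW _ _ _ ap0 nf1n nf2p) (cW _ _ _ cf1p cf2n) (cW _ _ _ cf1n cf2p) _ tT).
  apply: (ae_imp _ H2) => s Hs sT; have {}Hs := Hs sT; have /andP[s0 /ltW sT'] := sT.
  move: Hs; rewrite (Rintegral_ppos sT' if2) /W/= pposE// pnegE//.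
  have [x [y [-> ->]]] := fin1 f2 s if2; rewrite pwE// subrr powRr0 aE /= => Hs.
  rewrite -!EFinM -!EFinD; congr EFin.
  by rewrite max0_diff; lra.
have [r2pT r2pl] := res_conv_lty nf2p cf2p f2T.
have [r2nT r2nl] := res_conv_lty nf2n cf2n f2T'.
have resT := conv_pw1_res_lty g_gt0 g_lt1 m0 T0.
pose zeta t := a1 * fine (res g m t) +
  (fine (conv (res g m) (ppos T f2) t) - fine (conv (res g m) (pneg T f2) t)).
have mD : measurable (D : set mR) by exact: measurable_itv.
have n2p := nr _ nf2p; have n2n := nr _ nf2n.
have c2p := causal_conv cres cf2p; have c2n := causal_conv cres cf2n.
have fineI h : nnmeas h -> causal h -> (conv (pw 1) h T < +oo)%E ->
    leb.-integrable D (EFin \o (fun t => fine (h t))).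
  by move=> nh ch hT; apply: integrable_fine => //; rewrite -conv_pw1_int.
have I0 := fineI _ nres cres resT.
have Ip := fineI _ n2p c2p r2pT; have In := fineI _ n2n c2n r2nT.
have Ipn : leb.-integrable D (EFin \o (fun t => fine (conv (res g m) (ppos T f2) t) -
    fine (conv (res g m) (pneg T f2) t))).
  exact: (integrableB mD Ip In).
have Ia : leb.-integrable D (EFin \o (fun t => a1 * fine (res g m t))).
  exact: (integrableZl mD a1 I0).
have Iz : leb.-integrable D (EFin \o zeta).
  exact: (integrableD mD Ia Ipn).
have intE h t : nnmeas h -> causal h -> (conv (pw 1) h T < +oo)%E -> t <= T ->
    \int[leb]_(r in `]0, t[) fine (h r) = fine (conv (pw 1) h t).
  move=> nh ch hT tT; rewrite Rintegral_fine//; first by rewrite conv_pw1E.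
  by have := le_lt_trans (conv_pw1_le nh ch tT) hT; rewrite (conv_pw1E _ ch).
exists zeta; split => //.
  pose bnd t := `|a1| * fine (res g m t) +
     (fine (conv (res g m) (ppos T f2) t) + fine (conv (res g m) (pneg T f2) t)).
  have Ipn' : leb.-integrable D (EFin \o (fun t => fine (conv (res g m) (ppos T f2) t) +
      fine (conv (res g m) (pneg T f2) t))).
    exact: (integrableD mD Ip In).
  have Ia' : leb.-integrable D (EFin \o (fun t => `|a1| * fine (res g m t))).
    exact: (integrableZl mD `|a1| I0).
  have Ib : leb.-integrable D (EFin \o bnd).
    exact: (integrableD mD Ia' Ipn').
  apply: (@le_trans _ _ (\int[leb]_(t in D) bnd t)).
    apply: le_Rintegral => //; first exact: integrable_norm.
    move=> t _; rewrite /zeta /bnd (le_trans (ler_normD _ _))// lerD//.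
      by rewrite normrM (ger0_norm (fine_ge0 _))//; apply nres.
    rewrite (le_trans (ler_normB _ _))// !ger0_norm ?fine_ge0//; first by apply n2n.
    by apply n2p.
  rewrite RintegralD// RintegralD// RintegralZl// !intE// (integral_ppn if2) mulrDr lerD//.
    rewrite mulrC ler_wpM2r//.
    have := conv_pw1_res_le g_gt0 g_lt1 m0 T0.
    have : (0 <= conv (pw 1) (res g m) T)%E by apply: conv_ge0.
    by case: (conv _ _ _).
  by rewrite mulrDr lerD.
apply: (ae_imp _ step1) => t st1 tT; have [s1 s2 s3] := st1 tT.
have /andP[t_gt0 /ltW tT'] := tT.
have tD : `]0, t[%classic `<=` D.
  by move=> r; rewrite /= !in_itv/= => /andP[-> rt]/=; exact: lt_le_trans tT'.
have mt : measurable (`]0, t[%classic : set mR) by exact: measurable_itv.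
have -> : \int[leb]_(r in `]0, t[) zeta r = a1 * fine (conv (pw 1) (res g m) t) +
    (fine (conv (pw 1) (conv (res g m) (ppos T f2)) t) -
     fine (conv (pw 1) (conv (res g m) (pneg T f2)) t)).
  rewrite -(intE _ _ nres cres resT tT') -(intE _ _ n2p c2p r2pT tT').
  rewrite -(intE _ _ n2n c2n r2nT tT') RintegralD//; last 2 first.
  - exact: (integrableS mD mt tD Ia).
  - exact: (integrableS mD mt tD Ipn).
  rewrite RintegralB//; last 2 first.
  - exact: (integrableS mD mt tD Ip).
  - exact: (integrableS mD mt tD In).
  by rewrite RintegralZl//; exact: (integrableS mD mt tD I0).
have finc h : nnmeas h -> causal h -> (conv (pw 1) h T < +oo)%E ->
    conv (pw 1) h t = (fine (conv (pw 1) h t))%:E.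
  move=> nh ch hT; apply/esym/fineK; rewrite ge0_fin_numE; last exact: conv_ge0.
  exact: le_lt_trans (conv_pw1_le nh ch tT') hT.
have := step2 t tT'.
rewrite (finc _ nres cres resT) (finc _ n2p c2p r2pT) (finc _ n2n c2n r2nT) /=.
move: (fine (conv (pw 1) (res g m) t)) => A.
move: (fine (conv (pw 1) (conv (res g m) (ppos T f2)) t)) => B.
move: (fine (conv (pw 1) (conv (res g m) (pneg T f2)) t)) => C.
move: s1 s2 s3; rewrite pposE// pnegE// resE//.
have := (nr _ nf1p).2 t; have := (nr _ nf1n).2 t.
case: (conv (res g m) (pneg T f1) t) => [R1n| |]// _; case: (conv (res g m) (ppos T f1) t) => [R1p| |]// _ _ _.
rewrite -!EFinM -!EFinD => -[e1] [e2]; rewrite bE aE /=.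
have E1 : cB * Num.max (v t) 0 + (bn * (t `^ (g - 1) * ml g (m * t `^ g)) + R1n) =
   cB * Num.max (- v t) 0 + (bp * (t `^ (g - 1) * ml g (m * t `^ g)) + R1p) by [].
have E2 : R1p + (an * A + C) = R1n + (ap * A + B) by [].
rewrite max0_diff mulrDr in E1; clear -E1 E2; lra.
Qed.

End mode_real.

(** * Real integrals over time steps *)

Section interval_integrals.
Context {R : realType}.
Local Notation mR := (measurableTypeR R).
Local Notation leb := (@lebesgue_measure R).
Implicit Types (F u h : R -> R) (I : set mR).

Lemma integrable_dominated I F h : measurable I -> measurable_fun I F ->
  leb.-integrable I (EFin \o h) -> (forall s, I s -> `|F s| <= h s) ->
  leb.-integrable I (EFin \o F).
Proof.
move=> mI mF ih Fh; have mF' : measurable_fun I (EFin \o F) by exact/measurable_EFinP.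
apply: (le_integrable _ _ _ ih) => // s Is /=.
by rewrite lee_fin (le_trans (Fh _ Is))// ler_norm.
Qed.

(** Against a function of mean zero, h may be replaced by h - k1, which lies between 0 and k2 -
    k1. *)
Lemma mean_zero_bound I u h (k1 k2 : R) : measurable I -> 
  leb.-integrable I (EFin \o u) -> measurable_fun I h ->
  (forall s, I s -> k1 <= h s <= k2) -> \int[leb]_(s in I) u s = 0 ->
  leb.-integrable I (EFin \o (fun s => h s * u s)) /\
  `|\int[leb]_(s in I) (h s * u s)| <= (k2 - k1) * \int[leb]_(s in I) `|u s|.
Proof.
move=> mI iu mh hk u0.
have mu_ : measurable_fun I u by apply/measurable_EFinP; case/integrableP: iu.
have ina : leb.-integrable I (EFin \o (fun s => `|u s|)) by exact: integrable_norm.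
have hb s : I s -> `|h s| <= `|k1| + `|k2|.
  move=> /hk /andP[h1 h2]; rewrite ler_norml; apply/andP; split.
    rewrite (le_trans _ h1)// lerNl (le_trans (ler_norm _))// normrN lerDl//.
  by rewrite (le_trans h2)// (le_trans (ler_norm _))// lerDr.
have ihu : leb.-integrable I (EFin \o (fun s => h s * u s)).
  apply: (@integrable_dominated _ _ (fun s => (`|k1| + `|k2|) * `|u s|)) => //.
  - exact: measurable_funM.
  - exact: (integrableZl mI (`|k1| + `|k2|) ina).
  - by move=> s Is; rewrite normrM ler_wpM2r// hb.
split => //.
have ik1 : leb.-integrable I (EFin \o (fun s => k1 * u s)) by exact: (integrableZl mI k1 iu).
have -> : \int[leb]_(s in I) (h s * u s) = \int[leb]_(s in I) (h s * u s - k1 * u s).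
  by rewrite RintegralB// RintegralZl// u0 mulr0 subr0.
have idf : leb.-integrable I (EFin \o (fun s => h s * u s - k1 * u s)).
  exact: (integrableB mI ihu ik1).
rewrite (le_trans (le_normr_Rintegral mI idf))// -RintegralZl//.
apply: le_Rintegral => //; first exact: integrable_norm.
  exact: (integrableZl mI (k2 - k1) ina).
move=> s Is; rewrite -mulrBl normrM ler_wpM2r//.
by have /andP[h1 h2] := hk _ Is; rewrite ger0_norm ?subr_ge0// lerB.
Qed.

Lemma Rintegral_setU_itv F (x y z : R) : x <= y -> y <= z ->
  leb.-integrable `]x, z[ (EFin \o F) ->
  \int[leb]_(s in `]x, z[) F s = \int[leb]_(s in `]x, y[) F s + \int[leb]_(s in `]y, z[) F s.
Proof.
rewrite le_eqVlt => /predU1P[<- _ _|xy].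
  by rewrite (set_itv_ge (b1 := BRight x) (b2 := BLeft x)) ?bnd_simp ?ltxx// Rintegral_set0 add0r.
rewrite le_eqVlt => /predU1P[<- _|yz].
  by rewrite (set_itv_ge (b1 := BRight y) (b2 := BLeft y)) ?bnd_simp ?ltxx// Rintegral_set0 addr0.
move=> iF.
have s1 : `]x, y[%classic `<=` `]x, z[%classic.
  by move=> s; rewrite /= !in_itv/= => /andP[-> /lt_trans]; apply.
have s2 : `[y, z[%classic `<=` `]x, z[%classic.
  by move=> s; rewrite /= !in_itv/= => /andP[ys ->]; rewrite (lt_le_trans xy).
have s3 : `]y, z[%classic `<=` `]x, z[%classic.
  by move=> s; rewrite /= !in_itv/= => /andP[ys ->]; rewrite (lt_trans xy).
have E : `]x, z[%classic = `]x, y[%classic `|` `[y, z[%classic.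
  apply/seteqP; split => [s|s [/s1//|/s2//]].
  rewrite /= !in_itv/= => /andP[xs sz]; have [sy|ys] := ltP s y.
    by left; rewrite xs.
  by right; rewrite sz.
rewrite [in LHS]E Rintegral_setU//.
- congr (_ + _); rewrite Rintegral_itv_obnd_cbnd//.
  by apply: (integrableS _ _ _ iF).
- by rewrite -E.
- apply/disj_setPS => s [] /=; rewrite !in_itv/= => /andP[_ sy] /andP[ys _].
  by move: (lt_le_trans sy ys); rewrite ltxx.
Qed.

Lemma Rintegral_sum_itv F (tau : R) n : 0 <= tau ->
  leb.-integrable `]0, n%:R * tau[ (EFin \o F) ->
  \int[leb]_(s in `]0, n%:R * tau[) F s =
  \sum_(i < n) \int[leb]_(s in `]i%:R * tau, i.+1%:R * tau[) F s.
Proof.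
move=> tau0; elim: n => [|n ih] iF.
  by rewrite big_ord0 mul0r (set_itv_ge (b1 := BRight 0) (b2 := BLeft 0)) ?bnd_simp ?ltxx// Rintegral_set0.
have nt : n%:R * tau <= n.+1%:R * tau by rewrite ler_wpM2r// ler_nat.
rewrite big_ord_recr/= -ih; last first.
  apply: (integrableS _ _ _ iF) => // s; rewrite /= !in_itv/= => /andP[-> sn]/=.
  exact: lt_le_trans nt.
by rewrite -Rintegral_setU_itv// mulr_ge0.
Qed.

End interval_integrals.

(** * Integrals of the Caputo kernel *)

Section kernel_integral.
Context {R : realType}.
Local Notation mR := (measurableTypeR R).
Local Notation leb := (@lebesgue_measure R).

Lemma integral_kernel_end (b x t : R) : 0 < b -> x <= t ->
  (\int[leb]_(s in `]x, t[) ((t - s) `^ (b - 1))%:E = ((t - x) `^ b / b)%:E)%E.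
Proof.
move=> b0 xt.
rewrite -(@conv_pw1 _ b (t - x)) ?subr_ge0// convC; try exact: nnmeas_pw.
have nn : nnmeas (fun s => (pw b (t - x - s) * pw 1 s)%E).
  split; first by apply: measurable_conv_integrand; exact: nnmeas_pw.
  by move=> s; apply: mule_ge0; apply nnmeas_pw.
rewrite /conv -(ge0_integral_addr x nn) [LHS]integral_mkcond.
apply: eq_integral => s _; rewrite patchE; case: ifPn => [|/negP].
  rewrite inE/= in_itv/= => /andP[xs st].
  rewrite [pw 1 _]pwE ?subr_gt0// subrr powRr0 mule1 pwE; last by lra.
  by congr (_ `^ _)%:E; ring.
rewrite inE/= in_itv/= => /negP; rewrite negb_and -!leNgt => /orP[sx|ts].
  by rewrite (causal_pw _ (t := (s - x))) ?mule0// subr_le0.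
by rewrite (causal_pw _ (t := (t - x - (s - x)))) ?mul0e//; lra.
Qed.

Lemma measurable_kernel (b t : R) (I : set mR) :
  measurable_fun I (fun s => (t - s) `^ b).
Proof.
apply: measurable_funTS.
apply: (@measurableT_comp _ _ _ mR mR mR (fun x : R => x `^ b)).
  exact: measurable_powR.
exact: measurable_subr.
Qed.

Lemma integrable_kernel (b x y t : R) : 0 < b -> x <= t -> y <= t ->
  leb.-integrable `]x, y[ (EFin \o (fun s => (t - s) `^ (b - 1))).
Proof.
move=> b0 xt yt.
have it : leb.-integrable `]x, t[ (EFin \o (fun s => (t - s) `^ (b - 1))).
  apply/integrableP; split; first by apply/measurable_EFinP; exact: measurable_kernel.
  under eq_integral do rewrite /= ger0_norm ?powR_ge0//.
  by rewrite integral_kernel_end// ltry.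
apply: (integrableS _ _ _ it) => // s; rewrite /= !in_itv/= => /andP[-> sy]/=.
exact: lt_le_trans yt.
Qed.

Lemma Rintegral_kernel (b x y t : R) : 0 < b -> x <= y -> y <= t ->
  \int[leb]_(s in `]x, y[) (t - s) `^ (b - 1) = ((t - x) `^ b - (t - y) `^ b) / b.
Proof.
move=> b0 xy yt; have xt := le_trans xy yt.
have := Rintegral_setU_itv xy yt (integrable_kernel b0 xt (lexx t)).
rewrite {1 3}/Rintegral !integral_kernel_end//= => e.
by rewrite mulrBl e addrK.
Qed.

Lemma integrable_powR (a t : R) : 0 < a -> 0 <= t ->
  leb.-integrable `]0, t[ (EFin \o (fun s => s `^ (a - 1))).
Proof.
move=> a0 t0; apply/integrableP; split.
  by apply/measurable_EFinP; apply: measurable_funTS; exact: measurable_powR.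
under eq_integral do rewrite /= ger0_norm ?powR_ge0//.
by rewrite integral_powR// ltry.
Qed.

Lemma integral_Beta (a b t : R) : 0 < a -> 0 < b -> 0 < t ->
  (\int[leb]_(s in `]0%R, t[) ((t - s) `^ (a - 1) * s `^ (b - 1))%:E =
   (Beta a b * t `^ (a + b - 1))%:E)%E.
Proof.
move=> a0 b0 t0; rewrite -conv_pw// conv_causalE; try exact: causal_pw.
apply: eq_integral => s; rewrite inE/= in_itv/= => /andP[s0 st].
by rewrite !pwE ?subr_gt0.
Qed.

Lemma integrable_Beta (a b t : R) : 0 < a -> 0 < b -> 0 < t ->
  leb.-integrable `]0, t[ (EFin \o (fun s => (t - s) `^ (a - 1) * s `^ (b - 1))).
Proof.
move=> a0 b0 t0; apply/integrableP; split.
  apply/measurable_EFinP; apply: measurable_funM; first exact: measurable_kernel.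
  by apply: measurable_funTS; exact: measurable_powR.
under eq_integral do rewrite /= ger0_norm ?mulr_ge0 ?powR_ge0//.
by rewrite integral_Beta// ltry.
Qed.

End kernel_integral.

(** * Consistency of the L1 scheme for a scalar function with a singularity at 0 *)

Section scheme_residual.
Context {R : realType}.
Local Notation mR := (measurableTypeR R).
Local Notation leb := (@lebesgue_measure R).
Variables (g tau B : R) (K : nat) (V : R -> R) (delta : nat -> R).
Hypotheses (g_gt0 : 0 < g) (g_lt1 : g < 1) (tau_gt0 : 0 < tau) (B_ge0 : 0 <= B).
Local Notation T := (K%:R * tau).
Local Notation I i := (`]i%:R * tau, i.+1%:R * tau[%classic : set R).
Hypothesis mV : measurable_fun (`]0, T[ : set mR) (V : mR -> mR).
Hypothesis V_le : forall t, 0 < t < T -> `|V t| <= B * t `^ (g - 1).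
Hypothesis osc : forall j s s', (0 < j < K)%N -> I j s -> I j s' -> `|V s - V s'| <= delta j.
Hypothesis delta_sum : \sum_(1 <= j < K) delta j <= B * tau `^ (g - 1).

Let g'0 : 0 < 1 - g. Proof. by rewrite subr_gt0. Qed.
Let expE : - g = 1 - g - 1. Proof. by ring. Qed.

Let mean i := tau^-1 * \int[leb]_(s in I i) V s.
Let h k s := (k.+1%:R * tau - s) `^ (- g).
Let err k i := \int[leb]_(s in I i) (h k s * (V s - mean i)).

Let ordn_le (m n : nat) : (m <= n)%N -> m%:R * tau <= n%:R * tau.
Proof. by move=> mn; rewrite ler_wpM2r ?(ltW tau_gt0)// ler_nat. Qed.

Let I_sub i n : (i < n)%N -> I i `<=` (`]0, n%:R * tau[%classic : set R).
Proof.
move=> iK s; rewrite /= !in_itv/= => /andP[i_s si]; apply/andP; split.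
  by rewrite (le_lt_trans _ i_s)// mulr_ge0// ltW.
exact: lt_le_trans (ordn_le iK).
Qed.

Let mI i : measurable (I i : set mR). Proof. exact: measurable_itv. Qed.

Lemma integrable_V : leb.-integrable `]0, T[ (EFin \o V).
Proof.
apply: (@integrable_dominated _ _ _ (fun t => B * t `^ (g - 1))) => //.
by apply: (integrableZl _ B (integrable_powR g_gt0 _)) => //; rewrite mulr_ge0// ltW.
Qed.

Lemma integrable_V_itv i : (i < K)%N -> leb.-integrable (I i) (EFin \o V).
Proof. by move=> iK; apply: (integrableS _ _ _ integrable_V) => //; exact: I_sub. Qed.

Lemma measure_itv i : leb (I i) = tau%:E.
Proof.
rewrite lebesgue_measure_itv/= lte_fin ltr_pM2r// ltr_nat ltnS leqnn -EFinB.
by congr EFin; rewrite -natr1; ring.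
Qed.

Lemma integrable_cst_itv i (c : R) : leb.-integrable (I i) (EFin \o cst c).
Proof.
apply/integrableP; split; first by apply/measurable_EFinP; exact: measurable_cst.
rewrite [ltLHS](_ : _ = \int[leb]_(s in I i) (`|c|%:E))%E; last exact: eq_integral.
by rewrite integral_cst//= measure_itv -EFinM ltry.
Qed.

Lemma Rintegral_cst_itv i (c : R) : \int[leb]_(s in I i) c = c * tau.
Proof. by rewrite Rintegral_cst//= measure_itv. Qed.

Lemma integrable_dev i : (i < K)%N ->
  leb.-integrable (I i) (EFin \o (fun s => V s - mean i)).
Proof.
by move=> iK; exact: (integrableB (mI i) (integrable_V_itv iK) (integrable_cst_itv i (mean i))).
Qed.

Lemma mean_zero i : (i < K)%N -> \int[leb]_(s in I i) (V s - mean i) = 0.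
Proof.
move=> iK; rewrite RintegralB//; [|exact: integrable_V_itv|exact: integrable_cst_itv].
by rewrite Rintegral_cst_itv /mean mulrAC mulVf ?mul1r ?subrr// gt_eqF.
Qed.

Lemma integrable_hV k : (k < K)%N ->
  leb.-integrable `]0, k.+1%:R * tau[ (EFin \o (fun s => h k s * V s)).
Proof.
move=> kK; have t0 : 0 < k.+1%:R * tau by rewrite mulr_gt0.
have sub : `]0, k.+1%:R * tau[%classic `<=` (`]0, T[%classic : set R).
  by move=> s; rewrite /= !in_itv/= => /andP[-> sk]/=; exact: lt_le_trans (ordn_le kK).
apply: (@integrable_dominated _ _ _
    (fun s => B * ((k.+1%:R * tau - s) `^ (1 - g - 1) * s `^ (g - 1)))) => //.
- apply: measurable_funM; first exact: measurable_kernel.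
  exact: (measurable_funS _ sub mV).
- by apply: (integrableZl _ B (integrable_Beta g'0 g_gt0 t0)).
- move=> s sI; rewrite /h -expE normrM (ger0_norm (powR_ge0 _ _)) [leRHS]mulrCA.
  rewrite ler_wpM2l ?powR_ge0//; apply: V_le.
  by have := sub _ sI; rewrite /= in_itv.
Qed.

Lemma integrable_h k i : (i <= k)%N -> leb.-integrable (I i) (EFin \o h k).
Proof.
move=> ik; rewrite /h expE; apply: integrable_kernel => //.
  by apply: ordn_le; exact: leqW.
exact: ordn_le.
Qed.

Lemma integral_h k i : (i <= k)%N -> \int[leb]_(s in I i) h k s =
  tau `^ (1 - g) * ((k - i).+1%:R `^ (1 - g) - (k - i)%:R `^ (1 - g)) / (1 - g).
Proof.
move=> ik; have := Rintegral_kernel g'0 (ordn_le (leqnSn i)) (ordn_le (ik : (i < k.+1)%N)).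
rewrite -expE => ->.
have -> : k.+1%:R * tau - i%:R * tau = (k - i).+1%:R * tau.
  by rewrite -mulrBl -natrB ?subSn// leqW.
have -> : k.+1%:R * tau - i.+1%:R * tau = (k - i)%:R * tau.
  by rewrite -mulrBl -natrB ?subSS.
rewrite (powRM _ (ler0n _ _) (ltW tau_gt0)) (powRM _ (ler0n _ _) (ltW tau_gt0)).
by congr (_ / _); ring.
Qed.

(** The weights of the scheme are the integrals of the kernel over the steps, so the scheme is the
    Caputo integral with V replaced by its mean on each step. The sum is reversed to match the lag j
    with the step i = k - j. *)
Lemma err_decomp k : (k < K)%N ->
  \int[leb]_(s in `]0, k.+1%:R * tau[) (h k s * V s) -
  (1 - g)^-1 * \sum_(j < k.+1) (j.+1%:R `^ (1 - g) - j%:R `^ (1 - g)) *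
    ((\int[leb]_(s in I (k - j)%N) V s) / tau `^ g) = \sum_(i < k.+1) err k i.
Proof.
move=> kK; have ihV := integrable_hV kK.
rewrite Rintegral_sum_itv ?(ltW tau_gt0)// mulr_sumr.
rewrite [X in _ - X](reindex_inj rev_ord_inj)/= -sumrB.
apply: eq_bigr => i _; have ik : (i <= k)%N by rewrite -ltnS.
have iK : (i < K)%N by exact: leq_ltn_trans kK.
have ihVi : leb.-integrable (I i) (EFin \o (fun s => h k s * V s)).
  by apply: (integrableS _ _ _ ihV) => //; exact: I_sub.
rewrite subSS /err.
have -> : \int[leb]_(s in I i) (h k s * (V s - mean i)) =
   \int[leb]_(s in I i) (h k s * V s - mean i * h k s).
  by apply: eq_Rintegral => s _; ring.
rewrite RintegralB//; last exact: (integrableZl (mI i) (mean i) (integrable_h ik)).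
rewrite RintegralZl//; last exact: integrable_h.
rewrite integral_h// subKn//; congr (_ - _).
rewrite /mean; have -> : tau `^ (1 - g) = tau / tau `^ g.
  by rewrite powRB ?(gt_eqF tau_gt0) ?implybT// powRr1// ltW.
have tg : tau `^ g != 0 by rewrite gt_eqF// powR_gt0.
have t_neq0 : tau != 0 by rewrite gt_eqF.
have g_neq0 : 1 - g != 0 by rewrite gt_eqF.
by field; rewrite tg t_neq0 g_neq0.
Qed.

Let Q i := \int[leb]_(s in I i) `|V s - mean i|.

Lemma Q_ge0 i : 0 <= Q i.
Proof. by apply: Rintegral_ge0. Qed.

(** V minus its mean integrates to zero, so by [mean_zero_bound] only the oscillation of the
    monotone kernel over the step counts. *)
Lemma err_lt k i : (k < K)%N -> (i < k)%N ->
  `|err k i| <= ((k - i)%:R `^ (- g) - (k - i).+1%:R `^ (- g)) * tau `^ (- g) * Q i.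
Proof.
move=> kK ik; have iK : (i < K)%N by exact: ltn_trans kK.
have ki0 : (0 < k - i)%N by rewrite subn_gt0.
have Ng : - g <= 0 by rewrite oppr_le0 ltW.
have Isub s : I i s -> (k - i)%:R * tau <= k.+1%:R * tau - s <= (k - i).+1%:R * tau.
  rewrite /= in_itv/= => /andP[is1 is2].
  have -> : (k - i)%:R * tau = k.+1%:R * tau - i.+1%:R * tau :> R.
    by rewrite -mulrBl -natrB ?subSS// ltnS ltnW.
  have -> : (k - i).+1%:R * tau = k.+1%:R * tau - i%:R * tau :> R.
    by rewrite -mulrBl -natrB ?subSn// ltnW// leqW// ltnW.
  by rewrite !lerB// ltW.
have hb s : I i s -> ((k - i).+1%:R * tau) `^ (- g) <= h k s <= ((k - i)%:R * tau) `^ (- g).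
  move=> /Isub /andP[s1 s2]; have p : 0 < (k - i)%:R * tau by rewrite mulr_gt0// ltr0n.
  by rewrite /h !le0_ler_powR//; exact: lt_le_trans s1.
have mh : measurable_fun (I i : set mR) (h k) by exact: measurable_kernel.
have [_ +] := mean_zero_bound (mI i) (integrable_dev iK) mh hb (mean_zero iK).
by rewrite !powRM ?ler0n ?(ltW tau_gt0)// -mulrBl.
Qed.

Lemma osc_mean j s : (0 < j < K)%N -> I j s -> `|V s - mean j| <= delta j.
Proof.
move=> jK js; have /andP[j0 jK'] := jK.
rewrite -(ler_pM2r tau_gt0) -[X in _ * X <= _](gtr0_norm tau_gt0) -normrM.
have -> : (V s - mean j) * tau = \int[leb]_(s' in I j) (V s - V s').
  rewrite RintegralB//; [|exact: integrable_cst_itv|exact: integrable_V_itv].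
  by rewrite Rintegral_cst_itv mulrBl /mean mulrAC mulVf ?mul1r// gt_eqF.
have id : leb.-integrable (I j) (EFin \o (fun s' => V s - V s')).
  exact: (integrableB (mI j) (integrable_cst_itv j (V s)) (integrable_V_itv jK')).
rewrite (le_trans (le_normr_Rintegral (mI j) id))// -(Rintegral_cst_itv j (delta j)).
apply: le_Rintegral => //; first exact: integrable_norm.
  exact: integrable_cst_itv.
by move=> s' js'; exact: osc.
Qed.

Lemma Q_le j : (0 < j < K)%N -> Q j <= tau * delta j.
Proof.
move=> jK; have /andP[j0 jK'] := jK; rewrite mulrC -(Rintegral_cst_itv j (delta j)).
apply: le_Rintegral => //; first exact: (integrable_norm (integrable_dev jK')).
  exact: integrable_cst_itv.
by move=> s js; exact: osc_mean.
Qed.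

Lemma delta_ge0 j : (0 < j < K)%N -> 0 <= delta j.
Proof. by move=> /Q_le/(le_trans (Q_ge0 j)); rewrite pmulr_rge0. Qed.

(** On the last step the kernel is unbounded but integrable, so the oscillation of V is used
    instead. *)
Lemma err_diag j : (0 < j < K)%N -> `|err j j| <= delta j * (tau `^ (1 - g) / (1 - g)).
Proof.
move=> jK; have /andP[j0 jK'] := jK.
have ih := integrable_h (leqnn j).
have mh : measurable_fun (I j : set mR) (h j) by exact: measurable_kernel.
have mdev : measurable_fun (I j : set mR) (fun s => V s - mean j).
  by apply/measurable_EFinP; have /integrableP[] := integrable_dev jK'.
have ihd : leb.-integrable (I j) (EFin \o (fun s => delta j * h j s)).
  exact: (integrableZl (mI j) (delta j) ih).
have le1 s : I j s -> `|h j s * (V s - mean j)| <= delta j * h j s.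
  move=> js; rewrite normrM (ger0_norm (powR_ge0 _ _)) mulrC.
  by rewrite ler_wpM2r ?powR_ge0// osc_mean.
have ie : leb.-integrable (I j) (EFin \o (fun s => h j s * (V s - mean j))).
  by apply: (integrable_dominated (mI j) _ ihd le1); exact: measurable_funM.
rewrite (le_trans (le_normr_Rintegral (mI j) ie))//.
have -> : delta j * (tau `^ (1 - g) / (1 - g)) = \int[leb]_(s in I j) (delta j * h j s).
  rewrite RintegralZl// integral_h// subnn powR1 powR0 ?gt_eqF// subr0.
  by congr (_ * _); rewrite mulr1.
by apply: le_Rintegral => //; exact: integrable_norm.
Qed.

Hypothesis K_gt0 : (0 < K)%N.

Lemma I0E : I 0%N = (`]0, tau[%classic : set R).
Proof. by rewrite mul0r mul1r. Qed.

Lemma normV_I0 : \int[leb]_(s in I 0%N) `|V s| <= B * (tau `^ g / g).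
Proof.
have i0 : leb.-integrable (I 0%N) (EFin \o (fun s => s `^ (g - 1))).
  by rewrite I0E; apply: integrable_powR => //; exact: ltW.
have -> : tau `^ g / g = \int[leb]_(s in I 0%N) s `^ (g - 1).
  by rewrite I0E /Rintegral integral_powR// ltW.
rewrite -RintegralZl//; apply: le_Rintegral => //.
- exact: (integrable_norm (integrable_V_itv K_gt0)).
- exact: (integrableZl (mI 0) B i0).
- by move=> s /(I_sub K_gt0); rewrite /= in_itv/=; exact: V_le.
Qed.

Lemma mean0_le : `|mean 0%N| <= B * (tau `^ (g - 1) / g).
Proof.
rewrite /mean normrM gtr0_norm ?invr_gt0//.
have -> : tau `^ (g - 1) = tau^-1 * tau `^ g.
  by rewrite powRB ?(gt_eqF tau_gt0) ?implybT// powRr1 ?ltW// mulrC.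
rewrite -[tau^-1 * _ / g]mulrA mulrCA ler_wpM2l ?invr_ge0 ?(ltW tau_gt0)//.
rewrite (le_trans (le_normr_Rintegral (mI 0) (integrable_V_itv K_gt0)))//.
exact: normV_I0.
Qed.

Lemma Q0_le : Q 0%N <= 2 * B * (tau `^ g / g).
Proof.
have i1 := integrable_norm (integrable_V_itv K_gt0).
apply: (@le_trans _ _ (\int[leb]_(s in I 0%N) (`|V s| + `|mean 0%N|))).
  apply: le_Rintegral => //.
  - exact: (integrable_norm (integrable_dev K_gt0)).
  - exact: (integrableD (mI 0) i1 (integrable_cst_itv 0 _)).
  - by move=> s _; exact: ler_normB.
rewrite RintegralD//; last exact: integrable_cst_itv.
rewrite Rintegral_cst_itv.
have h1 := normV_I0; have h2 := ler_wpM2r (ltW tau_gt0) mean0_le.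
have e : B * (tau `^ (g - 1) / g) * tau = B * (tau `^ g / g).
  rewrite -!mulrA; congr (_ * _); rewrite mulrCA [RHS]mulrC; congr (_ * _).
  by rewrite mulrC mulr_powRB1// ltW.
rewrite e in h2; lra.
Qed.

(** For the first level both V and the kernel are singular on the only step; their product is
    bounded by a Beta integral, and the term with the mean separately. *)
Lemma err00_le : `|err 0 0| <= B * (Beta (1 - g) g + ((1 - g) * g)^-1).
Proof.
have ihV := integrable_hV K_gt0.
have ihV0 : leb.-integrable (I 0%N) (EFin \o (fun s => h 0%N s * V s)).
  by apply: (integrableS _ _ _ ihV) => //; exact: I_sub.
have ih := integrable_h (leqnn 0).
have -> : err 0 0 = \int[leb]_(s in I 0%N) (h 0%N s * V s) - mean 0%N * \int[leb]_(s in I 0%N) h 0%N s.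
  rewrite -RintegralZl// -RintegralB//; last exact: (integrableZl (mI 0) (mean 0%N) ih).
  by apply: eq_Rintegral => s _; ring.
rewrite (le_trans (ler_normB _ _))// mulrDr lerD//.
  rewrite (le_trans (le_normr_Rintegral (mI 0) ihV0))//.
  have iB : leb.-integrable (I 0%N) (EFin \o (fun s => (tau - s) `^ (1 - g - 1) * s `^ (g - 1))).
    by rewrite I0E; exact: integrable_Beta.
  have -> : B * Beta (1 - g) g = \int[leb]_(s in I 0%N) (B * ((tau - s) `^ (1 - g - 1) * s `^ (g - 1))).
    rewrite RintegralZl//; congr (_ * _); rewrite /Rintegral I0E integral_Beta//=.
    have -> : 1 - g + g - 1 = 0 :> R by ring.
    by rewrite powRr0 mulr1.
  apply: le_Rintegral => //.
  - exact: integrable_norm.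
  - exact: (integrableZl (mI 0) B iB).
  - move=> s s0; rewrite /h -expE mul1r normrM (ger0_norm (powR_ge0 _ _)) [leRHS]mulrCA.
    rewrite ler_wpM2l ?powR_ge0//; apply: V_le.
    by have := I_sub K_gt0 s0; rewrite /= in_itv.
rewrite normrM integral_h// subnn powR1 powR0 ?gt_eqF// subr0 mulr1.
rewrite (ger0_norm (divr_ge0 (powR_ge0 _ _) (ltW g'0))).
rewrite (le_trans (ler_wpM2r (divr_ge0 (powR_ge0 _ _) (ltW g'0)) mean0_le))//.
have e : tau `^ (g - 1) * tau `^ (1 - g) = 1.
  rewrite -powRD ?(gt_eqF tau_gt0) ?implybT//.
  have -> : g - 1 + (1 - g) = 0 :> R by ring.
  by rewrite powRr0.
have -> : B * (tau `^ (g - 1) / g) * (tau `^ (1 - g) / (1 - g)) =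
   B * (tau `^ (g - 1) * tau `^ (1 - g)) * ((1 - g) * g)^-1.
  by rewrite invfM; ring.
by rewrite e mulr1.
Qed.

(** In order: the deviation on the first step seen from later levels, the same for the other steps,
    the diagonal errors, and the error of the first level. *)
Definition scheme_const : R :=
  2 / g + 1 + 1 / (1 - g) + (Beta (1 - g) g + ((1 - g) * g)^-1).

Lemma err_sum k : (k < K)%N -> `|\sum_(i < k.+1) err k i| <=
  \sum_(i < k) ((k - i)%:R `^ (- g) - (k - i).+1%:R `^ (- g)) * tau `^ (- g) * Q i + `|err k k|.
Proof.
move=> kK; rewrite big_ord_recr/= (le_trans (ler_normD _ _))// lerD2r.
rewrite (le_trans (ler_norm_sum _ _ _))//; apply: ler_sum => i _.
exact: err_lt.
Qed.

Lemma telescope_weights n : \sum_(0 <= j < n) (j.+1%:R `^ (- g) - j.+2%:R `^ (- g)) <= 1 :> R.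
Proof.
have -> : \sum_(0 <= j < n) (j.+1%:R `^ (- g) - j.+2%:R `^ (- g)) = 1 - n.+1%:R `^ (- g) :> R.
  elim: n => [|n ih]; first by rewrite big_nil powR1 subrr.
  by rewrite big_nat_recr//= ih; ring.
by rewrite gerBl powR_ge0.
Qed.

(** The residuals are summed over the levels before the sum over steps is estimated. The kernel
    oscillations attached to a fixed step then telescope, and all powers of tau cancel. *)
Lemma residual_sum :
  \sum_(k < K) `|\int[leb]_(s in `]0, k.+1%:R * tau[) (h k s * V s) -
    (1 - g)^-1 * \sum_(j < k.+1) (j.+1%:R `^ (1 - g) - j%:R `^ (1 - g)) *
    ((\int[leb]_(s in I (k - j)%N) V s) / tau `^ g)| <= scheme_const * B.
Proof.
apply: (@le_trans _ _ (\sum_(k < K) (\sum_(i < k)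
   ((k - i)%:R `^ (- g) - (k - i).+1%:R `^ (- g)) * tau `^ (- g) * Q i + `|err k k|))).
  by apply: ler_sum => k _; rewrite err_decomp//; exact: err_sum.
rewrite big_split/= (_ : scheme_const * B = tau `^ (- g) *
  (2 * B * (tau `^ g / g) + tau * (B * tau `^ (g - 1))) +
  (B * (Beta (1 - g) g + ((1 - g) * g)^-1) +
   B * tau `^ (g - 1) * (tau `^ (1 - g) / (1 - g)))); last first.
  have e1 : tau `^ (- g) = (tau `^ g)^-1 by rewrite powRN.
  have e2 : tau `^ (g - 1) = tau `^ g / tau.
    by rewrite powRB ?(gt_eqF tau_gt0) ?implybT// powRr1// ltW.
  have e3 : tau `^ (1 - g) = tau / tau `^ g.
    by rewrite powRB ?(gt_eqF tau_gt0) ?implybT// powRr1// ltW.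
  have tg : tau `^ g != 0 by rewrite gt_eqF// powR_gt0.
  have t_neq0 : tau != 0 by rewrite gt_eqF.
  have g_neq0 : 1 - g != 0 by rewrite gt_eqF.
  have gg_neq0 : g != 0 by rewrite gt_eqF.
  rewrite /scheme_const e1 e2 e3; field.
  by rewrite tg t_neq0 g_neq0 gg_neq0.
have tg_ge0 : 0 <= tau `^ (- g) by exact: powR_ge0.
have w_ge0 j : 0 <= j.+1%:R `^ (- g) - j.+2%:R `^ (- g) :> R.
  by rewrite subr_ge0 le0_ler_powR// ?oppr_le0 ?(ltW g_gt0)// ler_nat.
have big1K (F : nat -> R) : \sum_(k < K) F k = F 0%N + \sum_(1 <= k < K) F k.
  by rewrite -(big_mkord xpredT) big_ltn.
apply: lerD.
  under eq_bigr => k _.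
    rewrite (big_ord_widen K (fun i => ((k - i)%:R `^ (- g) - (k - i).+1%:R `^ (- g)) * tau `^ (- g) * Q i) (ltnW (ltn_ord k))).
    over.
  (* For a fixed step i the sum now runs over the later levels k; in the index k - i the weights
     telescope to at most 1. *)
  rewrite (exchange_big_dep xpredT)//=.
  apply: (@le_trans _ _ (\sum_(i < K) tau `^ (- g) * Q i)).
    apply: ler_sum => i _.
    under eq_bigr => k _ do rewrite -mulrA.
    rewrite -mulr_suml -[leRHS]mul1r ler_wpM2r ?mulr_ge0 ?Q_ge0//.
    rewrite -(big_geq_mkord i.+1 K xpredT (fun k => (k - i)%:R `^ (- g) - (k - i).+1%:R `^ (- g))).
    rewrite -{1}[i.+1]add0n big_addn.
    under eq_bigr => k _ do rewrite -addSnnS addnK.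
    exact: telescope_weights.
  rewrite -mulr_sumr ler_wpM2l// big1K lerD ?Q0_le//.
  apply: (@le_trans _ _ (\sum_(1 <= j < K) tau * delta j)).
    by rewrite !big_nat; apply: ler_sum => j jK; exact: Q_le.
  by rewrite -mulr_sumr ler_wpM2l// ltW.
rewrite (big1K (fun k => `|err k k|)) lerD ?err00_le//.
apply: (@le_trans _ _ (\sum_(1 <= j < K) delta j * (tau `^ (1 - g) / (1 - g)))).
  by rewrite !big_nat; apply: ler_sum => j jK; exact: err_diag.
by rewrite -mulr_suml ler_wpM2r// divr_ge0 ?powR_ge0// ltW.
Qed.

End scheme_residual.

(** * The Gamma integral: positivity and functional equation *)

Section gamma.
Context {R : realType}.
Local Notation mR := (measurableTypeR R).
Local Notation leb := (@lebesgue_measure R).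
Local Open Scope ereal_scope.

Let E (x : R) : \bar R := (expR (- x))%:E.

Let nE : nnmeas E.
Proof.
split; last by move=> x; rewrite lee_fin expR_ge0.
apply/measurable_EFinP; apply: measurableT_comp; first exact: measurable_expR.
exact: oppr_measurable.
Qed.

Lemma integral_expRN : \int[leb]_(x in `]0%R, +oo[) (expR (- x))%:E = 1.
Proof.
have <- : \int[leb]_x (exponential_pdf 1 x)%:E = 1 by exact: integral_exponential_pdf.
rewrite integral_itv_obnd_cbnd; last first.
  apply: measurable_funTS; apply/measurable_EFinP.
  by apply: measurableT_comp; [exact: measurable_expR|exact: oppr_measurable].
rewrite [LHS]integral_mkcond.
apply: eq_integral => x _; rewrite patchE; case: ifPn.
  by rewrite inE/= in_itv/= andbT => x0; rewrite exponential_pdfE// mul1r mulN1r.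
by rewrite notin_setE/= in_itv/= andbT => /negP; rewrite -ltNge => x0; rewrite lt0_exponential_pdf.
Qed.

Let npw (a : R) : nnmeas (pw a) := nnmeas_pw a.

Let int_pw1E : \int[leb]_x (pw 1 x * E x) = 1.
Proof.
rewrite -integral_expRN [RHS]integral_mkcond; apply: eq_integral => x _.
rewrite patchE pw1E indicE; by case: ifPn => _; rewrite ?mul1e ?mul0e.
Qed.

Let G (b : R) := \int[leb]_x (pw b x * E x).

Let nn_pwE (b : R) : nnmeas (fun x => pw b x * E x).
Proof.
split; last by move=> x; apply: mule_ge0; [apply npw|apply nE].
by apply: emeasurable_funM; [apply npw|apply nE].
Qed.

Let tail s : \int[leb]_x (pw 1 (x - s)%R * E x) = E s.
Proof.
have nn : nnmeas (fun u => pw 1 u * (E s * E u)).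
  have nEE : nnmeas (fun u => E s * E u) by apply: nnmeasZ; [exact: expR_ge0|exact: nE].
  split; last by move=> u; apply: mule_ge0; [apply npw|apply nEE].
  by apply: emeasurable_funM; [apply npw|apply nEE].
transitivity (\int[leb]_x (pw 1 (x - s)%R * (E s * E (x - s)%R))).
  by apply: eq_integral => x _; rewrite /E -EFinM -expRD; do 3 f_equal; ring.
rewrite (ge0_integral_addr s nn).
transitivity (\int[leb]_x (E s * (pw 1 x * E x))).
  by apply: eq_integral => x _; rewrite muleCA.
rewrite ge0_integralZl//; first by rewrite int_pw1E mule1.
- exact: (nn_pwE 1).1.
- by move=> x _; exact: (nn_pwE 1).2.
- exact: nE.2.
Qed.

(** Tonelli in place of integration by parts: x^b is b times the integral of s^(b-1) over ]0, x[,
    and the tail integral of e^(-x) beyond s is e^(-s). *)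
Let GS (b : R) : (0 < b)%R -> G (1 + b) = b%:E * G b.
Proof.
move=> b0; rewrite /G.
transitivity (\int[leb]_x (b%:E * (conv (pw 1) (pw b) x * E x))).
  apply: eq_integral => x _; have [x0|x0] := leP x 0%R.
    by rewrite causal_pw// (causal_conv (@causal_pw _ 1%R) (@causal_pw _ b))// mul0e mule0.
  rewrite pwE// conv_pw1 ?(ltW x0)// muleA -(EFinM b); congr (_ * _); congr EFin.
  by rewrite mulrCA mulfV ?gt_eqF// mulr1; congr (_ `^ _)%R; ring.
have nc : nnmeas (conv (pw 1) (pw b)) by exact: nnmeas_conv.
rewrite ge0_integralZl//; last 3 first.
- by apply: emeasurable_funM; [apply nc|apply nE].
- by move=> x _; apply: mule_ge0; [apply nc|apply nE].
- by rewrite lee_fin ltW.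
congr (_ * _).
transitivity (\int[leb]_x \int[leb]_s (E x * (pw 1 (x - s)%R * pw b s))).
  apply: eq_integral => x _; rewrite muleC ge0_integralZl//.
  - exact: measurable_conv_integrand.
  - by move=> s _; apply: mule_ge0; apply npw.
  - exact: nE.2.
transitivity (\int[leb]_s \int[leb]_x (E x * (pw 1 (x - s)%R * pw b s))).
  have := @fubini_tonelli _ _ mR mR R leb leb
    (fun z => E z.1 * (pw 1 (z.1 - z.2)%R * pw b z.2)); apply => /=.
    apply: emeasurable_funM; first by apply: measurableT_comp => //; apply nE.
    apply: emeasurable_funM; last by apply: measurableT_comp => //; apply npw.
    by apply: measurableT_comp; [apply npw|exact: measurable_funB].
  by move=> x; apply: mule_ge0; [apply nE|apply: mule_ge0; apply npw].
apply: eq_integral => s _.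
transitivity (\int[leb]_x (pw b s * (pw 1 (x - s)%R * E x))).
  by apply: eq_integral => x _; rewrite (muleC (E x)) -(muleA (pw 1 _)) (muleCA (pw 1 _)).
have m1 : measurable_fun [set: mR] (fun x => pw 1 (x - s)%R * E x).
  apply: emeasurable_funM; last by apply nE.
  apply: measurableT_comp; first by apply npw.
  by apply: measurable_funB => //; exact: measurable_cst.
rewrite ge0_integralZl//; first by rewrite tail.
- by move=> x _; apply: mule_ge0; [apply npw|apply nE].
- by apply npw.
Qed.

Let G_lty (b : R) : (0 < b <= 1)%R -> G b < +oo.
Proof.
move=> /andP[b0 b1].
have nn : nnmeas (fun x => pw 1 (1 - x)%R * pw b x).
  split; first exact: measurable_conv_integrand.
  by move=> x; apply: mule_ge0; apply npw.
apply: (@le_lt_trans _ _ (\int[leb]_x (pw 1 (1 - x)%R * pw b x + pw 1 x * E x))).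
  apply: ge0_le_integral => //.
  - by move=> x _; exact: (nn_pwE b).2.
  - exact: (nn_pwE b).1.
  - by apply: emeasurable_funD; [exact: nn.1|exact: (nn_pwE 1%R).1].
  move=> x _; have [x0|x0] := leP x 0%R; first by rewrite !(causal_pw _ x0) !mul0e mule0 adde0.
  rewrite !(pwE _ x0) subrr powRr0 mul1e; have [x1|x1] := ltP x 1%R.
    rewrite pwE ?subr_gt0// subrr powRr0 mul1e.
    rewrite (@le_trans _ _ (x `^ (b - 1))%:E)//; last by rewrite leeDl// lee_fin expR_ge0.
    by rewrite -EFinM lee_fin ler_piMr ?powR_ge0// -expR0 ler_expR oppr_le0 ltW.
  rewrite causal_pw ?subr_le0// mul0e add0e -EFinM lee_fin ler_piMl ?expR_ge0//.
  by rewrite -[leRHS](powRr0 x); apply: ler_powR => //; rewrite subr_le0.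
rewrite ge0_integralD//; last 4 first.
- by move=> x _; exact: nn.2.
- exact: nn.1.
- by move=> x _; exact: (nn_pwE 1%R).2.
- exact: (nn_pwE 1%R).1.
rewrite int_pw1E -/(conv (pw 1) (pw b) 1) conv_pw1//.
by rewrite -EFinD ltry.
Qed.

Let G_gt0 (b : R) : (0 < b)%R -> 0 < G b.
Proof.
move=> b0.
have nn : nnmeas (fun x => pw 1 (1 - x)%R * pw b x).
  split; first exact: measurable_conv_integrand.
  by move=> x; apply: mule_ge0; apply npw.
apply: (@lt_le_trans _ _ (\int[leb]_x ((expR (- 1))%:E * (pw 1 (1 - x)%R * pw b x)))).
  rewrite ge0_integralZl//; last 2 first.
  - exact: nn.1.
  - by move=> x _; exact: nn.2.
  rewrite -/(conv (pw 1) (pw b) 1) conv_pw1// -EFinM lte_fin.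
  by rewrite mulr_gt0 ?expR_gt0// divr_gt0// powR_gt0.
have nnc := nnmeasZ (expR_ge0 (- 1)%R) nn.
apply: ge0_le_integral => //.
- by move=> x _; exact: nnc.2.
- exact: nnc.1.
- exact: (nn_pwE b).1.
move=> x _; have [x1|x1] := leP 1%R x.
  by rewrite (causal_pw _ (t := (1 - x)%R)) ?subr_le0// mul0e mule0; exact: (nn_pwE b).2.
rewrite (pwE 1) ?subr_gt0// subrr powRr0 mul1e muleC; apply: lee_wpmul2l.
  by apply npw.
by rewrite lee_fin ler_expR lerN2 ltW.
Qed.

Let GammaE (b : R) : Gamma b = fine (G b).
Proof.
rewrite /Gamma /Rintegral; congr fine; rewrite [LHS]integral_mkcond.
apply: eq_integral => x _; rewrite patchE /pw; case: ifPn.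
  by rewrite inE/= in_itv/= andbT => ->; rewrite -EFinM.
by rewrite notin_setE/= in_itv/= andbT => /negP/negbTE ->; rewrite mul0e.
Qed.

Lemma Gamma_gt0 (b : R) : (0 < b <= 1)%R -> (0 < Gamma b)%R.
Proof.
move=> b01; have /andP[b0 _] := b01.
by rewrite GammaE fine_gt0// G_gt0//= G_lty.
Qed.

Lemma GammaS (b : R) : (0 < b <= 1)%R -> Gamma (1 + b) = (b * Gamma b)%R.
Proof.
move=> b01; have /andP[b0 _] := b01; rewrite !GammaE GS// fineM//.
rewrite ge0_fin_numE ?G_lty// ltW// G_gt0//.
Qed.

End gamma.

(** * A smooth step function *)

Section smooth_functions.
Context {R : realType}.
Implicit Types (f : R -> R) (x : R).

(* x^-n e^(-1/x), extended by 0 *)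
Definition flat n x : R := if 0 < x then x ^- n * expR (- x^-1) else 0.

Lemma flat_ge0 n x : 0 <= flat n x.
Proof. by rewrite /flat; case: ifP => // /ltW x0; rewrite mulr_ge0 ?invr_ge0 ?exprn_ge0 ?expR_ge0. Qed.

Lemma flat_gt0 n x : 0 < x -> 0 < flat n x.
Proof. by rewrite /flat => x0; rewrite x0 mulr_gt0 ?expR_gt0// invr_gt0 exprn_gt0. Qed.

Lemma flat_le0 n x : x <= 0 -> flat n x = 0.
Proof. by rewrite /flat leNgt => /negbTE ->. Qed.

(** From y/n <= e^(y/n), raised to the n-th power. *)
Lemma exprn_expRN_le n (y : R) : 0 <= y -> y ^+ n * expR (- y) <= n%:R ^+ n.
Proof.
move=> y0; rewrite expRN ler_pdivrMr ?expR_gt0//.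
case: n => [|n]; first by rewrite !expr0 mul1r -expR0 ler_expR.
have n0 : 0 < n.+1%:R :> R by [].
have -> : expR y = expR (y / n.+1%:R) ^+ n.+1 by rewrite -expRM_natl mulrC divfK// gt_eqF.
rewrite -exprMn; apply: lerXn2r; rewrite ?nnegrE ?mulr_ge0 ?expR_ge0//.
rewrite -ler_pdivrMl// mulrC (le_trans _ (expR_ge1Dx _))//.
by rewrite lerDr.
Qed.

Lemma flat_le n x : 0 <= x -> flat n x <= n.+2%:R ^+ n.+2 * x ^+ 2.
Proof.
rewrite le_eqVlt => /predU1P[<-|x0]; first by rewrite flat_le0// mulr_ge0.
rewrite /flat x0.
have y0 : 0 <= x^-1 by rewrite invr_ge0 ltW.
have := ler_wpM2r (exprn_ge0 2 (ltW x0)) (exprn_expRN_le n.+2 y0).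
apply: le_trans; rewrite mulrAC; apply: ler_wpM2r; first exact: expR_ge0.
rewrite -exprVn -addn2 exprD -mulrA -exprMn mulVf ?expr1n ?mulr1//.
by rewrite gt_eqF.
Qed.

Lemma is_derive_flat n x : is_derive x 1 (flat n) (flat n.+2 x - n%:R * flat n.+1 x).
Proof.
have [x0|x0|->] := ltgtP x 0.
- rewrite !flat_le0 ?(ltW x0)// mulr0 subr0.
  apply: (near_eq_is_derive (f := cst 0)) => //.
  by near=> z; rewrite flat_le0//; apply: ltW; near: z; exact: lt_nbhsl.
- have x_neq0 : x != 0 by rewrite gt_eqF.
  have di : is_derive x 1 (fun y : R => y^-1) (- x ^- 2).
    apply: is_derive_eq; first by apply: is_deriveV.
    by rewrite /GRing.scale/= mulr1.
  have dn := is_deriveX n di.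
  have dN : is_derive x 1 (fun y : R => - y^-1) (x ^- 2).
    by rewrite -[X in is_derive _ _ _ X]opprK; exact: is_deriveN.
  have de : is_derive x 1 (fun y : R => expR (- y^-1)) (expR (- x^-1) * x ^- 2).
    exact: is_derive1_comp.
  apply: (near_eq_is_derive (f := (fun y : R => y^-1) ^+ n * (fun y : R => expR (- y^-1)))).
    near=> z; rewrite /flat ifT; last by near: z; exact: lt_nbhsr.
    by rewrite mulrfctE exprfctE -exprVn.
  apply: (is_derive_eq (is_deriveM dn de)).
  rewrite /flat x0 exprfctE /GRing.scale/= -!exprVn.
  by case: n {dn} => [|n] /=; rewrite ?exprS; ring.
(* What remains is the point 0, where the quadratic bound [flat_le] makes the difference quotient
   tend to 0. *)
rewrite !flat_le0// mulr0 subr0.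
have C0 : 0 < n.+2%:R ^+ n.+2 :> R by rewrite exprn_gt0.
have lim0 : h^-1 *: ((flat n \o shift 0) (h *: 1) - flat n 0) @[h --> 0^'] --> (0 : R).
  apply/cvgrPdist_lt => e e0; near=> h.
  have h0 : h != 0 by near: h; exact: nbhs_dnbhs_neq.
  have he : `|h| < e / n.+2%:R ^+ n.+2.
    near: h; apply: dnbhs0_lt; exact: divr_gt0.
  rewrite /= /shift/= addr0 (flat_le0 n (lexx 0)) subr0 sub0r normrN /GRing.scale/= mulr1.
  rewrite normrM normfV (ger0_norm (flat_ge0 _ _)) mulrC ltr_pdivrMr ?normr_gt0//.
  have [hneg|hpos] := leP h 0; first by rewrite flat_le0// mulr_gt0// normr_gt0.
  rewrite (le_lt_trans (flat_le n (ltW hpos)))// (gtr0_norm hpos) expr2 mulrA ltr_pM2r//.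
  by rewrite -ltr_pdivlMl// mulrC -(gtr0_norm hpos).
apply: DeriveDef; first by apply/cvg_ex; exists 0.
exact: cvg_lim lim0.
Unshelve. all: by end_near.
Qed.

(** A class of functions closed under differentiation; smoothness of its members follows by
    induction on the number of directional derivatives. *)
Inductive elementary : (R -> R) -> Prop :=
| elementary_flat n : elementary (flat n)
| elementary_cst c : elementary (fun=> c)
| elementary_add f g : elementary f -> elementary g -> elementary (fun x => f x + g x)
| elementary_mul f g : elementary f -> elementary g -> elementary (fun x => f x * g x)
| elementary_affine f a b : elementary f -> elementary (fun x => f (a * x + b))
| elementary_inv f : (forall x, 0 < f x) -> elementary f -> elementary (fun x => (f x)^-1).

Lemma elementary_is_derive f : elementary f ->
  exists2 f', elementary f' & forall x, is_derive x 1 f (f' x).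
Proof.
elim=> [n|c|{}f g _ [f' Ef' df] _ [g' Eg' dg]|{}f g Ef [f' Ef' df] Eg [g' Eg' dg]
  |{}f a b _ [f' Ef' df]|{}f f0 Ef [f' Ef' df]].
- exists (fun x => flat n.+2 x + (- n%:R) * flat n.+1 x).
    by apply: elementary_add; [|apply: elementary_mul]; constructor.
  by move=> x; rewrite mulNr; exact: is_derive_flat.
- by exists (fun=> 0); [constructor|move=> x; exact: is_derive_cst].
- by exists (fun x => f' x + g' x); [constructor|move=> x; exact: is_deriveD].
- exists (fun x => f x * g' x + g x * f' x).
    by apply: elementary_add; apply: elementary_mul.
  by move=> x; exact: is_deriveM.
- exists (fun x => f' (a * x + b) * a).
    by apply: elementary_mul; constructor.
  move=> x; apply: (is_derive1_comp (f := f) (g := fun x => a * x + b)) => //.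
  apply: (is_derive_eq (is_deriveD (is_deriveM (is_derive_cst a x 1) (is_derive_id x 1))
    (is_derive_cst b x 1))).
  by rewrite /GRing.scale/= mulr1 mulr0 !addr0.
- exists (fun x => (- 1) * ((f x)^-1 * (f x)^-1) * f' x).
    by do ! apply: elementary_mul => //; constructor.
  move=> x; apply: (is_derive_eq (is_deriveV _ (df x))); first by rewrite gt_eqF.
  by rewrite /GRing.scale/= mulN1r -invfM -expr2 .
Qed.

Lemma elementary_smooth f : elementary f -> smooth f.
Proof.
move=> Ef vs; set g := foldr _ _ _; suff : elementary g.
  move=> /elementary_is_derive[g' _ dg].
  have diffg x : differentiable g x by apply/derivable1_diffP; case: (dg x).
  split=> [x|x v]; first exact: differentiable_continuous.
  exact: diff_derivable.
rewrite /g; elim: vs {g} => [//|v vs /=].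
move: (foldr _ _ _) => g /elementary_is_derive[g' Eg' dg].
suff -> : 'D_v g = (fun x => v * g' x) by apply: elementary_mul => //; constructor.
apply/funext => x.
have diffg : differentiable g x by apply/derivable1_diffP; case: (dg x).
rewrite deriveE// -[v in 'd _ _ v]mulr1 -[v * 1]/(v *: 1) linearZ/= -deriveE//.
by have [_ ->] := dg x.
Qed.

Definition smooth_step x := flat 0 x * (flat 0 x + flat 0 ((-1) * x + 1))^-1.

Let den_gt0 x : 0 < flat 0 x + flat 0 ((-1) * x + 1).
Proof.
have [x0|x0] := ltP 0 x; first by rewrite ltr_pwDl ?flat_gt0 ?flat_ge0.
by rewrite ltr_wpDl ?flat_ge0// flat_gt0//; lra.
Qed.

Lemma elementary_smooth_step : elementary smooth_step.
Proof.
apply: elementary_mul; first by constructor.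
apply: (@elementary_inv (fun x => flat 0 x + flat 0 ((-1) * x + 1))) => //.
by apply: elementary_add; [|apply: (@elementary_affine (flat 0))]; constructor.
Qed.

Lemma smooth_step_le0 x : x <= 0 -> smooth_step x = 0.
Proof. by move=> x0; rewrite /smooth_step flat_le0// mul0r. Qed.

Lemma smooth_step_ge1 x : 1 <= x -> smooth_step x = 1.
Proof.
move=> x1; rewrite /smooth_step (@flat_le0 _ (_ * x + 1)) ?addr0 ?divff//; last by lra.
by rewrite gt_eqF// flat_gt0//; lra.
Qed.

Lemma smooth_step_ge0 x : 0 <= smooth_step x.
Proof. by rewrite mulr_ge0 ?flat_ge0// invr_ge0 ltW. Qed.

Lemma smooth_step_le1 x : smooth_step x <= 1.
Proof. by rewrite ler_pdivrMr// mul1r lerDl flat_ge0. Qed.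

Lemma smooth_step_derivative : exists S' : R -> R,
  [/\ continuous S', forall x, is_derive x 1 smooth_step (S' x),
      forall x, (x < 0) || (1 < x) -> S' x = 0 &
      exists2 M, 0 <= M & forall x, `|S' x| <= M].
Proof.
have [S' ES' dS] := elementary_is_derive elementary_smooth_step.
have cS' : continuous S'.
  move=> x; have [S'' _ dS'] := elementary_is_derive ES'.
  by apply: differentiable_continuous; apply/derivable1_diffP; case: (dS' x).
suff S'0 x : (x < 0) || (1 < x) -> S' x = 0.
  exists S'; split => //.
  have [c _ cmax] := @EVT_max R (fun x => `|S' x|) 0 1 ler01
    (continuous_subspaceT (fun x => cvg_norm (cS' x))).
  exists `|S' c| => // x.
  have [x0|x0] := ltP x 0; first by rewrite S'0 ?x0// normr0.
  have [x1|x1] := ltP 1 x; first by rewrite S'0 ?x1 ?orbT// normr0.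
  by apply: cmax; rewrite in_itv/= x0.
move=> x01; have [_ <-] := dS x.
case/orP: x01 => x01.
  have : is_derive x 1 smooth_step 0.
    apply: (near_eq_is_derive (f := cst 0)) => //.
    by near=> z; rewrite smooth_step_le0//; apply: ltW; near: z; exact: lt_nbhsl.
  by case.
have : is_derive x 1 smooth_step 0.
  apply: (near_eq_is_derive (f := cst (1 : R))) => //.
  by near=> z; rewrite smooth_step_ge1//; apply: ltW; near: z; exact: lt_nbhsr.
by case.
Unshelve. all: by end_near.
Qed.

End smooth_functions.

(** * One-sided mollifiers at Lebesgue points *)

Section mollification.
Context {R : realType}.
Local Notation mR := (measurableTypeR R).
Local Notation leb := (@lebesgue_measure R).
Implicit Types x : R.
Variables (S S' : R -> R) (M : R).
Hypotheses (cS' : continuous S') (dS : forall x, is_derive x 1 S (S' x))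
  (S0 : forall x, x <= 0 -> S x = 0) (S1 : forall x, 1 <= x -> S x = 1)
  (S'0 : forall x, (x < 0) || (1 < x) -> S' x = 0)
  (S'M : forall x, `|S' x| <= M).
Variables (a e : R).
Hypothesis e0 : 0 < e.
Local Notation I := (`]a, a + e[%classic : set mR).

(** The derivative of S((x - a)/e): a mollifier of integral 1 vanishing outside [a, a + e]. *)
Definition scaled_bump (x : R) := e^-1 * S' (e^-1 * x + - (e^-1 * a)).

Lemma is_derive_scaled x :
  is_derive x 1 (fun x => S (e^-1 * x + - (e^-1 * a))) (scaled_bump x).
Proof.
rewrite /scaled_bump [X in is_derive _ _ _ X]mulrC.
apply: (is_derive1_comp (f := S) (g := fun x => e^-1 * x + - (e^-1 * a))) => //.
apply: (is_derive_eq (is_deriveD (is_deriveM (is_derive_cst e^-1 x 1) (is_derive_id x 1))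
  (is_derive_cst (- (e^-1 * a)) x 1))).
by rewrite /GRing.scale/= mulr1 mulr0 !addr0.
Qed.

Lemma continuous_scaled_bump : continuous scaled_bump.
Proof.
move=> x; apply: cvgM; first exact: cvg_cst.
apply: (continuous_comp (f := fun x => e^-1 * x + - (e^-1 * a))); last exact: cS'.
by apply: cvgD; [apply: cvgM; [exact: cvg_cst|exact: cvg_id]|exact: cvg_cst].
Qed.

Lemma measurable_scaled_bump (J : set mR) : measurable_fun J scaled_bump.
Proof. by apply: measurable_funTS; exact: continuous_measurable_fun continuous_scaled_bump. Qed.

Lemma scaled_bump_out x : ~ (a <= x <= a + e) -> scaled_bump x = 0.
Proof.
move=> xI; rewrite /scaled_bump S'0 ?mulr0// -mulrBr.
rewrite pmulr_rlt0 ?invr_gt0// mulrC ltr_pdivlMr// mul1r.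
by case: (ltP (x - a) 0) => //= ?; rewrite ltNge; apply/negP => ?; apply: xI; lra.
Qed.

Lemma scaled_bump_le x : `|scaled_bump x| <= e^-1 * M.
Proof. by rewrite /scaled_bump normrM gtr0_norm ?invr_gt0// ler_wpM2l// invr_ge0 ltW. Qed.

Lemma integrable_scaled_bump g : leb.-integrable I (EFin \o g) ->
  leb.-integrable I (EFin \o (fun x => scaled_bump x * g x)).
Proof.
move=> ig; have mg : measurable_fun I g by apply/measurable_EFinP; case/integrableP: ig.
have ih : leb.-integrable I (EFin \o (fun x => (e^-1 * M) * `|g x|)).
  have mI : measurable I by [].
  exact: (integrableZl mI (e^-1 * M) (integrable_norm ig)).
apply: (integrable_dominated _ _ ih) => //.
  by apply: measurable_funM => //; exact: measurable_scaled_bump.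
by move=> x _; rewrite normrM ler_wpM2r// scaled_bump_le.
Qed.

Lemma integrable_cst_bump (c : R) : leb.-integrable I (EFin \o (fun=> c)).
Proof.
apply/integrableP; split; first by apply/measurable_EFinP; exact: measurable_cst.
under eq_integral do rewrite abse_EFin.
by rewrite integral_cst//= lebesgue_measure_itv/=; case: ifP => _; rewrite -EFinM ltry.
Qed.

Lemma Rintegral_scaled_bump : \int[leb]_(x in I) scaled_bump x = 1.
Proof.
have ae : a < a + e by rewrite ltrDl.
have dF x := is_derive_scaled x.
have cF : continuous (fun x => S (e^-1 * x + - (e^-1 * a))).
  move=> x; apply: differentiable_continuous; apply/derivable1_diffP.
  by case: (dF x).
rewrite /Rintegral -(integral_itv_bndoo true false); last first.
  by apply/measurable_EFinP; exact: measurable_scaled_bump.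
rewrite (@continuous_FTC2 _ _ (fun x => S (e^-1 * x + - (e^-1 * a))) a (a + e) ae).
- rewrite subrr (S0 (lexx 0)) sube0 S1// mulrDr mulVf ?gt_eqF//.
  by rewrite addrAC subrr add0r.
- by apply: continuous_subspaceT; exact: continuous_scaled_bump.
- split; first by move=> x _; case: (dF x).
  + exact/cvg_at_right_filter/cF.
  + exact/cvg_at_left_filter/cF.
- by move=> x _; rewrite derive1E; case: (dF x).
Qed.

Lemma scaled_bump_mean g (c : R) : leb.-integrable I (EFin \o g) ->
  `|\int[leb]_(x in I) (scaled_bump x * g x) - c| <=
  e^-1 * M * \int[leb]_(x in I) `|g x - c|.
Proof.
move=> ig; have ic := integrable_cst_bump c.
have mI : measurable I by [].
have igc : leb.-integrable I (EFin \o (fun x => g x - c)) by exact: (integrableB mI ig ic).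
have -> : \int[leb]_(x in I) (scaled_bump x * g x) - c =
    \int[leb]_(x in I) (scaled_bump x * (g x - c)).
  transitivity (\int[leb]_(x in I) (scaled_bump x * g x) -
      \int[leb]_(x in I) (scaled_bump x * c)).
    congr (_ - _); transitivity (\int[leb]_(x in I) scaled_bump x * c).
      by rewrite Rintegral_scaled_bump mul1r.
    rewrite -RintegralZr//; have := integrable_scaled_bump (integrable_cst_bump 1).
    by apply: eq_integrable => // x _ /=; rewrite mulr1.
  rewrite -RintegralB//; [|exact: integrable_scaled_bump|exact: integrable_scaled_bump].
  by apply: eq_Rintegral => x _; rewrite mulrBr.
have i1 := integrable_scaled_bump igc.
rewrite (le_trans (le_normr_Rintegral mI i1))// -RintegralZl//; last exact: integrable_norm.
apply: le_Rintegral => //; first exact: integrable_norm.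
  exact: (integrableZl mI (e^-1 * M) (integrable_norm igc)).
by move=> x _; rewrite normrM ler_wpM2r// scaled_bump_le.
Qed.

(** The bump is at most M/e and the ball of radius e has measure 2e, hence the factor 2M in front of
    the averaged deviation over the ball. *)
Lemma scaled_bump_davg g : leb.-integrable setT (EFin \o g) ->
  (`|\int[leb]_(x in I) (scaled_bump x * g x) - g a|%:E <= (M *+ 2)%:E * davg g a e)%E.
Proof.
move=> ig; have igI : leb.-integrable I (EFin \o g) by apply: integrableS ig.
have M0 : 0 <= M by apply: le_trans (S'M 0).
have mg : measurable_fun setT g by apply/measurable_EFinP; case/integrableP: ig.
have igc : leb.-integrable I (EFin \o (fun x => `|g x - g a|)).
  have mI : measurable I by [].
  exact: integrable_norm (integrableB mI igI (integrable_cst_bump (g a))).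
apply: (@le_trans _ _ ((e^-1 * M)%:E * (\int[leb]_(x in I) `|g x - g a|)%:E)%E).
  by rewrite -EFinM lee_fin scaled_bump_mean.
rewrite /davg /iavg (lebesgue_measure_ball a (ltW e0)) inver ifF; last first.
  by apply/negbTE; rewrite gt_eqF// pmulrn_lgt0.
have -> : e^-1 * M = M *+ 2 * (e *+ 2)^-1.
  by rewrite -(mulr_natr e) invfM -mulr_natr; field; rewrite gt_eqF.
rewrite muleA EFinM. apply: lee_wpmul2l.
  by rewrite -EFinM lee_fin mulr_ge0 ?invr_ge0 ?mulrn_wge0// ltW.
rewrite /Rintegral fineK; last exact: (integrable_fin_num _ igc).
apply: ge0_subset_integral => //.
- exact: measurable_ball.
- apply: measurable_funTS; apply/measurable_EFinP; apply: measurableT_comp => //.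
  exact: measurable_funB.
- by move=> x /=; rewrite in_itv/= => /andP[ax xae]; rewrite /ball/= ltr_norml; apply/andP; split; lra.
Qed.

End mollification.

(** * A weak derivative is the density of a primitive *)

Section du_bois_reymond.
Context {R : realType}.
Local Notation mR := (measurableTypeR R).
Local Notation leb := (@lebesgue_measure R).
Implicit Types x : R.
Variables (T : R) (f f' : R -> R).
Local Notation D := (`]0, T[%classic : set mR).
Hypotheses (intf : leb.-integrable D (EFin \o f)) (intf' : leb.-integrable D (EFin \o f')).
Hypothesis weak : forall psi : R -> R, test_function (`]0, T[%classic : set R) psi ->
  \int[leb]_(x in D) (derive1 psi x * f x) = - \int[leb]_(x in D) (psi x * f' x).

Definition ramp (a e : R) x : R := smooth_step (e^-1 * x + - (e^-1 * a)).

Lemma ramp_le a e x : 0 < e -> x <= a -> ramp a e x = 0.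
Proof.
move=> e0 xa; rewrite /ramp smooth_step_le0// -mulrBr.
by rewrite pmulr_rle0 ?invr_gt0// subr_le0.
Qed.

Lemma ramp_ge a e x : 0 < e -> a + e <= x -> ramp a e x = 1.
Proof.
move=> e0 xa; rewrite /ramp smooth_step_ge1// -mulrBr mulrC ler_pdivlMr// mul1r.
by rewrite lerBrDl.
Qed.

Lemma test_function_ramp a b e : 0 < e -> 0 < a -> a <= b -> b + e < T ->
  test_function (`]0, T[%classic : set R) (fun x => ramp a e x - ramp b e x).
Proof.
move=> e0 a0 ab beT; split.
  rewrite (_ : (fun x => _) = (fun x => ramp a e x + (- 1) * ramp b e x)); last first.
    by apply/funext => x; rewrite mulN1r.
  apply: elementary_smooth; apply: elementary_add; last apply: elementary_mul.
  - exact: elementary_affine elementary_smooth_step.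
  - by constructor.
  - exact: elementary_affine elementary_smooth_step.
exists `[a, b + e]%classic.
  split; first exact: segment_compact.
  move=> x /=; rewrite !in_itv/= => /andP[ax xb]; apply/andP; split.
    exact: lt_le_trans ax.
  exact: le_lt_trans beT.
move=> x xab; have [xa|ax] := leP x a.
  by rewrite !ramp_le ?subrr// (le_trans xa).
have bx : b + e <= x.
  by rewrite leNgt; apply/negP => xb; apply: xab; rewrite /= in_itv/= !ltW.
by rewrite !ramp_ge ?subrr// (le_trans _ bx)// lerD2r.
Qed.

Let g := f \_ D.

Let ig : leb.-integrable setT (EFin \o g).
Proof. by rewrite /g -restrict_EFin; exact: (integrable_mkcond _ _).1. Qed.

Lemma ae_lebesgue_pt : {ae leb, forall x, lebesgue_pt g x}.
Proof. exact: (lebesgue_differentiation (integrable_locally_integrable ig)). Qed.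

(** The test function is the difference of two ramps that rise just after a and just after b. Its
    derivative is a difference of mollifiers, which recover f(a) and f(b) at Lebesgue points, while
    the function itself tends to the indicator of ]a, b]. *)
Lemma lebesgue_pt_increment (a b : R) : 0 < a -> a <= b -> b < T ->
  lebesgue_pt g a -> lebesgue_pt g b ->
  f b - f a = \int[leb]_(x in `]a, b]) f' x.
Proof.
move=> a0 ab bT lga lgb.
have [S' [cS' dS S'0 [M M0 S'M]]] := @smooth_step_derivative R.
(* Ramp widths tending to 0 that keep b + e_k below T, so that the test functions have compact
   support in ]0, T[. *)
pose e (k : nat) : R := (T - b) / 2 / k.+1%:R.
have e_gt0 k : 0 < e k by rewrite !divr_gt0// subr_gt0.
have e_le k : b + e k < T.
  rewrite -ltrBrDl ltr_pdivrMr// (@lt_le_trans _ _ (T - b))//.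
    by rewrite ltr_pdivrMr// ltr_pMr ?subr_gt0// ltr1n.
  by rewrite ler_pMr ?subr_gt0// ler1n.
have e0 : e k @[k --> \oo] --> (0 : R).
  rewrite -[X in _ --> X](mulr0 ((T - b) / 2)).
  by apply: cvgM; [exact: cvg_cst|exact: cvg_harmonic].
have e_small (p x : R) : p < x -> \forall k \near \oo, p + e k <= x.
  rewrite -subr_gt0 => px; near=> k; rewrite -lerBrDl ltW//; near: k.
  exact: (cvgr_lt _ e0).
have e_cvg : e k @[k --> \oo] --> (0 : R)^'+.
  move=> A A0; have : \forall k \near \oo, 0 < e k -> A (e k) by exact: e0 _ A0.
  rewrite -[X in _ -> X]/(\forall k \near \oo, A (e k)).
  by apply: filterS => k; apply; exact: e_gt0.
have imul (h F : R -> R) (k : R) : leb.-integrable D (EFin \o F) -> measurable_fun D h ->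
    (forall x, `|h x| <= k) -> leb.-integrable D (EFin \o (fun x => h x * F x)).
  move=> iF mh hk; have mD : measurable D by [].
  have mF : measurable_fun D F by apply/measurable_EFinP; case/integrableP: iF.
  apply: (integrable_dominated _ _ (integrableZl mD k (integrable_norm iF))) => //.
    exact: measurable_funM.
  by move=> x _; rewrite normrM ler_wpM2r.
have conv_pt (p : R) : a <= p <= b -> lebesgue_pt g p ->
    \int[leb]_(x in D) (scaled_bump S' p (e k) x * f x) @[k --> \oo] --> f p.
  move=> /andP[ap pb] lp.
  have p0 : 0 < p by exact: lt_le_trans ap.
  have pe k : p + e k < T by apply: le_lt_trans (e_le k); rewrite lerD2r.
  have -> : f p = g p.
    by rewrite /g patchE mem_set//= in_itv/= p0/= (le_lt_trans pb).
  have E k : \int[leb]_(x in D) (scaled_bump S' p (e k) x * f x) =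
      \int[leb]_(x in `]p, p + e k[) (scaled_bump S' p (e k) x * g x).
    rewrite [RHS]/Rintegral -(integral_itv_bndoo true false); last first.
      apply/measurable_EFinP; apply: measurable_funM; first exact: measurable_scaled_bump.
      by apply: measurable_funTS; apply/measurable_EFinP; case/integrableP: ig.
    rewrite -[RHS]/(Rintegral _ _ _) Rintegral_mkcond [RHS]Rintegral_mkcond.
    congr Rintegral; apply/funext => x; rewrite !patchE /g patchE.
    have [xI|xI] := pselect (p <= x <= p + e k).
      have xD : 0 < x < T.
        case/andP: xI => px xpe; apply/andP; split; first exact: lt_le_trans px.
        exact: le_lt_trans (pe k).
      by rewrite !mem_set//= in_itv.
    rewrite (memNset (A := `[p, p + e k]%classic)); last by rewrite /= in_itv.
    by rewrite (scaled_bump_out S'0 (e_gt0 k) xI) mul0r; case: ifP.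
  apply/subr_cvg0/norm_cvg0P.
  apply: (@fine_cvg _ _ _ _ (fun k => `|\int[leb]_(x in D) (scaled_bump S' p (e k) x * f x) - g p|%:E)).
  apply: (@squeeze_cvge _ _ _ _ (cst 0%E) _ (fun k => ((M *+ 2)%:E * davg g p (e k))%E)).
  - near=> k; rewrite lee_fin normr_ge0/= E.
    exact: (@scaled_bump_davg _ _ _ _ cS' dS smooth_step_le0 smooth_step_ge1 S'M).
  - exact: cvg_cst.
  - rewrite -[X in _ --> X](mule0 (M *+ 2)%:E); apply: cvgeZl => //.
    exact: (cvg_comp _ _ e_cvg lp).
have cvg_l : \int[leb]_(x in D) (derive1 (fun x => ramp a (e k) x - ramp b (e k) x) x * f x)
    @[k --> \oo] --> f a - f b.
  have dE k x : derive1 (fun x => ramp a (e k) x - ramp b (e k) x) x =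
      scaled_bump S' a (e k) x - scaled_bump S' b (e k) x.
    rewrite derive1E.
    by have [_ ->] := is_deriveB (is_derive_scaled dS a (e k) x) (is_derive_scaled dS b (e k) x).
  have ib p k : leb.-integrable D (EFin \o (fun x => scaled_bump S' p (e k) x * f x)).
    apply: (imul _ _ ((e k)^-1 * M)) => //; first exact: measurable_scaled_bump.
    by move=> x; exact: scaled_bump_le.
  rewrite (_ : (fun k => _) = (fun k => \int[leb]_(x in D) (scaled_bump S' a (e k) x * f x) -
    \int[leb]_(x in D) (scaled_bump S' b (e k) x * f x))).
    by apply: cvgB; apply: conv_pt => //; rewrite lexx ?ab.
  apply/funext => k; rewrite -RintegralB//.
  by apply: eq_Rintegral => x _; rewrite dE mulrBl.
(* Dominated convergence: a ramp vanishes up to its starting point and is eventually 1 at every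
   later point. *)
have cvg_r : \int[leb]_(x in D) ((ramp a (e k) x - ramp b (e k) x) * f' x)
    @[k --> \oo] --> \int[leb]_(x in `]a, b]) f' x.
  have mD : measurable D by [].
  have mf' : measurable_fun D f' by apply/measurable_EFinP; case/integrableP: intf'.
  pose h x : R := (f' \_ `]a, b]) x.
  have -> : \int[leb]_(x in `]a, b]) f' x = \int[leb]_(x in D) h x.
    rewrite -Rintegral_mkcondr; congr Rintegral.
    rewrite eqEsubset; split => x /=; rewrite !in_itv/=; last by case.
    move=> /andP[ax xb]; by rewrite (lt_trans a0 ax) (le_lt_trans xb bT) ax xb.
  have mramp p k : measurable_fun D (ramp p (e k)).
    apply: measurable_funTS; apply: continuous_measurable_fun => x.
    apply: differentiable_continuous; apply/derivable1_diffP.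
    by case: (is_derive_scaled dS p (e k) x).
  have ramp01 p k x : 0 <= ramp p (e k) x <= 1.
    by rewrite smooth_step_ge0 smooth_step_le1.
  have mh : measurable_fun D (EFin \o h).
    apply/measurable_EFinP; rewrite /h.
    apply/measurable_restrict => //.
    exact: measurable_funS mf'.
  have [] := @dominated_convergence _ _ _ leb D mD
    (fun k x => ((ramp a (e k) x - ramp b (e k) x) * f' x)%:E) (EFin \o h) (fun x => `|f' x|%:E).
  - move=> k; apply/measurable_EFinP; apply: measurable_funM => //.
    exact: measurable_funB.
  - exact: mh.
  - apply: aeT => x _; apply: cvg_near_cst; rewrite /comp /= /h patchE.
    have [xa|ax] := leP x a.
      rewrite memNset/=; last by rewrite in_itv/= ltNge xa.
      by near=> k; rewrite !ramp_le ?(le_trans xa)// subrr mul0r.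
    have [xb|bx] := leP x b.
      rewrite mem_set/=; last by rewrite in_itv/= ax.
      near=> k; rewrite (ramp_le _ xb)// ramp_ge// ?subr0 ?mul1r//.
      by near: k; exact: e_small.
    rewrite memNset/=; last by rewrite in_itv/= ax leNgt bx.
    near=> k; rewrite !ramp_ge ?subrr ?mul0r//; near: k; exact: e_small.
  - exact: integrable_norm.
  - apply: aeT => x k _; rewrite lee_fin normrM ler_piMl//.
    have /andP[? ?] := ramp01 a k x; have /andP[? ?] := ramp01 b k x.
    by rewrite ler_norml; apply/andP; split; lra.
  move=> ih _ cv; apply: (@fine_cvg _ _ _ _
    (fun k => \int[leb]_(x in D) ((ramp a (e k) x - ramp b (e k) x) * f' x)%:E)%E).
  by rewrite /Rintegral fineK//; exact: (integrable_fin_num _ ih).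
have cvg_l' : \int[leb]_(x in D) (derive1 (fun x => ramp a (e k) x - ramp b (e k) x) x * f x)
    @[k --> \oo] --> - \int[leb]_(x in `]a, b]) f' x.
  rewrite (_ : (fun k => _) = (fun k => - \int[leb]_(x in D)
    ((ramp a (e k) x - ramp b (e k) x) * f' x))); first exact: cvgN.
  by apply/funext => k; apply: weak; exact: test_function_ramp.
by rewrite -opprB (cvg_unique _ cvg_l cvg_l') // opprK.
Unshelve. all: by end_near. Qed.

Theorem du_bois_reymond : exists c : R, {ae leb, forall t, 0 < t < T ->
  f t = c + \int[leb]_(x in `]0, t[) f' x}.
Proof.
have [T0|T0] := leP T 0.
  by exists 0; apply: aeT => t /andP[t0 tT]; have := lt_trans t0 (lt_le_trans tT T0); rewrite ltxx.
have gE t : 0 < t < T -> g t = f t by move=> tD; rewrite /g patchE mem_set//= in_itv.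
have int0 t : t < T -> leb.-integrable `]0, t[ (EFin \o f').
  by move=> tT; apply: integrableS intf' => //; apply: subset_itvl; rewrite bnd_simp ltW.
have prim (s t : R) : 0 < s -> s <= t -> t < T ->
    \int[leb]_(x in `]0, t[) f' x - \int[leb]_(x in `]0, s[) f' x =
    \int[leb]_(x in `]s, t]) f' x.
  move=> s0 st tT; rewrite (Rintegral_itv_bndo_bndc (int0 _ tT)).
  rewrite (Rintegral_itv_bndo_bndc (int0 _ (le_lt_trans st tT))).
  rewrite Rintegral_itvB//; last by rewrite bnd_simp ltW.
  by apply: integrableS intf' => //; apply: subset_itvl; rewrite bnd_simp.
(* Almost every point is a Lebesgue point and ]0, T[ has positive measure; the constant is read off
   at one such p. *)
have [p [p0 pT lp]] : exists p, [/\ 0 < p, p < T & lebesgue_pt g p].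
  apply: contrapT => np; have negD : leb.-negligible D.
    apply: negligibleS ae_lebesgue_pt => x /=; rewrite in_itv/= => /andP[x0 xT] lx.
    by apply: np; exists x.
  have : leb D = 0%E by exact: measure_negligible.
  rewrite /= lebesgue_measure_itv/= lte_fin T0 sube0 => -[].
  by move=> T00; move: T0; rewrite T00 ltxx.
exists (f p - \int[leb]_(x in `]0, p[) f' x).
apply: ae_imp ae_lebesgue_pt => t lt /andP[t0 tT].
have [pt|tp] := leP p t.
  by have := lebesgue_pt_increment p0 pt tT lp lt; rewrite -prim//; lra.
by have := lebesgue_pt_increment t0 (ltW tp) pT lt lp; rewrite -prim// ?ltW//; lra.
Qed.

End du_bois_reymond.

(** * Primitives of integrable functions and their initial values *)

Section primitives.
Context {R : realType}.
Local Notation mR := (measurableTypeR R).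
Local Notation leb := (@lebesgue_measure R).
Variable T : R.
Local Notation D := (`]0, T[%classic : set mR).
Implicit Types f z : R -> R.

Lemma integrable_prefix z t : t <= T -> leb.-integrable D (EFin \o z) ->
  leb.-integrable `]0, t[ (EFin \o z).
Proof. by move=> tT; apply: integrableS => //; apply: subset_itvl; rewrite bnd_simp. Qed.

Lemma integrable_subitv z s t : 0 <= s -> t <= T -> leb.-integrable D (EFin \o z) ->
  leb.-integrable `]s, t[ (EFin \o z).
Proof.
move=> s0 tT; apply: integrableS => //.
by apply: subset_itv; rewrite bnd_simp.
Qed.

Lemma Rintegral_norm_ge0 z (J : set mR) : 0 <= \int[leb]_(r in J) `|z r|.
Proof. by apply: Rintegral_ge0. Qed.

Lemma prefix_diff z s t : 0 <= s -> s <= t -> t <= T -> leb.-integrable D (EFin \o z) ->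
  \int[leb]_(r in `]0, t[) z r - \int[leb]_(r in `]0, s[) z r = \int[leb]_(r in `]s, t[) z r.
Proof.
move=> s0 st tT iz.
rewrite (@Rintegral_setU_itv _ z 0 s t)//; first by rewrite addrAC subrr add0r.
exact: integrable_prefix.
Qed.

Lemma le_prefix_diff z s t : 0 <= s -> s <= t -> t <= T -> leb.-integrable D (EFin \o z) ->
  `|\int[leb]_(r in `]0, t[) z r - \int[leb]_(r in `]0, s[) z r| <=
  \int[leb]_(r in `]0, t[) `|z r| - \int[leb]_(r in `]0, s[) `|z r|.
Proof.
move=> s0 st tT iz; rewrite !prefix_diff//; last exact: integrable_norm.
by apply: le_normr_Rintegral => //; exact: integrable_subitv.
Qed.

Lemma le_prefix z s t : 0 <= s -> s <= t -> t <= T -> leb.-integrable D (EFin \o z) ->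
  \int[leb]_(r in `]0, s[) `|z r| <= \int[leb]_(r in `]0, t[) `|z r|.
Proof.
move=> s0 st tT iz; rewrite -subr_ge0 prefix_diff//; last exact: integrable_norm.
exact: Rintegral_norm_ge0.
Qed.

Lemma le_norm_prefix z t : 0 <= t -> t <= T -> leb.-integrable D (EFin \o z) ->
  `|\int[leb]_(r in `]0, t[) z r| <= \int[leb]_(r in D) `|z r|.
Proof.
move=> t0 tT iz; rewrite (le_trans (le_normr_Rintegral _ (integrable_prefix tT iz)))//.
exact: le_prefix.
Qed.

Lemma measurable_prefix z : leb.-integrable D (EFin \o z) ->
  measurable_fun D (fun t => \int[leb]_(r in `]0, t[) z r).
Proof.
move=> iz; have mz : measurable_fun D z by apply/measurable_EFinP; case/integrableP: iz.
have mzN : measurable_fun D (fun x => - z x) by exact: measurable_funN.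
have mc h : measurable_fun D h ->
    measurable_fun D (fun t => fine (conv (pw 1) (ppos T h) t)).
  move=> mh; apply: (measurableT_comp (@fine_measurable R setT measurableT)).
  by apply: measurable_funTS; apply (nnmeas_conv (nnmeas_pw 1 : nnmeas (pw (1 : R))) (nnmeas_ppos mh)).
apply: (eq_measurable_fun (fun t => fine (conv (pw 1) (ppos T z) t) -
  fine (conv (pw 1) (pneg T z) t))).
  move=> t; rewrite inE/= in_itv/= => /andP[_ tT].
  by rewrite (Rintegral_ppos (ltW tT) iz).
by apply: measurable_funB; [exact: mc|rewrite pnegN; exact: mc].
Qed.

(** The inequality |c| <= |f(t)| plus the L^1 norm of f' is averaged over ]0, T[. *)
Lemma initial_value_le f f' (c : R) : 0 < T -> leb.-integrable D (EFin \o f) ->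
  leb.-integrable D (EFin \o f') ->
  {ae leb, forall t, 0 < t < T -> f t = c + \int[leb]_(r in `]0, t[) f' r} ->
  `|c| <= T^-1 * \int[leb]_(t in D) `|f t| + \int[leb]_(t in D) `|f' t|.
Proof.
move=> T0 iF iF' H; set Z := \int[leb]_(t in D) `|f' t|.
have mD : measurable D by [].
have mf : measurable_fun D f by apply/measurable_EFinP; case/integrableP: iF.
have lebD : leb D = T%:E by rewrite lebesgue_measure_itv/= lte_fin T0 sube0.
have ic (k : R) : leb.-integrable D (EFin \o cst k).
  apply/integrableP; split; first by apply/measurable_EFinP; exact: measurable_cst.
  rewrite [ltLHS](_ : _ = \int[leb]_(t in D) (`|k|%:E))%E; last exact: eq_integral.
  by rewrite integral_cst//= lebD -EFinM ltry.
have iR : leb.-integrable D (EFin \o (fun t => `|f t| + Z)).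
  exact: (integrableD mD (integrable_norm iF) (ic Z)).
have : (\int[leb]_(t in D) `|c|%:E <= \int[leb]_(t in D) (`|f t| + Z)%:E)%E.
  apply: ae_ge0_le_integral => //.
  - by move=> t _; rewrite lee_fin addr_ge0// Rintegral_norm_ge0.
  - by apply/measurable_EFinP; case/integrableP: iR => /measurable_EFinP.
  move: H; apply: ae_imp => t ft; rewrite /= in_itv/= => tD; rewrite lee_fin.
  have /andP[t0 tT] := tD.
  have -> : c = f t - \int[leb]_(r in `]0, t[) f' r by rewrite ft// addrK.
  by rewrite (le_trans (ler_normB _ _))// lerD2l le_norm_prefix// ltW.
rewrite integral_cst//= lebD.
have -> : (\int[leb]_(t in D) (`|f t| + Z)%:E = (\int[leb]_(t in D) `|f t| + Z * T)%:E)%E.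
  rewrite -(fineK (integrable_fin_num mD iR)) -[fine _]/(\int[leb]_(t in D) (`|f t| + Z)).
  rewrite RintegralD//; [|exact: integrable_norm|exact: ic].
  by rewrite Rintegral_cst//= lebD.
by rewrite -EFinM lee_fin -ler_pdivlMr// mulrDl mulfK ?gt_eqF// mulrC.
Qed.

End primitives.

(** * Decay and oscillation of one mode *)

Section mode_profile.
Context {R : realType}.
Local Notation mR := (measurableTypeR R).
Local Notation leb := (@lebesgue_measure R).
Variables (g m T b : R) (v zeta : R -> R) (B : R).
Hypotheses (g_gt0 : 0 < g) (g_lt1 : g < 1) (m0 : 0 <= m) (T0 : 0 < T).
Local Notation D := (`]0, T[%classic : set mR).
Local Notation cB := (Beta (1 - g) g).
Hypotheses (iv : leb.-integrable D (EFin \o v)) (iz : leb.-integrable D (EFin \o zeta)).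
Hypothesis rep : {ae leb, forall t, 0 < t < T ->
  cB * v t = b * fine (res g m t) + \int[leb]_(r in `]0, t[) zeta r}.
Hypothesis B_ge : cB^-1 * (`|b| + (\int[leb]_(r in D) `|zeta r|) * T `^ (1 - g)) <= B.

Let g01 : 0 < g <= 1. Proof. by rewrite g_gt0 ltW. Qed.
Let g'0 : 0 < 1 - g. Proof. by rewrite subr_gt0. Qed.

Let cB0 : 0 < cB.
Proof. by apply: Beta_gt0; apply/andP; split=> //; rewrite ltrBlDr ltrDl. Qed.

Let Z := \int[leb]_(r in D) `|zeta r|.
Let Z0 : 0 <= Z. Proof. exact: Rintegral_norm_ge0. Qed.

Let rho t := fine (res g m t).

Let rho_ge0 t : 0 <= rho t.
Proof. by rewrite fine_ge0//; apply (nnmeas_res g01 m0). Qed.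

Let rho_le t : 0 < t -> rho t <= t `^ (g - 1).
Proof.
by move=> t0; have := res_le_pw g01 t m0; rewrite pwE// /rho resE// lee_fin.
Qed.

Let rho_anti s t : 0 < s -> s <= t -> rho t <= rho s.
Proof.
move=> s0 st; have := res_antitone g01 m0 s0 st.
by rewrite /rho !resE ?lee_fin// (lt_le_trans s0).
Qed.

(** This absorbs the bounded part of the profile into the singular weight t^(g-1). *)
Let pw_ge1 t : 0 < t -> t <= T -> 1 <= T `^ (1 - g) * t `^ (g - 1).
Proof.
move=> t0 tT; rewrite -(opprB 1 g) powRN.
rewrite ler_pdivlMr ?powR_gt0// mul1r.
by apply: ge0_ler_powR => //; rewrite ?nnegrE; exact: ltW.
Qed.

(** A representative of v for which decay and oscillation bounds hold at every time of ]0, T[;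
    [mode_scheme] uses that integrals do not distinguish it from v. *)
Definition profile t := cB^-1 * (b * rho t + \int[leb]_(r in `]0, t[) zeta r).

Lemma ae_profile : {ae leb, forall t, D t -> v t = profile t}.
Proof.
apply: ae_imp rep => t H; rewrite /= in_itv/= => /H E.
by rewrite /profile /rho -E mulrA mulVf ?mul1r// gt_eqF.
Qed.

Lemma measurable_profile : measurable_fun D (profile : mR -> mR).
Proof.
apply: measurable_funM => //; apply: measurable_funD; last exact: measurable_prefix.
apply: measurable_funM => //.
apply: (measurableT_comp (@fine_measurable R setT measurableT)).
by apply: measurable_funTS; apply (nnmeas_res g01 m0).
Qed.

Let B0 : 0 <= B.
Proof.
apply: le_trans B_ge; rewrite mulr_ge0 ?invr_ge0 ?(ltW cB0)//.
by rewrite addr_ge0// mulr_ge0// powR_ge0.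
Qed.

Lemma profile_le t : 0 < t < T -> `|profile t| <= B * t `^ (g - 1).
Proof.
move=> /andP[t0 tT]; apply: (@le_trans _ _ (cB^-1 * (`|b| * t `^ (g - 1) +
    Z * (T `^ (1 - g) * t `^ (g - 1))))).
  rewrite /profile normrM gtr0_norm ?invr_gt0// ler_wpM2l ?invr_ge0 ?(ltW cB0)//.
  rewrite (le_trans (ler_normD _ _))// lerD//.
    by rewrite normrM ler_wpM2l// ger0_norm// rho_le.
  rewrite (le_trans (le_norm_prefix (ltW t0) (ltW tT) iz))//.
  by rewrite ler_peMr// pw_ge1// ltW.
rewrite mulrA -mulrDl mulrA ler_wpM2r// powR_ge0//.
Qed.

Lemma mode_decay : {ae leb, forall t, 0 < t < T -> `|v t| <= B * t `^ (g - 1)}.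
Proof.
apply: ae_imp ae_profile => t vt tD; by rewrite vt ?profile_le//= in_itv.
Qed.

(* The oscillation of the profile on an interval is the increment of this
   monotone function, so its sum over the time steps telescopes. *)
Let osc t := cB^-1 * (- (`|b| * rho t) + \int[leb]_(r in `]0, t[) `|zeta r|).

Let alg1 (c x y z w : R) : c * x + z - (c * y + w) = c * (x - y) - (w - z).
Proof. by ring. Qed.

Let alg2 (c x y z w : R) : - (c * x) + z - (- (c * y) + w) = c * (y - x) + (z - w).
Proof. by ring. Qed.

Lemma profile_osc p q s t : 0 < p -> q <= T -> p <= s <= q -> p <= t <= q ->
  `|profile s - profile t| <= osc q - osc p.
Proof.
move=> p0 qT; wlog st : s t / s <= t.
  move=> H sI tI; have [st|/ltW ts] := leP s t; first exact: H.
  by rewrite distrC; exact: H.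
move=> /andP[ps sq] /andP[pt tq]; have s0 := lt_le_trans p0 ps.
have t0 := lt_le_trans s0 st; have q0 := lt_le_trans t0 tq.
rewrite /profile /osc -!mulrBr normrM gtr0_norm ?invr_gt0//.
rewrite ler_wpM2l ?invr_ge0 ?(ltW cB0)//.
rewrite alg1 alg2 (le_trans (ler_normB _ _))//.
have rst : 0 <= rho s - rho t by rewrite subr_ge0; exact: rho_anti.
apply: lerD.
  rewrite normrM (ger0_norm rst); apply: ler_wpM2l; first exact: normr_ge0.
  by apply: lerB; exact: rho_anti.
rewrite (le_trans (le_prefix_diff (ltW s0) st (le_trans tq qT) iz))//.
apply: lerB; first exact: (le_prefix (ltW t0) tq qT iz).
exact: (le_prefix (ltW p0) ps (le_trans sq qT) iz).
Qed.

(** The sum telescopes to osc(T) - osc(tau). Starting at the second step avoids the singularity at 0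
    and leaves rho(tau) <= tau^(g-1). *)
Lemma osc_sum K tau : (0 < K)%N -> 0 < tau -> K%:R * tau = T ->
  \sum_(1 <= j < K) (osc (j.+1%:R * tau) - osc (j%:R * tau)) <= B * tau `^ (g - 1).
Proof.
move=> K0 tau0 KT; rewrite telescope_sumr// KT mul1r.
have tT : tau <= T by rewrite -KT ler_peMl ?ler1n// ltW.
apply: (@le_trans _ _ (cB^-1 * (`|b| * tau `^ (g - 1) +
    Z * (T `^ (1 - g) * tau `^ (g - 1))))); last first.
  by rewrite mulrA -mulrDl mulrA ler_wpM2r// powR_ge0.
rewrite /osc -mulrBr ler_wpM2l ?invr_ge0 ?(ltW cB0)//.
rewrite alg2.
apply: lerD.
  by rewrite ler_wpM2l// (le_trans _ (rho_le tau0))// gerBl.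
apply: (@le_trans _ _ Z); first by rewrite gerBl Rintegral_norm_ge0.
by rewrite ler_peMr// pw_ge1.
Qed.

Lemma mode_scheme K tau : (0 < K)%N -> 0 < tau -> K%:R * tau = T ->
  \sum_(k < K) `|\int[leb]_(s in `]0, k.+1%:R * tau[) ((k.+1%:R * tau - s) `^ (- g) * v s) -
    (1 - g)^-1 * \sum_(j < k.+1) (j.+1%:R `^ (1 - g) - j%:R `^ (1 - g)) *
    ((\int[leb]_(s in `](k - j)%N%:R * tau, (k - j)%N.+1%:R * tau[) v s) / tau `^ g)|
  <= scheme_const g * B.
Proof.
move=> K0 tau0 KT.
have mv : measurable_fun D v by apply/measurable_EFinP; case/integrableP: iv.
have le_T k : (k <= K)%N -> k%:R * tau <= T by move=> kK; rewrite -KT ler_pM2r// ler_nat.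
have ae_eq (h : R -> R) p q : 0 <= p -> q <= T -> measurable_fun `]p, q[ h ->
    \int[leb]_(s in `]p, q[) (h s * v s) = \int[leb]_(s in `]p, q[) (h s * profile s).
  move=> p0 qT mh; have sub : `]p, q[ `<=` D by apply: subset_itv; rewrite bnd_simp.
  rewrite /Rintegral; congr fine; apply: ae_eq_integral => //.
  - by apply/measurable_EFinP; apply: measurable_funM => //; exact: measurable_funS mv.
  - apply/measurable_EFinP; apply: measurable_funM => //.
    exact: measurable_funS measurable_profile.
  - by apply: ae_imp ae_profile => s vs /sub sD /=; rewrite vs.
have osc_le j s t : (0 < j < K)%N -> (`]j%:R * tau, j.+1%:R * tau[%classic : set R) s ->
    (`]j%:R * tau, j.+1%:R * tau[%classic : set R) t ->
    `|profile s - profile t| <= osc (j.+1%:R * tau) - osc (j%:R * tau).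
  move=> /andP[j0 jK]; rewrite /= !in_itv/= => /andP[? ?] /andP[? ?].
  apply: profile_osc; [by rewrite mulr_gt0// ltr0n|exact: le_T| |];
    by apply/andP; split; exact: ltW.
have mp := measurable_profile; have pl := profile_le; have os := osc_sum K0 tau0 KT.
rewrite -KT in mp pl.
apply: le_trans (residual_sum g_gt0 g_lt1 tau0 mp pl osc_le os K0).
rewrite le_eqVlt; apply/orP; left; apply/eqP; apply: eq_bigr => k _; congr `|_ - _ * _|.
  apply: ae_eq => //; first exact: le_T.
  exact: measurable_kernel.
apply: eq_bigr => j _; congr (_ * (_ / _)).
have mul1E (F : R -> R) (J : set mR) : \int[leb]_(s in J) F s = \int[leb]_(s in J) (cst 1 s * F s).
  by apply: eq_Rintegral => s _; rewrite mul1r.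
rewrite mul1E [RHS]mul1E; apply: ae_eq => //.
  by rewrite mulr_ge0// ltW.
by apply: le_T; rewrite (leq_ltn_trans (leq_subr _ _)).
Qed.

End mode_profile.

(** * Uniform estimate for one mode of the evolution equation *)

Section mode_estimate.
Context {R : realType}.
Local Notation mR := (measurableTypeR R).
Local Notation leb := (@lebesgue_measure R).
Variables (g T mu y0 : R) (v F F1 F2 : R -> R).
Hypotheses (g_gt0 : 0 < g) (g_lt1 : g < 1) (T0 : 0 < T) (mu0 : 0 <= mu).
Local Notation D := (`]0, T[%classic : set mR).
Local Notation cB := (Beta (1 - g) g).
Local Notation G1 := (Gamma (1 - g)).
Hypotheses (iv : leb.-integrable D (EFin \o v)) (iF : leb.-integrable D (EFin \o F))
  (iF1 : leb.-integrable D (EFin \o F1)) (iF2 : leb.-integrable D (EFin \o F2)).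
Hypothesis mode_eq : {ae leb, forall t, 0 < t < T ->
  G1^-1 * \int[leb]_(r in `]0, t[) ((t - r) `^ (- g) * v r) +
  mu * (y0 + \int[leb]_(r in `]0, t[) v r) = F t}.
Hypothesis weak1 : forall psi : R -> R, test_function (`]0, T[%classic : set R) psi ->
  \int[leb]_(x in D) (derive1 psi x * F x) = - \int[leb]_(x in D) (psi x * F1 x).
Hypothesis weak2 : forall psi : R -> R, test_function (`]0, T[%classic : set R) psi ->
  \int[leb]_(x in D) (derive1 psi x * F1 x) = - \int[leb]_(x in D) (psi x * F2 x).

(** Large enough to absorb every coefficient in [mode_bound], and independent of [mu], so that the
    modes can be summed. *)
Definition mode_const : R := cB^-1 * G1 * (1 + T^-1 + g^-1 + 2 * T / g).

Definition mode_data : R := mu * `|y0| + \int[leb]_(t in D) `|F t| +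
  \int[leb]_(t in D) `|F1 t| + \int[leb]_(t in D) `|F2 t|.

Let G10 : 0 < G1.
Proof. by apply: Gamma_gt0; rewrite subr_gt0 g_lt1 gerBl ltW. Qed.

Let cB0 : 0 < cB.
Proof. by apply: Beta_gt0; apply/andP; split=> //; rewrite ?subr_gt0// ltrBlDr ltrDl. Qed.

Lemma mode_bound (a0 a1 Z f0 f1 f2 : R) : 0 <= f0 -> 0 <= f1 -> 0 <= f2 ->
  `|a0| <= T^-1 * f0 + f1 -> `|a1| <= T^-1 * f1 + f2 ->
  Z <= T `^ g / g * (`|G1 * a1| + G1 * f2) ->
  cB^-1 * (`|G1 * (a0 - mu * y0)| + Z * T `^ (1 - g)) <=
  mode_const * (mu * `|y0| + f0 + f1 + f2).
Proof.
move=> f00 f10 f20 ha0 ha1 hZ.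
have TT : T `^ g * T `^ (1 - g) = T.
  by rewrite -powRD ?(gt_eqF T0) ?implybT// subrKC powRr1// ltW.
have -> : mode_const * (mu * `|y0| + f0 + f1 + f2) =
    cB^-1 * (G1 * ((1 + T^-1 + g^-1 + 2 * T / g) * (mu * `|y0| + f0 + f1 + f2))).
  by rewrite /mode_const; ring.
apply: ler_wpM2l; first by rewrite invr_ge0 ltW.
have hb : `|G1 * (a0 - mu * y0)| <= G1 * (T^-1 * f0 + f1 + mu * `|y0|).
  rewrite normrM (gtr0_norm G10); apply: ler_wpM2l; first exact: ltW.
  rewrite (le_trans (ler_normB _ _))// normrM (ger0_norm mu0); exact: lerD.
have hz : Z * T `^ (1 - g) <= G1 * (T / g * (T^-1 * f1 + 2 * f2)).
  apply: (@le_trans _ _ (T `^ g / g * (`|G1 * a1| + G1 * f2) * T `^ (1 - g))).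
    by apply: ler_wpM2r => //; exact: powR_ge0.
  have -> : T `^ g / g * (`|G1 * a1| + G1 * f2) * T `^ (1 - g) =
      (T `^ g * T `^ (1 - g)) / g * (`|G1 * a1| + G1 * f2) by ring.
  rewrite TT normrM (gtr0_norm G10) -mulrDr mulrCA; apply: ler_wpM2l; first exact: ltW.
  apply: ler_wpM2l; first by rewrite divr_ge0 ?ltW.
  by rewrite (_ : 2 * f2 = f2 + f2) ?addrA ?lerD2r//; ring.
apply: le_trans (lerD hb hz) _; rewrite -mulrDr; apply: ler_wpM2l; first exact: ltW.
have my0 : 0 <= mu * `|y0| by rewrite mulr_ge0.
have -> : T / g * (T^-1 * f1 + 2 * f2) = g^-1 * f1 + 2 * T / g * f2.
  by field; rewrite ?gt_eqF.
have Ti : 0 <= T^-1 by rewrite invr_ge0 ltW.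
have gi : 0 <= g^-1 by rewrite invr_ge0 ltW.
have Tg : 0 <= 2 * T / g by rewrite !mulr_ge0 ?invr_ge0 ?ltW.
move: my0 Ti gi Tg; move: (2 * T / g) => k; move: (mu * `|y0|) (T^-1) (g^-1) => y i j y_ge0 i0 j0 k0.
rewrite -subr_ge0 (_ : _ - _ = f0 + i * f1 + j * f0 + j * f2 + k * f0 + k * f1 + f2 + i * f2 +
   i * y + j * y + k * y); last by ring.
by rewrite !addr_ge0 ?mulr_ge0.
Qed.

Theorem mode_estimate :
  {ae leb, forall t, 0 < t < T -> `|v t| <= mode_const * mode_data * t `^ (g - 1)} /\
  forall K tau, (0 < K)%N -> 0 < tau -> K%:R * tau = T ->
  \sum_(k < K) `|G1^-1 * (\int[leb]_(s in `]0, k.+1%:R * tau[)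
      ((k.+1%:R * tau - s) `^ (- g) * v s)) -
    (Gamma (2 - g))^-1 * \sum_(j < k.+1) (j.+1%:R `^ (1 - g) - j%:R `^ (1 - g)) *
    ((\int[leb]_(s in `](k - j)%N%:R * tau, (k - j)%N.+1%:R * tau[) v s) / tau `^ g)|
  <= G1^-1 * (scheme_const g * (mode_const * mode_data)).
Proof.
have mD : measurable D by [].
have [a0 H0] := du_bois_reymond iF iF1 weak1.
have [a1 H1] := du_bois_reymond iF1 iF2 weak2.
(* Multiplication by Gamma(1 - g) brings the equation to the form of [mode_rep], with m cB = G1 mu.
   The constant b collects the initial value a0 of F and the initial datum y0. *)
pose m := G1 * mu / cB.
have m0 : 0 <= m by rewrite /m !mulr_ge0 ?invr_ge0 ?(ltW G10) ?(ltW cB0).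
pose b := G1 * (a0 - mu * y0).
have ZF1 : leb.-integrable D (EFin \o (fun t => G1 * F1 t)) by exact: (integrableZl mD G1 iF1).
have ZF2 : leb.-integrable D (EFin \o (fun t => G1 * F2 t)) by exact: (integrableZl mD G1 iF2).
have Zprefix f t : t < T -> leb.-integrable D (EFin \o f) ->
    \int[leb]_(r in `]0, t[) (G1 * f r) = G1 * \int[leb]_(r in `]0, t[) f r.
  by move=> tT jf; rewrite RintegralZl//; apply: integrable_prefix jf; exact: ltW.
have E1 : {ae leb, forall t, 0 < t < T ->
    \int[leb]_(r in `]0, t[) ((t - r) `^ (- g) * v r) +
    m * cB * \int[leb]_(r in `]0, t[) v r = b + \int[leb]_(r in `]0, t[) (G1 * F1 r)}.
  apply: ae_imp2 mode_eq H0 => t Et Ft tD; have /andP[t0 tT] := tD.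
  move: (Et tD); rewrite (Ft tD) (Zprefix _ _ tT iF1) /m /b divfK ?gt_eqF//.
  move: (\int[leb]_(r in _) _) (\int[leb]_(r in _) v _) (\int[leb]_(r in _) F1 _) => x y z E.
  have -> : x = G1 * (a0 + z - mu * (y0 + y)).
    by rewrite -E addrK mulrA divff ?mul1r// gt_eqF.
  by ring.
have E2 : {ae leb, forall t, 0 < t < T ->
    G1 * F1 t = G1 * a1 + \int[leb]_(r in `]0, t[) (G1 * F2 r)}.
  apply: ae_imp H1 => t Ft tD; have /andP[t0 tT] := tD.
  by rewrite (Ft tD) (Zprefix _ _ tT iF2) mulrDr.
have [zeta [iz Zle rep]] := mode_rep g_gt0 g_lt1 m0 T0 iv ZF1 ZF2 E1 E2.
have N2 : \int[leb]_(t in D) `|G1 * F2 t| = G1 * \int[leb]_(t in D) `|F2 t|.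
  rewrite -RintegralZl//; last exact: integrable_norm.
  by apply: eq_Rintegral => t _; rewrite normrM gtr0_norm.
rewrite N2 in Zle.
have B_ge := mode_bound (Rintegral_norm_ge0 F D) (Rintegral_norm_ge0 F1 D)
  (Rintegral_norm_ge0 F2 D) (initial_value_le T0 iF iF1 H0) (initial_value_le T0 iF1 iF2 H1) Zle.
split; first exact: (mode_decay g_gt0 g_lt1 m0 T0 iz rep B_ge).
move=> K tau K0 tau0 KT.
have := mode_scheme g_gt0 g_lt1 m0 T0 iv iz rep B_ge K0 tau0 KT.
rewrite -/mode_data => H.
have G2 : Gamma (2 - g) = (1 - g) * G1.
  rewrite -GammaS ?subr_gt0 ?g_lt1 ?gerBl ?(ltW g_gt0)//.
  by congr Gamma; ring.
have Gi : 0 <= G1^-1 by rewrite invr_ge0 ltW.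
have := ler_wpM2l Gi H; apply: le_trans; rewrite mulr_sumr; apply: ler_sum => k _.
by rewrite -[X in X * `|_|](ger0_norm Gi) -normrM mulrBr G2 invfM [_^-1 * G1^-1]mulrC !mulrA.
Qed.

End mode_estimate.

(** * Monotonicity of the integral as a supremum over simple functions *)

Section lower_integral.
Local Open Scope ereal_scope.

(* The integral of a nonnegative function is a supremum over simple functions,
   hence monotone without any measurability. *)
Lemma ge0_le_lower_integral d (S : measurableType d) (R : realType)
    (mu : {measure set S -> \bar R}) (D : set S) (f1 f2 : S -> \bar R) :
  (forall x, D x -> 0 <= f1 x) -> (forall x, D x -> f1 x <= f2 x) ->
  \int[mu]_(x in D) f1 x <= \int[mu]_(x in D) f2 x.
Proof.
move=> f10 f12; rewrite !ge0_integralE//; last first.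
  by move=> x Dx; rewrite (le_trans (f10 x Dx))// f12.
apply: le_ereal_sup => _ [h hf <-]; exists h => // x.
apply: le_trans (hf x) _; rewrite !patchE; case: ifPn => // /set_mem; exact: f12.
Qed.

End lower_integral.

(** * Open subsets of the row space are measurable *)

Section open_measurable.
Context {R : realType} {n : nat}.
Local Notation E := 'rV[R]_n.

Lemma measurable_rV_ball (x : E) (e : R) : measurable (ball x e : set E).
Proof.
rewrite /measurable/= /measurable_rV.
have [e0|e0] := ltP 0 e; last first.
  rewrite (_ : _ @^-1` _ = set0); first exact: measurable0.
  by rewrite -subset0 => t [] /=; rewrite ltNge e0.
rewrite (_ : _ @^-1` _ = \bigcap_(i in [set: 'I_n]) ((fun t : n.-tuple (measurableTypeR R) => tnth t i)
    @^-1` ball (x ord0 i) e)); last first.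
  apply/seteqP; split=> t /=.
    by move=> [_ H] i _; have := H ord0 i; rewrite mxE.
  by move=> H; split=> // i j; rewrite (ord1 i) mxE; exact: H.
apply: fin_bigcap_measurable => // i _.
rewrite -[X in measurable X]setTI; apply: (measurable_tnth i) => //.
exact: measurable_ball.
Qed.

(** U is the union of the balls with rational centre and radius 1/(N+1) that it contains; [pickle]
    enumerates these countably many balls. *)
Lemma open_measurable_rV (U : set E) : open U -> measurable U.
Proof.
move=> oU.
pose good (p : 'rV[rat]_n * nat) := ball (map_mx ratr p.1 : E) (p.2.+1%:R^-1) `<=` U.
pose box (o : option ('rV[rat]_n * nat)) : set E := if o is Some p then
  if pselect (good p) then ball (map_mx ratr p.1 : E) (p.2.+1%:R^-1) else set0 else set0.
have box_sub o : box o `<=` U by move=> x; case: o => //= p; case: (pselect (good p)) => //; apply.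
have mbox o : measurable (box o).
  case: o => [p|]/=; last exact: measurable0.
  case: (pselect (good p)) => g /=; last exact: measurable0.
  exact: measurable_rV_ball.
rewrite (_ : U = \bigcup_k box (unpickle k)); first exact: bigcupT_measurable.
apply/seteqP; split=> [x Ux|x [k _]]; last exact: box_sub.
have /nbhs_ballP[e /= e0 eU] := open_nbhs_nbhs (conj oU Ux).
pose N := Num.trunc (2 / e).
pose d : R := N.+1%:R^-1.
have d0 : 0 < d by rewrite invr_gt0 ltr0n.
have de : d + d <= e.
  rewrite -mulr2n -mulr_natr mulrC ler_pdivrMr ?ltr0n// mulrC -ler_pdivrMr//.
  by rewrite ltW// truncnS_gt.
have /choice[q Hq] : forall j : 'I_n, exists q : rat, ratr q \in `]x ord0 j - d, x ord0 j + d[.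
  by move=> j; apply: rat_in_itvoo; lra.
have xq j : `|x ord0 j - ratr (q j)| < d.
  by have := Hq j; rewrite in_itv/= => /andP[? ?]; rewrite ltr_norml; apply/andP; split; lra.
pose p : 'rV[rat]_n * nat := (\row_j q j, N).
exists (pickle p) => //; rewrite pickleK /box.
case: (pselect (good p)) => [g|[]].
  by split=> // i j; rewrite (ord1 i) !mxE/= /ball/= distrC.
move=> y [_ Hy]; apply: eU; split=> // i j.
have := Hy i j; rewrite (ord1 i) !mxE/= /ball/= => yq.
rewrite -(subrK (ratr (q j)) (x ord0 j)) -addrA (le_lt_trans (ler_normD _ _))//.
by rewrite (lt_le_trans _ de)// ltrD// xq.
Qed.

End open_measurable.

(** * The space L^2 of the domain and its scalar product *)

Section square_integrable.
Context {R : realType} {n : nat}.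
Local Notation E := 'rV[R]_n.
Local Notation mu := (lebesgue_rV n).
Variable Omega : set E.
Hypothesis mO : measurable Omega.
Implicit Types (w v u : E -> R) (a : R).
Local Notation dot := (L2dot Omega).

Lemma L2_mul w v : L2 Omega w -> L2 Omega v -> mu.-integrable Omega (EFin \o (fun x => w x * v x)).
Proof.
move=> [mw iw] [mv iv].
have iwv : mu.-integrable Omega (fun x => (w x ^+ 2)%:E + (v x ^+ 2)%:E)%E.
  exact: integrableD.
apply: le_integrable iwv => //; first by apply/measurable_EFinP; exact: measurable_funM.
move=> x _; rewrite /= lee_fin normrM [leRHS]ger0_norm ?addr_ge0 ?sqr_ge0//.
rewrite -(real_normK (num_real (w x))) -(real_normK (num_real (v x))).
have := sqr_ge0 (`|w x| - `|v x|); rewrite sqrrB.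
have := mulr_ge0 (normr_ge0 (w x)) (normr_ge0 (v x)).
by move: (`|w x|) (`|v x|) => p q; rewrite -mulr_natl; nra.
Qed.

Lemma L2_lin a w v : L2 Omega w -> L2 Omega v -> L2 Omega (fun x => a * w x + v x).
Proof.
move=> Lw Lv; have [mw iw] := Lw; have [mv iv] := Lv; split.
  by apply: measurable_funD => //; exact: measurable_funM.
have i1 : mu.-integrable Omega (EFin \o (fun x => a ^+ 2 * w x ^+ 2)) by exact: (integrableZl mO (a ^+ 2) iw).
have i2 : mu.-integrable Omega (EFin \o (fun x => (2 * a) * (w x * v x))).
  exact: (integrableZl mO (2 * a) (L2_mul Lw Lv)).
apply: eq_integrable (integrableD mO (integrableD mO i1 i2) iv) => // x _.
by rewrite /= -!EFinD; congr EFin; ring.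
Qed.

Lemma L2_0 : L2 Omega (fun=> 0).
Proof.
split; first exact: measurable_cst.
by apply: eq_integrable (integrable0 mu Omega) => // x _; rewrite expr0n.
Qed.

Lemma L2_scale a w : L2 Omega w -> L2 Omega (fun x => a * w x).
Proof.
move=> Lw; have := L2_lin a Lw L2_0; congr L2.
by apply/funext => x; rewrite addr0.
Qed.

Lemma L2_comb (c : nat -> R) (f : nat -> E -> R) m : (forall k, (k < m)%N -> L2 Omega (f k)) ->
  L2 Omega (fun x => \sum_(k < m) c k * f k x).
Proof.
elim: m => [_|m IH Lf].
  by rewrite (_ : (fun x => _) = (fun=> 0)); [exact: L2_0|apply/funext => x; rewrite big_ord0].
rewrite (_ : (fun x => _) = (fun x => c m * f m x + \sum_(k < m) c k * f k x)).
  by apply: L2_lin; [exact: Lf|apply: IH => k km; apply: Lf; exact: ltnW].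
by apply/funext => x; rewrite big_ord_recr/= addrC.
Qed.

Lemma L2dotC w v : dot w v = dot v w.
Proof. by apply: eq_Rintegral => x _; rewrite mulrC. Qed.

Lemma L2dot_linl a w v u : L2 Omega w -> L2 Omega v -> L2 Omega u ->
  dot (fun x => a * w x + v x) u = a * dot w u + dot v u.
Proof.
move=> Lw Lv Lu; rewrite /L2dot -RintegralZl//; last exact: L2_mul.
rewrite -RintegralD//; last exact: L2_mul.
  by apply: eq_Rintegral => x _; ring.
exact: (integrableZl mO a (L2_mul Lw Lu)).
Qed.

Lemma L2dot_linr a w v u : L2 Omega w -> L2 Omega v -> L2 Omega u ->
  dot u (fun x => a * w x + v x) = a * dot u w + dot u v.
Proof. by move=> Lw Lv Lu; rewrite L2dotC L2dot_linl// !(L2dotC u). Qed.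

Lemma L2dot0 u : dot (fun=> 0) u = 0.
Proof. by rewrite /L2dot; under eq_Rintegral do rewrite mul0r; rewrite Rintegral_cst// mul0r. Qed.

Lemma L2dot_comb (c : nat -> R) (f : nat -> E -> R) m u :
  (forall k, (k < m)%N -> L2 Omega (f k)) -> L2 Omega u ->
  dot (fun x => \sum_(k < m) c k * f k x) u = \sum_(k < m) c k * dot (f k) u.
Proof.
move=> + Lu; elim: m => [_|m IH Lf].
  rewrite big_ord0 -[RHS](L2dot0 u); congr L2dot.
  by apply/funext => x; rewrite big_ord0.
rewrite (_ : (fun x => _) = (fun x => c m * f m x + \sum_(k < m) c k * f k x)); last first.
  by apply/funext => x; rewrite big_ord_recr/= addrC.
have Lf' k : (k < m)%N -> L2 Omega (f k) by move=> km; apply: Lf; exact: ltnW.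
rewrite L2dot_linl//; [|exact: Lf|exact: L2_comb].
by rewrite IH// big_ord_recr/= addrC.
Qed.

Lemma L2dot_ge0 w : 0 <= dot w w.
Proof. by apply: Rintegral_ge0 => x _; rewrite -expr2 sqr_ge0. Qed.

Lemma L2normsqE w : L2 Omega w -> L2normsq Omega w = (dot w w)%:E.
Proof.
move=> Lw; rewrite /L2dot /Rintegral fineK; last exact: (integrable_fin_num _ (L2_mul Lw Lw)).
by apply: eq_integral => x _; rewrite expr2.
Qed.

Lemma L2_cauchy_schwarz w v : L2 Omega w -> L2 Omega v ->
  dot w v ^+ 2 <= dot w w * dot v v.
Proof.
move=> Lw Lv.
have H t : 0 <= t ^+ 2 * dot w w + 2 * t * dot w v + dot v v.
  have Lt := L2_lin t Lw Lv.
  have := L2dot_ge0 (fun x => t * w x + v x).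
  rewrite L2dot_linl// !L2dot_linr// (L2dotC v w).
  by congr (0 <= _); ring.
have := L2dot_ge0 w; have := L2dot_ge0 v; move: H.
move: (dot w v) (dot w w) (dot v v) => b a c H c0.
rewrite le_eqVlt => /predU1P[a0|a0].
  have [->|b0] := eqVneq b 0; first by rewrite expr0n/= -a0 mul0r.
  (* Degenerate case: an affine function of t that is nonnegative everywhere has slope zero; at this
     t it would equal -1. *)
  have := H (- (c + 1) / (2 * b)); rewrite -a0 mulr0 add0r.
  have -> : 2 * (- (c + 1) / (2 * b)) * b = - (c + 1) by field.
  by rewrite opprD addrAC addNr add0r oppr_ge0 ler10.
(* The minimiser of the quadratic polynomial. *)
have := H (- b / a).
have -> : (- b / a) ^+ 2 * a + 2 * (- b / a) * b + c = (a * c - b ^+ 2) / a.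
  by field; rewrite gt_eqF.
by rewrite pmulr_lge0 ?invr_gt0// subr_ge0.
Qed.

End square_integrable.

(** * Spectral Sobolev spaces and their duals *)

Section spectral_spaces.
Context {R : realType} {n : nat}.
Local Notation E := 'rV[R]_n.
Local Notation mu := (lebesgue_rV n).
Variables (Omega : set E) (lam : nat -> R) (phi : nat -> E -> R) (s : R).
Hypothesis mO : measurable Omega.
Hypothesis Lphi : forall k, L2 Omega (phi k).
Local Notation dot := (L2dot Omega).
Hypothesis ortho : forall i j, dot (phi i) (phi j) = (i == j)%:R.
Implicit Types (w v u : E -> R) (a : R) (c : nat -> R) (F : (E -> R) -> R).
Local Notation Hsn := (Hs_norm Omega lam phi s).
Local Notation HsO := (Hs Omega lam phi s).
Local Notation dualn := (dual_norm Omega lam phi s).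

Definition wt k : R := lam k `^ s.

Lemma wt_ge0 k : 0 <= wt k. Proof. exact: powR_ge0. Qed.

Definition Hsq w : \bar R := (\sum_(k <oo) (wt k * dot w (phi k) ^+ 2)%:E)%E.

Let term_ge0 w k : (0 <= (wt k * dot w (phi k) ^+ 2)%:E)%E.
Proof. by rewrite lee_fin mulr_ge0 ?wt_ge0 ?sqr_ge0. Qed.

Lemma Hsq_ge0 w : (0 <= Hsq w)%E.
Proof. by apply: nneseries_ge0 => k _ _. Qed.

Lemma Hs_normE w : Hsq w \is a fin_num -> Hsn w = (Num.sqrt (fine (Hsq w)))%:E.
Proof.
move=> wfin; rewrite /Hs_norm -/(Hsq w) -(fineK wfin) poweR_EFin.
by rewrite powR12_sqrt// fine_ge0// Hsq_ge0.
Qed.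

Lemma HsP w : HsO w <-> L2 Omega w /\ (Hsq w < +oo)%E.
Proof.
split=> -[Lw wfin]; split=> //; last first.
  by rewrite Hs_normE ?ltry// ge0_fin_numE// Hsq_ge0.
rewrite ltNge leye_eq; apply/negP => /eqP wy; move: wfin.
by rewrite /Hs_norm -/(Hsq w) wy poweRyr ?ltxx// invr_eq0 pnatr_eq0.
Qed.

Lemma Hsq_fin w : HsO w -> Hsq w \is a fin_num.
Proof. by move=> /HsP[_ wfin]; rewrite ge0_fin_numE// Hsq_ge0. Qed.

Lemma Hs_norm_le1 w : HsO w -> (Hsn w <= 1)%E = (Hsq w <= 1)%E.
Proof.
move=> /Hsq_fin wfin; rewrite Hs_normE// -[in RHS](fineK wfin) !lee_fin.
by rewrite -{1}sqrtr1 ler_sqrt.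
Qed.

Lemma L2dot_scale a w u : L2 Omega w -> L2 Omega u -> dot (fun x => a * w x) u = a * dot w u.
Proof.
move=> Lw Lu; have := L2dot_linl mO a Lw (L2_0 mO) Lu.
rewrite L2dot0// addr0 => <-; congr L2dot.
by apply/funext => x; rewrite addr0.
Qed.

Lemma Hsq_scale a w : L2 Omega w -> Hsq (fun x => a * w x) = ((a ^+ 2)%:E * Hsq w)%E.
Proof.
move=> Lw; rewrite -nneseriesZl//; apply: eq_eseriesr => k _.
by rewrite -EFinM L2dot_scale// exprMn mulrCA.
Qed.

Lemma Hsq_lin a w v : L2 Omega w -> L2 Omega v ->
  (Hsq (fun x => a * w x + v x)%R <= (2 * a ^+ 2)%:E * Hsq w + 2%:E * Hsq v)%E.
Proof.
move=> Lw Lv; rewrite -!nneseriesZl// -nneseriesD//; last 2 first.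
- by move=> k _ _; rewrite mule_ge0// lee_fin mulr_ge0// sqr_ge0.
- by move=> k _ _; rewrite mule_ge0.
apply: lee_nneseries => // k _; rewrite -!EFinM -EFinD lee_fin L2dot_linl//.
have := wt_ge0 k; move: (wt k) (dot w (phi k)) (dot v (phi k)) => x y z x0.
rewrite -subr_ge0.
have -> : 2 * a ^+ 2 * (x * y ^+ 2) + 2 * (x * z ^+ 2) - x * (a * y + z) ^+ 2 =
  x * (a * y - z) ^+ 2 by ring.
by rewrite mulr_ge0 ?sqr_ge0.
Qed.

Lemma Hs_lin a w v : HsO w -> HsO v -> HsO (fun x => a * w x + v x).
Proof.
move=> Hw Hv; have wfin := Hsq_fin Hw; have vfin := Hsq_fin Hv.
move: Hw Hv => /HsP[Lw _] /HsP[Lv _].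
apply/HsP; split; first exact: L2_lin.
rewrite (le_lt_trans (Hsq_lin a Lw Lv))// -(fineK wfin) -(fineK vfin).
by rewrite -!EFinM -EFinD ltry.
Qed.

Lemma Hs_L2 w : HsO w -> L2 Omega w. Proof. by case. Qed.

Lemma Hsq_finite w m : (forall k, (m <= k)%N -> dot w (phi k) = 0) ->
  Hsq w = (\sum_(k < m) wt k * dot w (phi k) ^+ 2)%:E.
Proof.
move=> w0; rewrite /Hsq (nneseries_split 0 m) ?add0n; last by [].
rewrite eseries0 ?adde0; first by rewrite big_mkord sumEFin.
by move=> k mk _; rewrite w0// expr0n/= mulr0.
Qed.

Lemma Hs_of_finite w m : L2 Omega w -> (forall k, (m <= k)%N -> dot w (phi k) = 0) -> HsO w.
Proof. by move=> Lw w0; apply/HsP; rewrite (Hsq_finite w0) ltry. Qed.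

Lemma Hs_phi k : HsO (phi k).
Proof.
apply: (@Hs_of_finite _ k.+1) => // j kj; rewrite ortho.
by case: eqP kj => // ->; rewrite ltnn.
Qed.

Lemma Hsq_phi k : Hsq (phi k) = (wt k)%:E.
Proof.
rewrite (@Hsq_finite _ k.+1); last first.
  by move=> j kj; rewrite ortho; case: eqP kj => // ->; rewrite ltnn.
rewrite big_ord_recr/= ortho eqxx expr1n mulr1 big1 ?add0r// => j _.
by rewrite ortho gtn_eqF ?ltn_ord// expr0n mulr0.
Qed.

Definition comb c m : E -> R := fun x => \sum_(k < m) c k * phi k x.

Lemma L2_phi_comb c m : L2 Omega (comb c m).
Proof. by apply: L2_comb. Qed.

Lemma comb_coef c m j : dot (comb c m) (phi j) = if (j < m)%N then c j else 0.
Proof.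
rewrite L2dot_comb//; case: ifPn => [jm|].
  rewrite (bigD1 (Ordinal jm))//= ortho eqxx mulr1 big1 ?addr0// => i ij.
  by rewrite ortho -val_eqE/= in ij *; rewrite (negbTE ij) mulr0.
rewrite -leqNgt => mj; rewrite big1// => i _.
by rewrite ortho ltn_eqF ?mulr0// (leq_trans (ltn_ord i)).
Qed.

Lemma Hs_comb c m : HsO (comb c m).
Proof.
apply: (@Hs_of_finite _ m); first exact: L2_phi_comb.
by move=> k mk; rewrite comb_coef ltnNge mk.
Qed.

Lemma Hsq_comb c m : Hsq (comb c m) = (\sum_(k < m) wt k * c k ^+ 2)%:E.
Proof.
rewrite (@Hsq_finite _ m); last by move=> k mk; rewrite comb_coef ltnNge mk.
by congr EFin; apply: eq_bigr => k _; rewrite comb_coef ltn_ord.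
Qed.

Definition proj w m := comb (fun k => dot w (phi k)) m.

Lemma Hs_sub w m : HsO w -> HsO (fun x => (-1) * proj w m x + w x).
Proof. by move=> Hw; exact: (Hs_lin (-1) (Hs_comb _ m) Hw). Qed.

Lemma Hsq_tail w m : HsO w -> Hsq (fun x => (-1) * proj w m x + w x) =
  (\sum_(m <= k <oo) (wt k * dot w (phi k) ^+ 2)%:E)%E.
Proof.
move=> Hw; have Lw := Hs_L2 Hw.
have E k : dot (fun x => (-1) * proj w m x + w x) (phi k) =
    if (k < m)%N then 0 else dot w (phi k).
  rewrite L2dot_linl ?comb_coef//; last exact: L2_phi_comb.
  by case: ifP => _; ring.
rewrite /Hsq (nneseries_split 0 m) ?add0n; last by [].
rewrite big_mkord big1 ?add0e; last first.
  by move=> k _; rewrite E ltn_ord expr0n mulr0.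
apply/congr_lim/funext => j; apply: eq_big_nat => k /andP[mk _].
by rewrite E ltnNge mk.
Qed.

Lemma tail_cvg w : HsO w -> fine (Hsq (fun x => (-1) * proj w m x + w x)) @[m --> \oo] --> (0 : R).
Proof.
move=> Hw; have /HsP[_ wfin] := Hw.
rewrite (_ : (fun m => _) = (fun m => fine (\sum_(m <= k <oo) (wt k * dot w (phi k) ^+ 2)%:E)%E)).
  apply: (@fine_cvg _ _ _ _ (fun m => \sum_(m <= k <oo) (wt k * dot w (phi k) ^+ 2)%:E)%E).
  exact: (nneseries_tail_cvg wfin).
by apply/funext => m; rewrite Hsq_tail.
Qed.

Section functionals.
Variable F : (E -> R) -> R.
Hypothesis F_lin : forall a w v, HsO w -> HsO v -> F (fun x => a * w x + v x) = a * F w + F v.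

Lemma Hs_0 : HsO (fun=> 0).
Proof.
by apply: (@Hs_of_finite _ 0); [exact: L2_0|move=> k _; rewrite L2dot0//].
Qed.

Lemma functional0 : F (fun=> 0) = 0.
Proof.
have := F_lin 1 Hs_0 Hs_0; rewrite (_ : (fun x : E => 1 * 0 + 0) = (fun=> 0)).
  by rewrite mul1r => /eqP; rewrite -subr_eq subrr eq_sym => /eqP.
by apply/funext => x; rewrite mulr0 addr0.
Qed.

Lemma functional_comb c m : F (comb c m) = \sum_(k < m) c k * F (phi k).
Proof.
elim: m => [|m IH].
  rewrite big_ord0 -[RHS]functional0; congr F.
  by apply/funext => x; rewrite /comb big_ord0.
rewrite big_ord_recr/= -IH addrC -F_lin; [|exact: Hs_phi|exact: Hs_comb].
by congr F; apply/funext => x; rewrite /comb big_ord_recr/= addrC.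
Qed.

Lemma functional_scale a w : HsO w -> F (fun x => a * w x) = a * F w.
Proof.
move=> Hw; have := F_lin a Hw Hs_0; rewrite functional0 addr0 => <-.
by congr F; apply/funext => x; rewrite addr0.
Qed.

Variable N : R.
Hypothesis F_N : (dualn F <= N%:E)%E.

Lemma dual_norm_apply w : HsO w -> (Hsq w <= 1)%E -> `|F w| <= N.
Proof.
move=> Hw w1; rewrite -lee_fin (le_trans _ F_N)//; apply: ereal_sup_ubound.
by exists w => //; split => //; rewrite Hs_norm_le1.
Qed.

Lemma dual_bound_ge0 : 0 <= N.
Proof.
apply: le_trans (dual_norm_apply Hs_0 _); first exact: normr_ge0.
by rewrite (@Hsq_finite _ 0) ?big_ord0// => k _; rewrite L2dot0//.
Qed.

(** The bound on the unit ball extends by homogeneity, after scaling by any r whose square dominates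
    [Hsq w]. *)
Lemma dual_bound w : HsO w -> F w ^+ 2 <= N ^+ 2 * fine (Hsq w).
Proof.
move=> Hw; have N0 := dual_bound_ge0.
have wfin := Hsq_fin Hw; have Lw := Hs_L2 Hw.
have q0 : 0 <= fine (Hsq w) by rewrite fine_ge0// Hsq_ge0.
have H r : 0 < r -> fine (Hsq w) <= r ^+ 2 -> `|F w| <= N * r.
  move=> r0 qr; rewrite -ler_pdivrMr// mulrC -[X in X * _]gtr0_norm ?invr_gt0//.
  rewrite -normrM -functional_scale//; apply: dual_norm_apply.
    have := Hs_lin r^-1 Hw Hs_0; congr Hs.
    by apply/funext => x; rewrite addr0.
  rewrite Hsq_scale// -(fineK wfin) -EFinM lee_fin exprVn mulrC ler_pdivrMr ?exprn_gt0//.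
  by rewrite mul1r.
move: q0; rewrite le_eqVlt => /predU1P[q0|q0].
  (* Here w has norm zero, so arbitrarily large multiples of it stay in the unit ball. *)
  have -> : F w = 0.
    apply/eqP; rewrite -normr_le0; apply/ler_addgt0Pr => e e0; rewrite add0r.
    have e' : 0 < e / (N + 1) by rewrite divr_gt0// ltr_wpDl.
    apply: le_trans (H _ e' _) _; first by rewrite -q0 sqr_ge0.
    rewrite mulrCA; apply: ler_piMr; first exact: ltW.
    by rewrite ler_pdivrMr ?mul1r ?lerDl// ltr_wpDl.
  by rewrite expr0n/= -q0 mulr0.
rewrite -real_normK ?num_real// -(sqr_sqrtr (ltW q0)) -exprMn.
apply: lerXn2r; rewrite ?nnegrE ?mulr_ge0 ?sqrtr_ge0//.
by apply: H; rewrite ?sqrtr_gt0// sqr_sqrtr// ltW.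
Qed.

Lemma functional_phi_le k : F (phi k) ^+ 2 <= N ^+ 2 * wt k.
Proof. by have := dual_bound (Hs_phi k); rewrite Hsq_phi. Qed.

Lemma functional_phi0 k : wt k = 0 -> F (phi k) = 0.
Proof.
move=> k0; have := functional_phi_le k; rewrite k0 mulr0 => Fk.
by apply/eqP; rewrite -sqrf_eq0 eq_le Fk sqr_ge0.
Qed.

(** F is tested against its own truncated Riesz representative, with coefficients F(phi_k)/wt_k.
    Where wt_k = 0 the inverse is 0 by convention and the term vanishes. *)
Lemma bessel m : \sum_(k < m) (wt k)^-1 * F (phi k) ^+ 2 <= N ^+ 2.
Proof.
set S := \sum_(k < m) _; have S0 : 0 <= S.
  by apply: sumr_ge0 => k _; rewrite mulr_ge0 ?sqr_ge0 ?invr_ge0 ?wt_ge0.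
have := dual_bound (Hs_comb (fun k => (wt k)^-1 * F (phi k)) m).
rewrite functional_comb Hsq_comb/=.
have -> : \sum_(k < m) (wt k)^-1 * F (phi k) * F (phi k) = S.
  by apply: eq_bigr => k _; rewrite expr2 mulrA.
have -> : \sum_(k < m) wt k * ((wt k)^-1 * F (phi k)) ^+ 2 = S.
  apply: eq_bigr => k _; have [->|k0] := eqVneq (wt k) 0; first by rewrite invr0 !mul0r.
  by field.
move: S0; rewrite le_eqVlt => /predU1P[<- _|S0]; first exact: sqr_ge0.
by rewrite expr2 ler_pM2r.
Qed.

Lemma functional_proj_cvg w : HsO w -> F (proj w m) @[m --> \oo] --> F w.
Proof.
move=> Hw; apply/subr_cvg0/norm_cvg0P.
have E m : `|F (proj w m) - F w| = Num.sqrt ((F (fun x => (-1) * proj w m x + w x)) ^+ 2).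
  by rewrite (F_lin (-1) (Hs_comb _ m) Hw) sqrtr_sqr mulN1r distrC addrC.
rewrite (_ : (fun m => _) = (fun m => Num.sqrt ((F (fun x => (-1) * proj w m x + w x)) ^+ 2))); last first.
  by apply/funext => m; rewrite -E.
rewrite -[X in _ --> X](@sqrtr0 R); apply: continuous_cvg; first exact: sqrt_continuous.
apply: (@squeeze_cvgr _ _ _ _ (cst 0) (fun m => N ^+ 2 * fine (Hsq (fun x => (-1) * proj w m x + w x)))).
- near=> m; rewrite sqr_ge0/=; apply: dual_bound; exact: Hs_sub.
- exact: cvg_cst.
- rewrite -[X in _ --> X](mulr0 (N ^+ 2)); apply: cvgMr; exact: tail_cvg.
Unshelve. all: by end_near. Qed.

End functionals.

(** A converse to [bessel] for functionals that are linear on finite combinations and compatible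
    with the spectral projections: a weighted Young inequality in each mode, then a limit in the
    number of modes. *)
Lemma dual_norm_le F q : 0 <= q ->
  (forall w, HsO w -> F (proj w m) @[m --> \oo] --> F w) ->
  (forall c m, F (comb c m) = \sum_(k < m) c k * F (phi k)) ->
  (forall k, wt k = 0 -> F (phi k) = 0) ->
  (forall m, \sum_(k < m) (wt k)^-1 * F (phi k) ^+ 2 <= q ^+ 2) -> (dualn F <= q%:E)%E.
Proof.
move=> q0 Fcvg Fcomb F0 Fq.
(* A positive r replaces q, because the next estimate divides by it. *)
suff H r : 0 < r -> q <= r -> (dualn F <= r%:E)%E.
  by apply/lee_addgt0Pr => e e0; rewrite -EFinD; apply: H; [rewrite ltr_wpDl|rewrite lerDl ltW].
move=> r0 qr; apply: ub_ereal_sup => _ [w [Hw w1] <-]; rewrite lee_fin.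
rewrite Hs_norm_le1// in w1.
have Hm m : `|F (proj w m)| <= r.
  rewrite /proj Fcomb (le_trans (ler_norm_sum _ _ _))//.
  apply: (@le_trans _ _ (\sum_(k < m) (2^-1 * (r * (wt k * dot w (phi k) ^+ 2)) +
      2^-1 * (r^-1 * ((wt k)^-1 * F (phi k) ^+ 2))))).
    apply: ler_sum => k _; have [k0|k0] := eqVneq (wt k) 0.
      by rewrite F0// k0 invr0 !(mul0r, mulr0) normr0 addr0.
    have {}k0 : 0 < wt k by rewrite lt_def k0 wt_ge0.
    have rk : 0 < r * wt k by rewrite mulr_gt0.
    rewrite -subr_ge0 normrM.
    rewrite -(real_normK (num_real (dot w (phi k)))) -(real_normK (num_real (F (phi k)))).
    move: (wt k) k0 (`|dot w (phi k)|) (`|F (phi k)|) rk => y y0 p z ry.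
    have -> : 2^-1 * (r * (y * p ^+ 2)) + 2^-1 * (r^-1 * (y^-1 * z ^+ 2)) - p * z =
      2^-1 * (r * y)^-1 * (r * y * p - z) ^+ 2 by field; rewrite !gt_eqF.
    by rewrite mulr_ge0 ?sqr_ge0// mulr_ge0// invr_ge0 ltW.
  rewrite big_split/= -!mulr_sumr.
  have s1 : \sum_(k < m) wt k * dot w (phi k) ^+ 2 <= 1.
    rewrite -lee_fin (le_trans _ w1)// -sumEFin -(big_mkord xpredT (fun k => (wt k * dot w (phi k) ^+ 2)%:E)).
    exact: nneseries_lim_ge.
  have s2 : \sum_(k < m) (wt k)^-1 * F (phi k) ^+ 2 <= r ^+ 2.
    by rewrite (le_trans (Fq m))// lerXn2r ?nnegrE// ltW.
  have t1 : r * (\sum_(k < m) wt k * dot w (phi k) ^+ 2) <= r by rewrite ler_piMr// ltW.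
  have t2 : r^-1 * (\sum_(k < m) (wt k)^-1 * F (phi k) ^+ 2) <= r.
    by rewrite mulrC ler_pdivrMr// -expr2.
  move: (r * _) (r^-1 * _) t1 t2 => x y t1 t2; lra.
have c : `|F (proj w m)| @[m --> \oo] --> `|F w| by apply: cvg_norm; exact: Fcvg.
rewrite -(cvg_lim (@norm_hausdorff _ _) c); apply: limr_le; last exact: nearW.
by apply/cvg_ex; exists `|F w|.
Qed.

End spectral_spaces.

(** * Functions of time with values in the dual space *)

Section time_dependent.
Context {R : realType} {n : nat}.
Local Notation E := 'rV[R]_n.
Local Notation mR := (measurableTypeR R).
Local Notation leb := (@lebesgue_measure R).
Variables (Omega : set E) (lam : nat -> R) (phi : nat -> E -> R) (s : R).
Hypothesis mO : measurable Omega.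
Hypothesis Lphi : forall k, L2 Omega (phi k).
Local Notation dot := (L2dot Omega).
Hypothesis ortho : forall i j, dot (phi i) (phi j) = (i == j)%:R.
Variable T : R.
Local Notation D := (`]0, T[%classic : set mR).
Local Notation HsO := (Hs Omega lam phi s).
Local Notation HsqO := (Hsq Omega lam phi s).
Local Notation HmsO := (Hms Omega lam phi s).
Local Notation dualn := (dual_norm Omega lam phi s).
Local Notation wtk := (wt lam s).
Implicit Types (w v : E -> R) (f : R -> (E -> R) -> R).

Lemma dual_norm_ge0 F : (0 <= dualn F)%E.
Proof.
apply: (@le_trans _ _ `|F (fun=> 0)|%:E); first by rewrite lee_fin.
have H0 := Hs_0 lam phi s mO; apply: ereal_sup_ubound; exists (fun=> 0) => //; split=> //.
rewrite (Hs_norm_le1 H0) (@Hsq_finite _ _ _ _ _ _ _ 0%N) ?big_ord0//.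
by move=> k _; rewrite L2dot0.
Qed.

Lemma dual_normK F : HmsO F -> dualn F = (fine (dualn F))%:E.
Proof. by move=> [_ F1]; rewrite fineK// ge0_fin_numE// dual_norm_ge0. Qed.

Lemma dual_norm_le_fine F : HmsO F -> (dualn F <= (fine (dualn F))%:E)%E.
Proof. by move=> HF; rewrite -(dual_normK HF). Qed.

(** Pairing with w is controlled by the dual norm, so it is a pointwise limit of the pairings of the
    approximating simple functions. *)
Lemma strong_measurable_apply f w : (forall t, 0 < t < T -> HmsO (f t)) ->
  strongly_measurable Omega lam phi s T f -> HsO w -> measurable_fun D (fun t => f t w).
Proof.
move=> Hf [S [simpleS cvgS]] Hw.
have Slin m t a u v : HsO u -> HsO v ->
    S m t (fun x => a * u x + v x) = a * S m t u + S m t v.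
  have [p [B [x [Bx SE]]]] := simpleS m; move=> Hu Hv; rewrite !SE mulr_sumr -big_split/=.
  by apply: eq_bigr => i _; rewrite (Bx i).2.1// mulrDr mulrCA.
apply: (@measurable_fun_cvg _ _ _ _ (fun m t => S m t w)).
  move=> m; have [p [B [x [Bx SE]]]] := simpleS m.
  apply: (eq_measurable_fun (fun t => \sum_(i < p) \1_(B i) t * x i w)).
    by move=> t _; rewrite SE.
  apply: measurable_sum => i; apply: measurable_funM => //.
  by apply: measurable_funTS; apply: measurable_indic; have [] := Bx i.
move=> t; rewrite /= in_itv/= => tD; have Hft := Hf t tD.
apply/subr_cvg0/norm_cvg0P.
have /fine_cvgP[dfin dcvg] := cvgS t tD.
rewrite -[X in _ --> X](@sqrtr0 R).
apply: (@cvg_trans _ (Num.sqrt ((S m t w - f t w) ^+ 2) @[m --> \oo])).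
  by apply: near_eq_cvg; near=> m; rewrite sqrtr_sqr.
apply: continuous_cvg; first exact: sqrt_continuous.
apply: (@squeeze_cvgr _ _ _ _ (cst 0)
    (fun m => (fine (dualn (fun w => S m t w - f t w))) ^+ 2 * fine (HsqO w))).
- near=> m; rewrite sqr_ge0/=.
  apply: (@dual_bound _ _ _ _ _ _ mO Lphi (fun w => S m t w - f t w)) => //.
    by move=> a u v Hu Hv; rewrite Slin// Hft.1//; ring.
  by rewrite fineK//; near: m.
- exact: cvg_cst.
- rewrite -[X in _ --> X](mul0r (fine (HsqO w))); apply: cvgMl.
  rewrite -[X in _ --> X](mulr0 (0 : R)).
  by rewrite (_ : (fun m => _) = (fun m => (fine (dualn (fun w => S m t w - f t w))) *
    (fine (dualn (fun w => S m t w - f t w))))); [exact: cvgM|apply/funext => m; rewrite expr2].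
Unshelve. all: by end_near. Qed.

Lemma Lp_measurable p f w : Lp_Hms Omega lam phi s T p f -> HsO w ->
  measurable_fun D (fun t => f t w).
Proof. by move=> [Hf sf _] Hw; exact: strong_measurable_apply. Qed.

Lemma L1_integrable f w : Lp_Hms Omega lam phi s T 1 f -> HsO w ->
  leb.-integrable D (EFin \o (fun t => f t w)).
Proof.
move=> fL Hw; have [Hf sf fint] := fL; have mD : measurable D by [].
(* The factor a brings w into the unit ball, since q <= (1 + q)^2. *)
pose q := fine (HsqO w); pose a : R := (1 + q)^-1.
have q0 : 0 <= q by rewrite fine_ge0// Hsq_ge0.
have a0 : 0 < a by rewrite invr_gt0 ltr_pwDl.
have Lw := Hs_L2 Hw.
have Haw : HsO (fun x => a * w x).
  have := Hs_lin mO Lphi a Hw (Hs_0 lam phi s mO); congr Hs.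
  by apply/funext => x; rewrite addr0.
have aw1 : (HsqO (fun x => a * w x)%R <= 1)%E.
  rewrite Hsq_scale// -(fineK (Hsq_fin Hw)) -/q -EFinM lee_fin /a exprVn mulrC.
  by rewrite ler_pdivrMr ?exprn_gt0 ?ltr_pwDl// mul1r; nra.
have i1 : leb.-integrable D (EFin \o (fun t => f t (fun x => a * w x))).
  apply/integrableP; split; first by apply/measurable_EFinP; exact: (Lp_measurable fL).
  apply: le_lt_trans fint; apply: ge0_le_lower_integral => t; rewrite /= in_itv/= => tD.
    by rewrite lee_fin.
  apply: (@le_trans _ _ (fine (dualn (f t)))%:E); last by rewrite -(dual_normK (Hf t tD)).
  rewrite /= lee_fin.
  exact: (dual_norm_apply (dual_norm_le_fine (Hf t tD)) Haw aw1).
apply: eq_integrable (integrableZl mD a^-1 i1) => // t; rewrite inE/= in_itv/= => tD.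
have [lin _] := Hf t tD.
by rewrite (functional_scale mO lin)// -EFinM mulrA mulVf ?mul1r// gt_eqF.
Qed.

Definition time_normsq f : R := fine (\int[leb]_(t in D) (dualn (f t) ^+ 2)).

Section square.
Variable f : R -> (E -> R) -> R.
Hypothesis fL : Lp_Hms Omega lam phi s T 2 f.

Let Hf t : 0 < t < T -> HmsO (f t). Proof. by have [+ _ _] := fL; exact. Qed.

Let mD : measurable D. Proof. by []. Qed.

Let mf k : measurable_fun D (fun t => f t (phi k)).
Proof. exact: (Lp_measurable fL (Hs_phi lam s Lphi ortho k)). Qed.

Lemma time_normsqE : (time_normsq f)%:E = (\int[leb]_(t in D) (dualn (f t) ^+ 2))%E.
Proof.
have [_ _ fint] := fL; rewrite fineK// ge0_fin_numE//.
by apply: integral_ge0 => t _; rewrite expe_ge0// dual_norm_ge0.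
Qed.

(** Bessel's inequality at each time; comparing integrals through [ge0_le_lower_integral] requires
    no measurability of the dual norm in time. *)
Lemma time_bessel_integral m :
  (\int[leb]_(t in D) (\sum_(k < m) (wtk k)^-1 * f t (phi k) ^+ 2)%:E <= (time_normsq f)%:E)%E.
Proof.
rewrite time_normsqE; apply: ge0_le_lower_integral => t; rewrite /= in_itv/= => tD.
  by rewrite lee_fin sumr_ge0// => k _; rewrite mulr_ge0 ?sqr_ge0 ?invr_ge0 ?wt_ge0.
apply: (@le_trans _ _ (fine (dualn (f t)) ^+ 2)%:E); last by rewrite EFin_expe -(dual_normK (Hf tD)).
rewrite lee_fin.
have [lin _] := Hf tD; exact: (bessel mO Lphi ortho lin (dual_norm_le_fine (Hf tD))).
Qed.

Lemma square_integrable_mode k : leb.-integrable D (EFin \o (fun t => f t (phi k) ^+ 2)).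
Proof.
have [k0|k0] := eqVneq (wtk k) 0.
  apply: eq_integrable (integrable0 leb D) => // t; rewrite inE/= in_itv/= => tD.
  have [lin _] := Hf tD.
  by rewrite (functional_phi0 mO Lphi ortho lin (dual_norm_le_fine (Hf tD)) k0) expr0n.
have i1 : leb.-integrable D (EFin \o (fun t => (wtk k)^-1 * f t (phi k) ^+ 2)).
  apply/integrableP; split.
    by apply/measurable_EFinP; apply: measurable_funM => //; exact: measurable_funX.
  apply: le_lt_trans (ltry (time_normsq f)); apply: le_trans (time_bessel_integral k.+1).
  apply: ge0_le_lower_integral => t _ //=.
  rewrite lee_fin ger0_norm; last by rewrite mulr_ge0 ?sqr_ge0 ?invr_ge0 ?wt_ge0.
  rewrite big_ord_recr/= lerDr sumr_ge0// => j _.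
  by rewrite mulr_ge0 ?sqr_ge0 ?invr_ge0 ?wt_ge0.
apply: eq_integrable (integrableZl mD (wtk k) i1) => // t _ /=.
by rewrite -EFinM mulrA divff ?mul1r.
Qed.

Lemma time_bessel m :
  \sum_(k < m) (wtk k)^-1 * \int[leb]_(t in D) (f t (phi k) ^+ 2) <= time_normsq f.
Proof.
have i1 k : leb.-integrable D (EFin \o (fun t => (wtk k)^-1 * f t (phi k) ^+ 2)).
  exact: (integrableZl mD _ (square_integrable_mode k)).
have [iS <-] : leb.-integrable D (EFin \o (fun t => \sum_(k < m) (wtk k)^-1 * f t (phi k) ^+ 2)) /\
    \int[leb]_(t in D) (\sum_(k < m) (wtk k)^-1 * f t (phi k) ^+ 2) =
    \sum_(k < m) (wtk k)^-1 * \int[leb]_(t in D) (f t (phi k) ^+ 2).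
  elim: m => [|m [iS IH]].
    split; first by apply: eq_integrable (integrable0 leb D) => // t _; rewrite /= big_ord0.
    by rewrite big_ord0; under eq_Rintegral do rewrite big_ord0; rewrite Rintegral_cst// mul0r.
  split.
    by apply: eq_integrable (integrableD mD iS (i1 m)) => // t _; rewrite /= big_ord_recr.
  under eq_Rintegral do rewrite big_ord_recr/=.
  rewrite RintegralD// IH big_ord_recr/= RintegralZl//; exact: square_integrable_mode.
rewrite -lee_fin (le_trans _ (time_bessel_integral m))// /Rintegral fineK//.
exact: (integrable_fin_num mD iS).
Qed.

Hypothesis T0 : 0 < T.

Let lebD : leb D = T%:E.
Proof. by rewrite lebesgue_measure_itv/= lte_fin T0 sube0. Qed.

Let icst (a : R) : leb.-integrable D (EFin \o cst a).
Proof.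
apply/integrableP; split; first by apply/measurable_EFinP; exact: measurable_cst.
rewrite [ltLHS](_ : _ = \int[leb]_(t in D) (`|a|%:E))%E; last exact: eq_integral.
by rewrite integral_cst//= lebD -EFinM ltry.
Qed.

Lemma L2_mode_integrable k : leb.-integrable D (EFin \o (fun t => f t (phi k))).
Proof.
have i1 : leb.-integrable D (EFin \o (fun t => 1 + f t (phi k) ^+ 2)).
  exact: (integrableD mD (icst 1) (square_integrable_mode k)).
apply: (integrable_dominated mD (mf k) i1) => t _.
by rewrite -(real_normK (num_real (f t (phi k)))); move: (`|_|) => y; nra.
Qed.

(** Cauchy-Schwarz on ]0, T[, from the nonnegativity of the variance of |f|. *)
Lemma integral_norm_sqr_le k : (\int[leb]_(t in D) `|f t (phi k)|) ^+ 2 <=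
  T * \int[leb]_(t in D) (f t (phi k) ^+ 2).
Proof.
have i1 := integrable_norm (L2_mode_integrable k); have i2 := square_integrable_mode k.
set I := \int[leb]_(t in D) _; set J := \int[leb]_(t in D) _.
have : 0 <= \int[leb]_(t in D) (`|f t (phi k)| - T^-1 * I) ^+ 2.
  by apply: Rintegral_ge0 => t _; rewrite sqr_ge0.
have i3 : leb.-integrable D (EFin \o (fun t => (- (2 * (T^-1 * I))) * `|f t (phi k)|)).
  exact: (integrableZl mD _ i1).
have -> : \int[leb]_(t in D) (`|f t (phi k)| - T^-1 * I) ^+ 2 =
    \int[leb]_(t in D) (f t (phi k) ^+ 2 + (- (2 * (T^-1 * I))) * `|f t (phi k)| + (T^-1 * I) ^+ 2).
  by apply: eq_Rintegral => t _; rewrite -(real_normK (num_real (f t (phi k)))); ring.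
rewrite RintegralD//; [|exact: (integrableD mD i2 i3)|exact: icst].
rewrite RintegralD// RintegralZl// -/I -/J Rintegral_cst//= lebD/=.
clear i3; move: I J => I J H; rewrite -subr_ge0.
have -> : T * J - I ^+ 2 = T * (J + - (2 * (T^-1 * I)) * I + (T^-1 * I) ^+ 2 * T).
  by field; rewrite gt_eqF.
by rewrite mulr_ge0// ltW.
Qed.

Lemma time_bessel_L1 m :
  \sum_(k < m) (wtk k)^-1 * (\int[leb]_(t in D) `|f t (phi k)|) ^+ 2 <= T * time_normsq f.
Proof.
apply: (@le_trans _ _ (T * \sum_(k < m) (wtk k)^-1 * \int[leb]_(t in D) (f t (phi k) ^+ 2))).
  rewrite mulr_sumr; apply: ler_sum => k _; rewrite [leRHS]mulrCA.
  by rewrite ler_wpM2l ?invr_ge0 ?wt_ge0 ?integral_norm_sqr_le.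
rewrite ler_pM2l//; exact: time_bessel.
Qed.

End square.

End time_dependent.

(** * The residual as a functional determined by its modes *)

Section residual_functional.
Context {R : realType} {n : nat}.
Local Notation E := 'rV[R]_n.
Local Notation mR := (measurableTypeR R).
Local Notation leb := (@lebesgue_measure R).
Variables (Omega : set E) (lam : nat -> R) (phi : nat -> E -> R) (s : R).
Hypothesis mO : measurable Omega.
Hypothesis Lphi : forall k, L2 Omega (phi k).
Local Notation dot := (L2dot Omega).
Hypothesis ortho : forall i j, dot (phi i) (phi j) = (i == j)%:R.
Hypothesis complete : forall w, L2 Omega w ->
  L2normsq Omega (fun x => w x - \sum_(k < m) dot w (phi k) * phi k x)
    @[m --> \oo] --> 0%E.
Variables (T g : R).
Hypotheses (T0 : 0 < T) (g_gt0 : 0 < g) (g_lt1 : g < 1).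
Local Notation D := (`]0, T[%classic : set mR).
Local Notation HsO := (Hs Omega lam phi s).
Local Notation HsqO := (Hsq Omega lam phi s).
Local Notation HmsO := (Hms Omega lam phi s).
Local Notation dualn := (dual_norm Omega lam phi s).
Local Notation wtk := (wt lam s).
Local Notation cmb := (comb phi).
Local Notation prj := (proj Omega phi).
Implicit Types (w v : E -> R).

Let g'0 : 0 < 1 - g. Proof. by rewrite subr_gt0. Qed.
Let expE : - g = 1 - g - 1. Proof. by ring. Qed.

Lemma proj_dot_cvg v w : L2 Omega v -> L2 Omega w -> dot v (prj w m) @[m --> \oo] --> dot v w.
Proof.
move=> Lv Lw; have Lp m : L2 Omega (prj w m) by exact: L2_phi_comb.
pose d m := fun x => w x - \sum_(k < m) dot w (phi k) * phi k x.
have dE m : d m = (fun x => (-1) * prj w m x + w x).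
  by apply/funext => x; rewrite /d mulN1r addrC.
have Ld m : L2 Omega (d m) by rewrite dE; exact: L2_lin.
have dotE m : dot v (d m) = dot v w - dot v (prj w m).
  by rewrite dE (L2dot_linr mO _ (Lp m) Lw Lv) mulN1r addrC.
apply/subr_cvg0/norm_cvg0P; rewrite -[X in _ --> X](@sqrtr0 R).
rewrite (_ : (fun m => _) = (fun m => Num.sqrt (dot v (d m) ^+ 2))); last first.
  by apply/funext => m; rewrite sqrtr_sqr dotE distrC.
apply: continuous_cvg; first exact: sqrt_continuous.
apply: (@squeeze_cvgr _ _ _ _ (cst 0) (fun m => dot v v * fine (L2normsq Omega (d m)))).
- by near=> m; rewrite sqr_ge0/= L2normsqE//; exact: L2_cauchy_schwarz.
- exact: cvg_cst.
- rewrite -[X in _ --> X](mulr0 (dot v v)); apply: cvgMr.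
  exact: (@fine_cvg _ _ _ _ (fun m => L2normsq Omega (d m)) 0 (complete Lw)).
Unshelve. all: by end_near. Qed.

Lemma integrable_ae_dominated (J : set mR) (F h : R -> R) : measurable J -> measurable_fun J F ->
  leb.-integrable J (EFin \o h) -> {ae leb, forall r, J r -> `|F r| <= h r} ->
  leb.-integrable J (EFin \o F).
Proof.
move=> mJ mF ih Fh; have /integrableP[mh hfin] := ih.
apply/integrableP; split; first exact/measurable_EFinP.
apply: le_lt_trans hfin; apply: ae_ge0_le_integral => //.
- by apply: measurableT_comp => //; exact/measurable_EFinP.
- exact: measurableT_comp.
- by apply: ae_imp Fh => r H /H Fr; rewrite /= lee_fin (le_trans Fr)// ler_norm.
Qed.

Variables (u0 : E -> R) (u : R -> E -> R) (du : R -> (E -> R) -> R).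
Hypothesis Lu : forall t, 0 <= t <= T -> L2 Omega (u t).
Hypothesis duL : Lp_Hms Omega lam phi s T 1 du.
Hypothesis u_primitive : forall t, 0 <= t <= T -> forall w, HsO w ->
  of_L2 Omega (u t) w = of_L2 Omega u0 w + \int[leb]_(r in `]0, t[) du r w.

Let du_Hms t : 0 < t < T -> HmsO (du t). Proof. by have [+ _ _] := duL; exact. Qed.

Section scheme.
Variables (tau : R) (K i : nat).
Hypotheses (iK : (i < K)%N) (tau0 : 0 < tau) (KT : K%:R * tau = T).

Let t_in j : (j <= i.+1)%N -> 0 <= j%:R * tau <= T.
Proof.
move=> ji; rewrite mulr_ge0 ?(ltW tau0)//= -KT ler_pM2r// ler_nat.
exact: leq_trans iK.
Qed.

Let incr j x := u ((i.+1 - j)%N%:R * tau) x - u ((i - j)%N%:R * tau) x.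

Let coef j := (Gamma (2 - g))^-1 *
  ((j.+1%:R `^ (1 - g) - j%:R `^ (1 - g)) / tau `^ g).

Let L2_incr j : L2 Omega (incr j).
Proof.
rewrite (_ : incr j = (fun x => (-1) * u ((i - j)%N%:R * tau) x + u ((i.+1 - j)%N%:R * tau) x)).
  apply: L2_lin => //; apply: Lu; apply: t_in; first by rewrite leqW// leq_subr.
  exact: leq_subr.
by apply/funext => x; rewrite mulN1r addrC.
Qed.

Let schemeE : L1_scheme g tau u i = (fun x => \sum_(j < i.+1) coef j * incr j x).
Proof.
apply/funext => x; rewrite /L1_scheme mulr_sumr; apply: eq_bigr => j _.
by rewrite /coef /incr -!mulrA; congr (_ * (_ * _)); rewrite mulrC.
Qed.

Lemma L1_scheme_L2 : L2 Omega (L1_scheme g tau u i).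
Proof. by rewrite schemeE; exact: L2_comb. Qed.

(** The increments of u, tested with w, are integrals of du over the steps; this is the scalar form
    treated in [residual_sum]. *)
Lemma L1_scheme_dot w : HsO w ->
  dot (L1_scheme g tau u i) w = (Gamma (2 - g))^-1 *
   \sum_(j < i.+1) (j.+1%:R `^ (1 - g) - j%:R `^ (1 - g)) *
    ((\int[leb]_(r in `](i - j)%N%:R * tau, (i - j)%N.+1%:R * tau[) du r w) / tau `^ g).
Proof.
move=> Hw; have Lw := Hs_L2 Hw; rewrite schemeE L2dot_comb// mulr_sumr.
apply: eq_bigr => j _; have ji : (j <= i)%N by rewrite -ltnS.
have -> : dot (incr j) w = \int[leb]_(r in `](i - j)%N%:R * tau, (i - j)%N.+1%:R * tau[) du r w.
  have /andP[p0 _] := t_in (leqW (leq_subr j i)).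
  have /andP[_ qT] := t_in (leq_subr j i.+1).
  have L1 := Lu (t_in (leqW (leq_subr j i))); have L2' := Lu (t_in (leq_subr j i.+1)).
  rewrite (_ : incr j = (fun x => (-1) * u ((i - j)%N%:R * tau) x + u ((i.+1 - j)%N%:R * tau) x)).
    rewrite L2dot_linl// -/(of_L2 Omega (u _) w) -/(of_L2 Omega (u ((i.+1 - j)%N%:R * tau)) w).
    rewrite !u_primitive//; [|exact: t_in (leq_subr _ _)|exact: t_in (leqW (leq_subr _ _))].
    have st : (i - j)%N%:R * tau <= (i.+1 - j)%N%:R * tau.
      by rewrite ler_pM2r// ler_nat leq_sub2r.
    have := prefix_diff p0 st qT (L1_integrable mO Lphi duL Hw).
    by rewrite -subSn// => <-; ring.
  by apply/funext => x; rewrite mulN1r addrC.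
by rewrite /coef -!mulrA; congr (_ * (_ * _)); rewrite mulrC.
Qed.

End scheme.

Variable M : nat -> R.
Hypothesis M_ge0 : forall k, 0 <= M k.
Hypothesis du_le : forall k, {ae leb, forall r, 0 < r < T -> `|du r (phi k)| <= M k * r `^ (g - 1)}.

Let sub_in t r : t <= T -> r \in `]0, t[ -> 0 < r < T.
Proof. by move=> tT; rewrite in_itv/= => /andP[-> rt] /=; exact: lt_le_trans tT. Qed.

Lemma measurable_caputo t w : t <= T -> HsO w ->
  measurable_fun (`]0, t[ : set mR) (fun r => (t - r) `^ (- g) * du r w).
Proof.
move=> tT Hw; apply: measurable_funM; first exact: measurable_kernel.
apply: measurable_funS (Lp_measurable mO Lphi duL Hw) => //.
by apply: subset_itvl; rewrite bnd_simp.
Qed.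

Lemma integrable_caputo_weight t (a : R) : 0 < t ->
  leb.-integrable `]0, t[ (EFin \o (fun r => (t - r) `^ (- g) * (a * r `^ (g - 1)))).
Proof.
move=> t0; have mI : measurable (`]0, t[ : set mR) by [].
apply: eq_integrable (integrableZl mI a (integrable_Beta g'0 g_gt0 t0)) => // r _ /=.
by rewrite -EFinM -expE mulrCA.
Qed.

Lemma integrable_caputo_phi t k : 0 < t -> t <= T ->
  leb.-integrable `]0, t[ (EFin \o (fun r => (t - r) `^ (- g) * du r (phi k))).
Proof.
move=> t0 tT; apply: (integrable_ae_dominated _ _ (integrable_caputo_weight (M k) t0)) => //.
  by apply: measurable_caputo => //; exact: Hs_phi.
apply: ae_imp (du_le k) => r H rt; rewrite normrM ger0_norm ?powR_ge0//.
by apply: ler_wpM2l; [exact: powR_ge0|apply: H; exact: (sub_in tT rt)].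
Qed.

Lemma caputo_comb t c m : 0 < t -> t <= T ->
  caputo g du t (cmb c m) = \sum_(k < m) c k * caputo g du t (phi k).
Proof.
move=> t0 tT; have mI : measurable (`]0, t[ : set mR) by [].
have E : \int[leb]_(r in `]0, t[) ((t - r) `^ (- g) * du r (cmb c m)) =
    \int[leb]_(r in `]0, t[) (\sum_(k < m) c k * ((t - r) `^ (- g) * du r (phi k))).
  apply: eq_Rintegral => r; rewrite inE/= => /(sub_in tT) rT.
  have [lin _] := du_Hms rT.
  rewrite (functional_comb mO Lphi ortho lin) mulr_sumr.
  by apply: eq_bigr => k _; rewrite mulrCA.
have i1 k : leb.-integrable `]0, t[ (EFin \o (fun r => c k * ((t - r) `^ (- g) * du r (phi k)))).
  exact: (integrableZl mI (c k) (integrable_caputo_phi k t0 tT)).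
rewrite /caputo E; under [in RHS]eq_bigr do rewrite mulrCA.
rewrite -mulr_sumr; congr (_ * _).
have [] : leb.-integrable `]0, t[ (EFin \o (fun r => \sum_(k < m) c k * ((t - r) `^ (- g) * du r (phi k)))) /\
    \int[leb]_(r in `]0, t[) (\sum_(k < m) c k * ((t - r) `^ (- g) * du r (phi k))) =
    \sum_(k < m) c k * \int[leb]_(r in `]0, t[) ((t - r) `^ (- g) * du r (phi k)); last by [].
elim: m {E} => [|m [iS IH]].
  split; first by apply: eq_integrable (integrable0 leb _) => // r _; rewrite /= big_ord0.
  by rewrite big_ord0; under eq_Rintegral do rewrite big_ord0; rewrite Rintegral_cst// mul0r.
split.
  by apply: eq_integrable (integrableD mI iS (i1 m)) => // r _; rewrite /= big_ord_recr.
under eq_Rintegral do rewrite big_ord_recr/=.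
by rewrite RintegralD// IH big_ord_recr/= RintegralZl//; exact: integrable_caputo_phi.
Qed.

Variable Q : R.
Hypothesis M_le : forall m, \sum_(k < m) (wtk k)^-1 * M k ^+ 2 <= Q.

(** Young's inequality in each mode gives a majorant independent of the number of modes; the
    countably many exceptional null sets of [du_le] are merged into one. *)
Lemma du_proj_le w : HsO w -> {ae leb, forall r, 0 < r < T -> forall m,
  `|du r (prj w m)| <= (2^-1 * fine (HsqO w) + 2^-1 * Q) * r `^ (g - 1)}.
Proof.
move=> Hw; have := ae_foralln du_le; apply: ae_imp => r H rT m.
have [lin _] := du_Hms rT.
rewrite /proj (functional_comb mO Lphi ortho lin) (le_trans (ler_norm_sum _ _ _))//.
apply: (@le_trans _ _ (\sum_(k < m) (2^-1 * (wtk k * dot w (phi k) ^+ 2) +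
    2^-1 * ((wtk k)^-1 * M k ^+ 2)) * r `^ (g - 1))).
  apply: ler_sum => k _; have r0 : 0 <= r `^ (g - 1) by exact: powR_ge0.
  have [k0|k0] := eqVneq (wtk k) 0.
    rewrite (functional_phi0 mO Lphi ortho lin (dual_norm_le_fine mO (du_Hms rT)) k0).
    by rewrite k0 invr0 !(mul0r, mulr0, addr0) normr0.
  have {}k0 : 0 < wtk k by rewrite lt_def k0 wt_ge0.
  rewrite normrM (le_trans (ler_wpM2l (normr_ge0 _) (H k rT)))// (mulrA `|_|).
  apply: ler_wpM2r => //; rewrite -(real_normK (num_real (dot w (phi k)))).
  move: (wtk k) k0 (`|dot w (phi k)|) (M k) => y y0 p z; rewrite -subr_ge0.
  have -> : 2^-1 * (y * p ^+ 2) + 2^-1 * (y^-1 * z ^+ 2) - p * z =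
    2^-1 * y^-1 * (y * p - z) ^+ 2 by field; rewrite gt_eqF.
  by rewrite mulr_ge0 ?sqr_ge0// mulr_ge0// invr_ge0 ltW.
rewrite -mulr_suml; apply: ler_wpM2r; first exact: powR_ge0.
rewrite big_split/= -!mulr_sumr; apply: lerD; apply: ler_wpM2l => //; last exact: M_le.
rewrite -lee_fin (fineK (Hsq_fin Hw)) -sumEFin.
rewrite -(big_mkord xpredT (fun k => (wtk k * dot w (phi k) ^+ 2)%:E)).
by apply: nneseries_lim_ge => k _ _; rewrite lee_fin mulr_ge0 ?wt_ge0 ?sqr_ge0.
Qed.

(** Integrability of du in time alone does not control the singular integral at a fixed t. The modal
    decay r^(g-1) provides a majorant integrable against (t - r)^(-g), and dominated convergence
    applies. *)
Lemma caputo_proj_cvg t w : 0 < t -> t <= T -> HsO w ->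
  caputo g du t (prj w m) @[m --> \oo] --> caputo g du t w.
Proof.
move=> t0 tT Hw; apply: cvgMr.
have mI : measurable (`]0, t[ : set mR) by [].
pose a := 2^-1 * fine (HsqO w) + 2^-1 * Q.
have Hp m : HsO (prj w m) by exact: Hs_comb.
have [] := @dominated_convergence _ _ _ leb `]0, t[ mI
  (fun m r => ((t - r) `^ (- g) * du r (prj w m))%:E) (fun r => ((t - r) `^ (- g) * du r w)%:E)
  (EFin \o (fun r => (t - r) `^ (- g) * (a * r `^ (g - 1)))).
- by move=> m; apply/measurable_EFinP; exact: measurable_caputo.
- by apply/measurable_EFinP; exact: measurable_caputo.
- apply: aeT => r /(sub_in tT) rT; apply: cvg_EFin; first by near=> m.
  apply: cvgMr; have [lin _] := du_Hms rT.
  exact: (functional_proj_cvg mO Lphi ortho lin (dual_norm_le_fine mO (du_Hms rT))).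
- exact: integrable_caputo_weight.
- apply: ae_imp (du_proj_le Hw) => r H m /(sub_in tT) rT.
  rewrite /= lee_fin normrM ger0_norm ?powR_ge0//.
  by apply: ler_wpM2l; [exact: powR_ge0|exact: H].
move=> ih _; rewrite -(fineK (integrable_fin_num _ ih))//.
by move=> /fine_cvgP[].
Unshelve. all: by end_near. Qed.

Lemma residual_phi0 tau K i k : (i < K)%N -> 0 < tau -> K%:R * tau = T -> wtk k = 0 ->
  residual Omega g tau u du i (phi k) = 0.
Proof.
move=> iK tau0 KT k0.
have du0 r : 0 < r < T -> du r (phi k) = 0.
  move=> rT; have [lin _] := du_Hms rT.
  exact: (functional_phi0 mO Lphi ortho lin (dual_norm_le_fine mO (du_Hms rT)) k0).
have iT : i.+1%:R * tau <= T by rewrite -KT ler_pM2r// ler_nat.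
rewrite /residual /of_L2 (L1_scheme_dot iK tau0 KT) //; last exact: Hs_phi.
rewrite big1 => [|j _]; last first.
  have -> : \int[leb]_(r in `](i - j)%N%:R * tau, (i - j)%N.+1%:R * tau[) du r (phi k) =
      \int[leb]_(r in `](i - j)%N%:R * tau, (i - j)%N.+1%:R * tau[) 0.
    apply: eq_Rintegral => r; rewrite inE/= in_itv/= => /andP[r1 r2]; apply: du0.
    rewrite (le_lt_trans _ r1) ?mulr_ge0 ?(ltW tau0)//= (lt_le_trans r2)//.
    by rewrite (le_trans _ iT)// ler_pM2r// ler_nat ltnS leq_subr.
  by rewrite Rintegral_cst// mul0r mul0r mulr0.
rewrite mulr0 subr0 /caputo.
have -> : \int[leb]_(r in `]0, i.+1%:R * tau[) ((i.+1%:R * tau - r) `^ (- g) * du r (phi k)) =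
    \int[leb]_(r in `]0, i.+1%:R * tau[) 0.
  by apply: eq_Rintegral => r; rewrite inE/= => /(sub_in iT) rT; rewrite du0// mulr0.
by rewrite Rintegral_cst// mul0r mulr0.
Qed.

Lemma residual_dual_norm tau K i q : (i < K)%N -> 0 < tau -> K%:R * tau = T -> 0 <= q ->
  (forall m, \sum_(k < m) (wtk k)^-1 * residual Omega g tau u du i (phi k) ^+ 2 <= q ^+ 2) ->
  (dualn (residual Omega g tau u du i) <= q%:E)%E.
Proof.
move=> iK tau0 KT q0 Hq.
have iT : i.+1%:R * tau <= T by rewrite -KT ler_pM2r// ler_nat.
have i0 : 0 < i.+1%:R * tau by rewrite mulr_gt0// ltr0n.
have Ls := L1_scheme_L2 iK tau0 KT.
apply: (dual_norm_le q0 _ _ _ Hq).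
- move=> w Hw; apply: cvgB; first exact: caputo_proj_cvg.
  by apply: proj_dot_cvg => //; exact: Hs_L2 Hw.
- move=> c m; rewrite /residual caputo_comb// /of_L2 L2dotC /comb L2dot_comb//.
  rewrite -sumrB; apply: eq_bigr => k _.
  by rewrite (L2dotC _ (L1_scheme _ _ _ _)) mulrBr.
- by move=> k; exact: (residual_phi0 iK tau0 KT).
Qed.

End residual_functional.

(** * Finite sums and monotone limits *)

Section real_sums.
Context {R : realType}.
Implicit Types (X : nat -> nat -> R).

(** Combined with the factor tau of the discrete norm, this comparison of l^2 with l^1 over the time
    levels is the source of the rate tau^(1/2). *)
Lemma sum_sqr_le (x : nat -> R) K : \sum_(i < K) x i ^+ 2 <= (\sum_(i < K) `|x i|) ^+ 2.
Proof.
elim: K => [|K IH]; first by rewrite !big_ord0 expr0n.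
rewrite !big_ord_recr/= -[x K ^+ 2]real_normK ?num_real//.
have : 0 <= \sum_(i < K) `|x i| by apply: sumr_ge0.
move: IH; move: (\sum_(i < K) _) (\sum_(i < K) _) (normr_ge0 (x K)) => p q.
by move: (`|x K|) => z z0 pq q0; rewrite sqrrD -addrA lerD// lerDr mulrn_wge0// mulr_ge0.
Qed.

(** Monotone limits commute with the finite sum over i, so a bound uniform in m on the double sums
    passes to the sum of the full series; these bound the squared dual norms level by level. *)
Lemma limits_of_partial_sums X K (B : R) : (forall i k, 0 <= X i k) ->
  (forall m, \sum_(i < K) \sum_(k < m) X i k <= B) ->
  exists2 L : nat -> R, forall i, (i < K)%N -> forall m, \sum_(k < m) X i k <= L i &
    \sum_(i < K) L i <= B.
Proof.
move=> X0 XB; pose S i m := \sum_(k < m) X i k.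
have S_nd i : {homo S i : p q / (p <= q)%N >-> p <= q}.
  apply: homo_leq => [//|p q r|m]; first exact: le_trans.
  by rewrite /S big_ord_recr/= lerDl.
have S_cvg i : (i < K)%N -> cvgn (S i).
  move=> iK; apply: nondecreasing_is_cvgn; first exact: S_nd.
  exists B => _ [m _ <-]; apply: le_trans (XB m).
  rewrite (bigD1 (Ordinal iK))//= lerDl; apply: sumr_ge0 => j _.
  by apply: sumr_ge0.
exists (fun i => limn (S i)).
  by move=> i iK m; apply: nondecreasing_cvgn_le; [exact: S_nd|exact: S_cvg].
have c : forall j, (j <= K)%N -> \sum_(i < j) S i m @[m --> \oo] --> \sum_(i < j) limn (S i).
  elim=> [_|j IH jK].
    by under eq_fun do rewrite big_ord0; rewrite big_ord0; exact: cvg_cst.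
  under eq_fun do rewrite big_ord_recr/=.
  by rewrite big_ord_recr/=; apply: cvgD; [apply: IH; exact: ltnW|exact: S_cvg].
rewrite -(cvg_lim (@Rhausdorff _) (c K (leqnn K))); apply: limr_le.
  by apply/cvg_ex; eexists; exact: (c K (leqnn K)).
by apply: nearW => m; exact: XB.
Qed.

End real_sums.

(** * Summation over all modes *)

Section residual_estimate.
Context {R : realType} {n : nat}.
Local Notation E := 'rV[R]_n.
Local Notation mR := (measurableTypeR R).
Local Notation leb := (@lebesgue_measure R).
Variables (Omega : set E) (lam : nat -> R) (phi : nat -> E -> R) (s : R).
Hypothesis mO : measurable Omega.
Hypothesis Lphi : forall k, L2 Omega (phi k).
Local Notation dot := (L2dot Omega).
Hypothesis ortho : forall i j, dot (phi i) (phi j) = (i == j)%:R.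
Hypothesis complete : forall w, L2 Omega w ->
  L2normsq Omega (fun x => w x - \sum_(k < m) dot w (phi k) * phi k x)
    @[m --> \oo] --> 0%E.
Variables (T g : R).
Hypotheses (T0 : 0 < T) (g_gt0 : 0 < g) (g_lt1 : g < 1).
Local Notation D := (`]0, T[%classic : set mR).
Local Notation HsO := (Hs Omega lam phi s).
Local Notation HsqO := (Hsq Omega lam phi s).
Local Notation dualn := (dual_norm Omega lam phi s).
Local Notation wtk := (wt lam s).
Local Notation normsq := (time_normsq Omega lam phi s T).
Variables (u0 : E -> R) (f f1 f2 : R -> (E -> R) -> R)
  (u : R -> E -> R) (du : R -> (E -> R) -> R).
Hypothesis Hu0 : HsO u0.
Hypothesis sol : solves Omega lam phi s g T u0 f u du.
Hypotheses (fL : Lp_Hms Omega lam phi s T 2 f) (f1L : Lp_Hms Omega lam phi s T 2 f1)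
  (f2L : Lp_Hms Omega lam phi s T 2 f2).
Hypotheses (wf : weak_time_derivative Omega lam phi s T f f1)
  (wf1 : weak_time_derivative Omega lam phi s T f1 f2).

Let Lu t : 0 <= t <= T -> L2 Omega (u t). Proof. by case: sol => -[_ +] _ _ _; exact. Qed.

Let duL : Lp_Hms Omega lam phi s T 1 du. Proof. by case: sol. Qed.

Let u_primitive t : 0 <= t <= T -> forall w, HsO w ->
  of_L2 Omega (u t) w = of_L2 Omega u0 w + \int[leb]_(r in `]0, t[) du r w.
Proof. by case: sol => _ _ + _; exact. Qed.

Let Hphi k : HsO (phi k). Proof. exact: Hs_phi. Qed.

Definition data_sq : R := fine (HsqO u0) + (normsq f + normsq f1 + normsq f2).

Definition mode_amplitude k : R := mode_const g T *
  mode_data T (wtk k) (dot u0 (phi k)) (fun t => f t (phi k)) (fun t => f1 t (phi k))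
    (fun t => f2 t (phi k)).

Lemma Ls_phi w k : Ls Omega lam phi s w (phi k) = wtk k * dot w (phi k).
Proof.
rewrite /Ls; apply: cvg_lim => //; apply: cvg_near_cst; near=> m.
have km : (k < m)%N by near: m; exact: nbhs_infty_gt.
rewrite /series/= big_mkord (bigD1 (Ordinal km))//= ortho eqxx mulr1 big1 ?addr0//.
by move=> j jk; rewrite ortho -val_eqE/= in jk *; rewrite eq_sym (negbTE jk) mulr0.
Unshelve. all: by end_near. Qed.

(** Testing with the eigenfunction diagonalises [Ls], and the coefficient of u(t) is rewritten as
    its initial value plus the integral of du. *)
Lemma mode_equation k : {ae leb, forall t, 0 < t < T ->
  (Gamma (1 - g))^-1 * \int[leb]_(r in `]0, t[) ((t - r) `^ (- g) * du r (phi k)) +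
  wtk k * (dot u0 (phi k) + \int[leb]_(r in `]0, t[) du r (phi k)) = f t (phi k)}.
Proof.
have [_ _ _ eqn] := sol; apply: ae_imp eqn => t H tT; have [_ eqt] := H tT.
have /andP[t0 tT'] := tT.
rewrite -(eqt _ (Hphi k)) /caputo Ls_phi; congr (_ + _ * _).
by rewrite -/(of_L2 Omega (u t) (phi k)) u_primitive// (ltW t0) ltW.
Qed.

Lemma mode_bounds k :
  {ae leb, forall r, 0 < r < T -> `|du r (phi k)| <= mode_amplitude k * r `^ (g - 1)} /\
  forall K tau, (0 < K)%N -> 0 < tau -> K%:R * tau = T ->
    \sum_(i < K) `|residual Omega g tau u du i (phi k)| <=
    (Gamma (1 - g))^-1 * (scheme_const g * mode_amplitude k).
Proof.
have [H1 H2] := mode_estimate g_gt0 g_lt1 T0 (wt_ge0 lam s k)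
  (L1_integrable mO Lphi duL (Hphi k)) (L2_mode_integrable mO Lphi ortho fL T0 k)
  (L2_mode_integrable mO Lphi ortho f1L T0 k) (L2_mode_integrable mO Lphi ortho f2L T0 k)
  (mode_equation k) (fun psi tp => wf tp (Hphi k)) (fun psi tp => wf1 tp (Hphi k)).
split; first exact: H1.
move=> K tau K0 tau0 KT; apply: le_trans (H2 K tau K0 tau0 KT); apply: ler_sum => i _.
by rewrite /residual /of_L2 (L1_scheme_dot mO Lphi g Lu duL u_primitive (ltn_ord i) tau0 KT (Hphi k)).
Qed.

Lemma time_normsq_ge0 h : 0 <= normsq h.
Proof.
by apply: fine_ge0; apply: integral_ge0 => t _; rewrite expe_ge0// dual_norm_ge0.
Qed.

Lemma data_sq_ge0 : 0 <= data_sq.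
Proof. by rewrite /data_sq !addr_ge0 ?time_normsq_ge0// fine_ge0// Hsq_ge0. Qed.

(** The square of a sum of four terms is at most four times the sum of the squares. The initial
    datum enters as wt_k^(-1) (wt_k y0)^2 = wt_k y0^2, the H^s norm; the time terms are summed by
    [time_bessel_L1], which costs a factor T. *)
Lemma mode_amplitude_sum m : \sum_(k < m) (wtk k)^-1 * mode_amplitude k ^+ 2 <=
  mode_const g T ^+ 2 * (4 * (1 + T)) * data_sq.
Proof.
pose I (h : R -> (E -> R) -> R) k : R := \int[leb]_(t in D) `|h t (phi k)|.
apply: (@le_trans _ _ (\sum_(k < m) mode_const g T ^+ 2 * (4 *
   (wtk k * dot u0 (phi k) ^+ 2 + (wtk k)^-1 * I f k ^+ 2 + (wtk k)^-1 * I f1 k ^+ 2 +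
    (wtk k)^-1 * I f2 k ^+ 2)))).
  apply: ler_sum => k _; rewrite /mode_amplitude exprMn mulrCA.
  apply: ler_wpM2l; first exact: sqr_ge0.
  rewrite /mode_data -/(I f k) -/(I f1 k) -/(I f2 k).
  have w0 := wt_ge0 lam s k; rewrite -(real_normK (num_real (dot u0 (phi k)))).
  move: (wtk k) w0 (`|dot u0 (phi k)|) (I f k) (I f1 k) (I f2 k) => x x0 y a b c.
  have -> : x * y ^+ 2 = x^-1 * (x * y) ^+ 2.
    have [->|xn0] := eqVneq x 0; first by rewrite invr0 !mul0r.
    by field.
  rewrite -!mulrDr [leRHS]mulrCA; apply: ler_wpM2l; first by rewrite invr_ge0.
  move: (x * y) => z; rewrite -subr_ge0.
  have -> : 4 * (z ^+ 2 + a ^+ 2 + b ^+ 2 + c ^+ 2) - (z + a + b + c) ^+ 2 =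
    (z - a) ^+ 2 + (z - b) ^+ 2 + (z - c) ^+ 2 + (a - b) ^+ 2 + (a - c) ^+ 2 + (b - c) ^+ 2 by ring.
  by rewrite !addr_ge0// sqr_ge0.
rewrite -mulr_sumr -mulrA; apply: ler_wpM2l; first exact: sqr_ge0.
rewrite -mulr_sumr -mulrA; apply: ler_wpM2l => //.
rewrite !big_split/=.
have hu : \sum_(k < m) wtk k * dot u0 (phi k) ^+ 2 <= fine (HsqO u0).
  rewrite -lee_fin (fineK (Hsq_fin Hu0)) -sumEFin.
  rewrite -(big_mkord xpredT (fun k => (wtk k * dot u0 (phi k) ^+ 2)%:E)).
  by apply: nneseries_lim_ge => k _ _; rewrite lee_fin mulr_ge0 ?wt_ge0 ?sqr_ge0.
have b0 := time_bessel_L1 mO Lphi ortho fL T0 m.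
have b1 := time_bessel_L1 mO Lphi ortho f1L T0 m.
have b2 := time_bessel_L1 mO Lphi ortho f2L T0 m.
apply: le_trans (lerD (lerD (lerD hu b0) b1) b2) _; rewrite /data_sq.
have n0 := time_normsq_ge0 f; have n1 := time_normsq_ge0 f1; have n2 := time_normsq_ge0 f2.
have : 0 <= fine (HsqO u0) by rewrite fine_ge0// Hsq_ge0.
move: (normsq f) (normsq f1) (normsq f2) (fine _) n0 n1 n2 => x y z h x0 y0 z0 h0.
rewrite -subr_ge0 (_ : _ - _ = x + y + z + T * h); last by ring.
by rewrite !addr_ge0// mulr_ge0// ltW.
Qed.

Definition residual_const : R :=
  ((Gamma (1 - g))^-1 * scheme_const g * mode_const g T) ^+ 2 * (4 * (1 + T)).

(** For each mode the l^2 sum over the levels is bounded by its l^1 sum; exchanging the sums over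
    levels and modes gives a bound uniform in the number of modes, and [residual_dual_norm] returns
    to the dual norms. *)
Lemma residual_estimate K tau : (0 < K)%N -> 0 < tau -> K%:R * tau = T ->
  (\sum_(i < K) (tau%:E * dualn (residual Omega g tau u du i) ^+ 2) <=
   (tau * (residual_const * data_sq))%:E)%E.
Proof.
move=> K0 tau0 KT.
pose res i k := residual Omega g tau u du i (phi k).
pose c := (Gamma (1 - g))^-1 * scheme_const g.
have [|m|L LX LB] := @limits_of_partial_sums R (fun i k => (wtk k)^-1 * res i k ^+ 2) K
    (residual_const * data_sq).
- by move=> i k; rewrite mulr_ge0 ?sqr_ge0 ?invr_ge0 ?wt_ge0.
- rewrite exchange_big/=.
  apply: (@le_trans _ _ (\sum_(k < m) c ^+ 2 * ((wtk k)^-1 * mode_amplitude k ^+ 2))).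
    apply: ler_sum => k _; rewrite -mulr_sumr mulrCA.
    apply: ler_wpM2l; first by rewrite invr_ge0 wt_ge0.
    apply: le_trans (sum_sqr_le (fun i => res i k) K) _; rewrite -exprMn.
    have := (mode_bounds k).2 K tau K0 tau0 KT; rewrite mulrA => H.
    have r0 : 0 <= \sum_(i < K) `|res i k| by apply: sumr_ge0.
    by apply: lerXn2r => //; rewrite nnegrE// (le_trans r0).
  have -> : residual_const * data_sq =
      c ^+ 2 * (mode_const g T ^+ 2 * (4 * (1 + T)) * data_sq).
    by rewrite /residual_const /c; ring.
  by rewrite -mulr_sumr; apply: ler_wpM2l; [exact: sqr_ge0|exact: mode_amplitude_sum].
have dle i : (i < K)%N -> (dualn (residual Omega g tau u du i) ^+ 2 <= (L i)%:E)%E.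
  move=> iK; have L0 : 0 <= L i by have := LX i iK 0%N; rewrite big_ord0.
  have dl : (dualn (residual Omega g tau u du i) <= (Num.sqrt (L i))%:E)%E.
    apply: (residual_dual_norm mO Lphi ortho complete g_gt0 g_lt1 Lu duL u_primitive
      (fun k => (mode_bounds k).1) mode_amplitude_sum iK tau0 KT); first exact: sqrtr_ge0.
    by move=> m; rewrite sqr_sqrtr//; exact: LX.
  have d0 := dual_norm_ge0 lam phi s mO (residual Omega g tau u du i).
  apply: (@le_trans _ _ ((Num.sqrt (L i))%:E ^+ 2)%E); first by rewrite !expe2 lee_pmul.
  by rewrite -EFin_expe sqr_sqrtr.
apply: (@le_trans _ _ (\sum_(i < K) (tau * L i)%:E)%E).
  apply: lee_sum => i _; rewrite EFinM; apply: lee_wpmul2l; first by rewrite lee_fin ltW.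
  exact: dle.
by rewrite sumEFin lee_fin -mulr_sumr ler_pM2l.
Qed.

End residual_estimate.

(** * From the rate one half to every smaller exponent *)

Theorem proposition3p6 (R : realType) (n : nat) (n_ge1 : (1 <= n)%N)
    (Omega : set 'rV[R]_n)
    (Omega_open : open Omega) (Omega_bounded : bounded_set Omega)
    (Omega_connected : connected Omega)
    (Omega_polyhedral : polyhedral_boundary Omega)
    (T : R) (T_gt0 : 0 < T)
    (A : 'rV[R]_n -> 'M[R]_n) (c : 'rV[R]_n -> R)
    (Ac_admissible : admissible_coefficients Omega A c)
    (Ac_regular : H2_regular Omega A c)
    (lam : nat -> R) (phi : nat -> 'rV[R]_n -> R)
    (lam_phi : dirichlet_eigenbasis Omega A c lam phi)
    (gamma s : R) (gamma01 : 0 < gamma < 1) (s01 : 0 < s < 1) :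
  exists C : R -> R,
    (C theta @[theta --> (2^-1)^'-] --> +oo) /\
    forall theta : R, 0 < theta < 2^-1 ->
    forall (u0 : 'rV[R]_n -> R) (f : R -> ('rV[R]_n -> R) -> R)
      (u : R -> 'rV[R]_n -> R) (du : R -> ('rV[R]_n -> R) -> R),
    solves Omega lam phi s gamma T u0 f u du ->
    (data_norm Omega lam phi s T u0 f < +oo)%E ->
    forall K : nat, (0 < K)%N ->
    let tau := T / K%:R in
    (discrete_norm Omega lam phi s tau K (residual Omega gamma tau u du)
     <= (C theta * tau `^ theta)%:E * data_norm Omega lam phi s T u0 f)%E.
Proof.
have mO : measurable Omega := open_measurable_rV Omega_open.
have [Hphi ortho complete] := lam_phi.
have Lphi k : L2 Omega (phi k) by have [G [[]]] := Hphi k.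
have /andP[g_gt0 g_lt1] := gamma01.
pose rc := Num.sqrt (residual_const T gamma).
(* The first summand carries the estimate uniformly in theta; the second makes the constant tend to
   infinity at 1/2. *)
pose C (theta : R) := rc * (1 + T) + (2^-1 - theta)^-1.
have rc0 : 0 <= rc by exact: sqrtr_ge0.
exists C; split.
  apply/cvgryPge => B; near=> theta.
  have th : theta < 2^-1 by near: theta; exact: nbhs_left_lt.
  have thB : 2^-1 - (`|B| + 1)^-1 < theta.
    by near: theta; apply: nbhs_left_gt; rewrite ltrBlDr ltrDl invr_gt0 ltr_wpDl.
  have B1 : 0 < `|B| + 1 by rewrite ltr_wpDl.
  have d0 : 0 < 2^-1 - theta by rewrite subr_gt0.
  have : `|B| + 1 <= (2^-1 - theta)^-1.
    rewrite -[leLHS]invrK lef_pV2 ?posrE ?invr_gt0//.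
    by rewrite lerBlDr -lerBlDl ltW.
  have cT : 0 <= rc * (1 + T) by rewrite mulr_ge0// addr_ge0// ltW.
  rewrite /C => H; have := ler_norm B; move: (`|B|) H => b H Bb; lra.
move=> theta /andP[th0 th1] u0 f u du sol data_fin K K0; lazy zeta; set tau := T / K%:R.
have tau0 : 0 < tau by rewrite divr_gt0// ltr0n.
have KT : K%:R * tau = T by rewrite mulrC divfK// pnatr_eq0 -lt0n.
have tauT : tau <= T by rewrite -[leRHS]KT; apply: ler_peMl; rewrite ?ler1n//; exact: ltW.
have H2_ge0 : (0 <= H2T_norm Omega lam phi s T f)%E.
  by apply: le_ereal_inf_tmp => _ [f1 [f2 [_ [_ _ ->]]]]; exact: poweR_ge0.
have Hs0_ge0 : (0 <= Hs_norm Omega lam phi s u0)%E by exact: poweR_ge0.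
have Hu0 : Hs Omega lam phi s u0.
  split; first by have [[]] := sol.
  by apply: le_lt_trans data_fin; rewrite leeDl.
have d0 : 0 < 2^-1 - theta by rewrite subr_gt0.
(* Write tau^(1/2) = tau^(1/2 - theta) tau^theta; since tau <= T, the first factor is at most (1 +
   T)^(1/2 - theta), hence at most 1 + T. *)
have rate : Num.sqrt tau * rc <= C theta * tau `^ theta.
  have -> : Num.sqrt tau = tau `^ (2^-1 - theta) * tau `^ theta.
    by rewrite -powRD ?subrK ?powR12_sqrt ?ltW// gt_eqF ?implybT.
  rewrite mulrAC; apply: ler_wpM2r; first exact: powR_ge0.
  apply: (@le_trans _ _ (rc * (1 + T))); last by rewrite lerDl invr_ge0 ltW.
  rewrite mulrC; apply: ler_wpM2l => //.
  apply: (@le_trans _ _ (T `^ (2^-1 - theta))).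
    by apply: ge0_ler_powR => //; rewrite ?nnegrE; exact: ltW.
  apply: (@le_trans _ _ ((1 + T) `^ (2^-1 - theta))).
    by apply: ge0_ler_powR; rewrite ?nnegrE ?lerDr//; [exact: ltW|exact: ltW|rewrite addr_ge0// ltW].
  rewrite -[leRHS]powRr1; last by rewrite addr_ge0// ltW.
  by apply: ler_powR; [rewrite lerDl ltW|lra].
have Ct0 : 0 < C theta * tau `^ theta.
  apply: mulr_gt0; last exact: powR_gt0.
  by apply: ltr_wpDl; [rewrite mulr_ge0// addr_ge0// ltW|rewrite invr_gt0].
have Hs0E := Hs_normE (Hsq_fin Hu0).
(* The H^2 norm in time is an infimum over pairs of weak derivatives. Isolating it, by dividing by
   the positive factor [C theta * tau^theta], reduces the claim to one arbitrary pair. *)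
rewrite /data_norm Hs0E -lee_pdivrMl// -leeBlDl//.
apply: le_ereal_inf_tmp => _ [f1 [f2 [[fL f1L f2L] [wf wf1 ->]]]].
rewrite leeBlDl// lee_pdivrMl//.
rewrite -(time_normsqE mO fL) -(time_normsqE mO f1L) -(time_normsqE mO f2L).
pose N := time_normsq Omega lam phi s T f + time_normsq Omega lam phi s T f1 +
  time_normsq Omega lam phi s T f2.
rewrite -[X in (X `^ _)%E]/(N%:E) poweR_EFin.
have N0 : 0 <= N by rewrite !addr_ge0// time_normsq_ge0.
rewrite powR12_sqrt// -EFinD -EFinM.
have est := residual_estimate mO Lphi ortho complete T_gt0 g_gt0 g_lt1 Hu0 sol fL f1L f2L wf wf1 K0 tau0 KT.
set A2 := data_sq Omega lam phi s T u0 f f1 f2 in est *.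
have rc_ge0 : 0 <= residual_const T gamma.
  by rewrite mulr_ge0 ?sqr_ge0// mulr_ge0// addr_ge0// ltW.
have A20 : 0 <= A2 by exact: data_sq_ge0.
apply: (@le_trans _ _ (Num.sqrt (tau * (residual_const T gamma * A2)))%:E).
  have X0 : 0 <= tau * (residual_const T gamma * A2) by apply: mulr_ge0; [exact: ltW|exact: mulr_ge0].
  rewrite -(powR12_sqrt X0) -poweR_EFin /discrete_norm.
  apply: gt0_ler_poweR; rewrite ?in_itv/= ?invr_ge0 ?leey ?andbT//.
    apply: sume_ge0 => k _; apply: mule_ge0; first by rewrite lee_fin ltW.
    by apply: mule_ge0; exact: dual_norm_ge0.
rewrite lee_fin (sqrtrM _ (ltW tau0)) (sqrtrM _ rc_ge0) -/rc mulrA.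
have h0 : 0 <= fine (Hsq Omega lam phi s u0) by rewrite fine_ge0// Hsq_ge0.
apply: ler_pM => //; first by rewrite mulr_ge0// sqrtr_ge0.
(* The root of the sum of squares is at most the sum of the two roots. *)
rewrite -[leRHS]ger0_norm ?addr_ge0 ?sqrtr_ge0// -sqrtr_sqr.
rewrite ler_sqrt ?sqr_ge0// sqrrD !sqr_sqrtr//.
by rewrite /A2 /data_sq -/N [leRHS]addrAC lerDl mulrn_wge0// mulr_ge0// sqrtr_ge0.
Unshelve. all: by end_near.
Qed.
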